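(* Let $B\subset\mathbb{R}^2$ be the unit disk and let $k\ge 1$ be an integer such that $\mu_{k-1}(B)=\mu_k(B)$. Then $B$ is not a local minimizer for the problem $$\inf\{P(\Omega)^2\mu_{k-1}(\Omega) : \Omega\subset\mathbb{R}^2 \text{ nonempty, bounded, open and convex}\}.$$
   Context: For a nonempty bounded open convex set $\Omega\subset\mathbb{R}^2$, $P(\Omega)$ denotes its perimeter (length of the boundary), and $0=\mu_0(\Omega)<\mu_1(\Omega)\le\mu_2(\Omega)\le\cdots$ denote the eigenvalues, counted with multiplicity, of the Neumann Laplacian on $\Omega$: $\mu$ is an eigenvalue if there is $0\ne u\in H^1(\Omega)$ with $\int_\Omega\nabla u\cdot\nabla\varphi=\mu\int_\Omega u\varphi$ for all $\varphi\in H^1(\Omega)$. A set $\Omega_0$ is a local minimizer of a functional $F$ on the class of nonempty bounded open convex sets if there is $\delta>0$ such that $F(\Omega)\ge F(\Omega_0)$ for every $\Omega$ in the class whose closure is at Hausdorff distance less than $\delta$ from the closure of $\Omega_0$. *)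

(* Defs.v *)
(* The plane is [R * R]; its library topology, sigma-algebra
   and module structure are the usual ones, but its library norm is the sup
   norm, so every metric notion below goes through [edistance]. *)
From HB Require Import structures.
From mathcomp Require Import all_boot all_order all_algebra.
From mathcomp Require Import all_classical all_reals all_analysis.
Set Implicit Arguments.
Unset Strict Implicit.
Unset Printing Implicit Defensive.
Import Order.TTheory GRing.Theory Num.Theory.
Import numFieldNormedType.Exports.
Local Open Scope classical_set_scope.
Local Open Scope ring_scope.

Section Plane.
Context {R : realType}.
Local Notation plane := (R * R)%type.
Implicit Types (A B U Omega : set plane) (u v phi : plane -> R).

Local Notation leb2 := (@lebesgue_measure R \x @lebesgue_measure R)%E.

Definition edistance (x y : plane) : R :=
  Num.sqrt ((x.1 - y.1) ^+ 2 + (x.2 - y.2) ^+ 2).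

Definition unit_disk : set plane := [set x | x.1 ^+ 2 + x.2 ^+ 2 < 1].

Definition admissible Omega : Prop :=
  [/\ Omega !=set0, bounded_set Omega, open Omega & convex_set Omega].

Definition hausdorff_distance A B : \bar R :=
  let d x C : \bar R := ereal_inf [set (edistance x y)%:E | y in C] in
  maxe (ereal_sup [set d x B | x in A]) (ereal_sup [set d y A | y in B]).

(* The point 0 is added so that the empty set has diameter 0, not -oo. *)
Definition diameter U : \bar R :=
  ereal_sup (0%E |` [set (edistance z.1 z.2)%:E | z in U `*` U]).

(* One-dimensional Hausdorff (outer) measure; no normalising constant is
   needed in dimension one. *)
Definition hausdorff1 A : \bar R :=
  ereal_sup [set ereal_inf
    [set (\sum_(0 <= i <oo) diameter (U i))%E | U in
      [set U : (set plane)^nat |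
        A `<=` \bigcup_i U i /\ forall i, (diameter (U i) <= r%:E)%E]]
    | r in [set r : R | 0 < r]].

Definition perimeter Omega : \bar R :=
  hausdorff1 (closure Omega `\` interior Omega).

Definition e1 : plane := (1, 0).
Definition e2 : plane := (0, 1).

Definition iter_deriv (s : seq bool) phi : plane -> R :=
  foldr (fun (b : bool) f => 'D_(if b then e1 else e2) f) phi s.

Definition smooth phi : Prop := forall s : seq bool,
  continuous (iter_deriv s phi) /\
  forall x, derivable (iter_deriv s phi) x e1 /\
            derivable (iter_deriv s phi) x e2.

Definition test_function Omega phi : Prop :=
  smooth phi /\
  exists K : set plane,
    [/\ compact K, K `<=` Omega & forall x, ~ K x -> phi x = 0].

Definition L2 Omega u : Prop :=
  measurable_fun Omega u /\
  (\int[leb2]_(x in Omega) ((u x) ^+ 2)%:E < +oo)%E.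

Definition weak_derivative Omega (e : plane) (u g : plane -> R) : Prop :=
  forall phi, test_function Omega phi ->
  \int[leb2]_(x in Omega) (u x * 'D_e phi x) =
  - \int[leb2]_(x in Omega) (g x * phi x).

(* [H1 Omega u g]: u is in H^1(Omega), with weak gradient g. *)
Definition H1 Omega u (g : (plane -> R) * (plane -> R)) : Prop :=
  [/\ L2 Omega u, L2 Omega g.1, L2 Omega g.2,
      weak_derivative Omega e1 u g.1 & weak_derivative Omega e2 u g.2].

(* Membership in the eigenspace of l; the zero function is allowed. *)
Definition neumann_eigenspace Omega (l : R) u : Prop :=
  exists2 g, H1 Omega u g &
  forall phi h, H1 Omega phi h ->
  \int[leb2]_(x in Omega) (g.1 x * h.1 x + g.2 x * h.2 x) =
  l * \int[leb2]_(x in Omega) (u x * phi x).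

(* Linear independence as elements of L^2(Omega), i.e. modulo null sets. *)
Definition independent Omega n (u : 'I_n -> plane -> R) : Prop :=
  forall c : 'I_n -> R,
  (\forall x \ae leb2, Omega x -> \sum_(i < n) c i * u i x = 0) ->
  forall i, c i = 0.

(* The eigenspace of l has dimension at least n; for n = 1 this says that l is
   an eigenvalue. *)
Definition multiplicity_ge Omega (l : R) (n : nat) : Prop :=
  exists2 u : 'I_n -> plane -> R,
    forall i, neumann_eigenspace Omega l (u i) & independent Omega u.

(* A finite list of eigenvalues, none repeated beyond its multiplicity. *)
Definition eigenvalue_list Omega (s : seq R) : Prop :=
  forall l, multiplicity_ge Omega l (count_mem l s).

(* mu_k(Omega), numbered from 0: the least t such that k + 1 eigenvalues,
   counted with multiplicity, are <= t (+oo if there are fewer than k + 1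
   eigenvalues in all, which does not happen for admissible Omega). *)
Definition neumann_mu Omega (k : nat) : \bar R :=
  ereal_inf [set t%:E | t in [set t : R |
    exists s : seq R,
      [/\ size s = k.+1, eigenvalue_list Omega s & all (fun l => l <= t) s]]].

Definition local_minimizer (F : set plane -> \bar R) (Omega0 : set plane) :=
  exists2 delta : R, 0 < delta &
  forall Omega, admissible Omega ->
  (hausdorff_distance (closure Omega) (closure Omega0) < delta%:E)%E ->
  (F Omega0 <= F Omega)%E.

End Plane.

(* Main.v *)
From HB Require Import structures.
From mathcomp Require Import all_boot all_order all_algebra.
From mathcomp Require Import all_classical all_reals all_analysis.
From mathcomp Require Import measurable_realfun ring lra.
Require Import Defs.

(** Cutting a small cap off the disk decreases the perimeter by an amount of
    order [eta ^+ 3], where [eta] is the chord of one half of the arc that is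
    removed. Because the eigenvalue is double, the cap can be chosen such that the
    relative increase of the eigenvalue is of smaller order. All that is used of
    the eigenfunctions of the disk is that there are enough of them.

    Let [k] be the smaller one of the two indices with the same eigenvalue, and let
    [lam 0 <= ... <= lam (k + 1)] be obtained by successive minimisation of the
    Rayleigh quotient on the disk, with orthonormal eigenfunctions
    [u 0, ..., u (k + 1)]; the double eigenvalue is at least [lam (k + 1)].
    One dimension can then be sacrificed: the combinations of the [k + 2]
    eigenfunctions with mean zero over a cap form a space of dimension [k + 1] on
    which the energy is at most [lam (k + 1)] times the mass. Such a function has
    little mass in the cap, by the Poincaré inequality with the constant
    [O(eta ^+ 2)] of a convex set of diameter [O(eta)]: at most [O(eta ^+ 2)] times
    its energy there. Restricting to the rest of the disk gives, by min-max
    ([neumann_mu_cut]), an eigenvalue of index [k] that is at most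
    [lam (k + 1) / (1 - y)], where [y] is [O(eta ^+ 2)] times the energy of the
    eigenfunctions in the cap. About [1 / (3 * eta)] disjoint caps lie in a shell
    of thickness [O(eta)] along the boundary, whose energy tends to zero, so that
    one of the caps has energy [o(eta)] ([good_cap]); hence [y = o(eta ^+ 3)].
    Against this the perimeter drops by at least [eta ^+ 3 / 8] ([perimeter_cut]),
    because the arc is longer than two chords of length [eta], while the chord that
    replaces it has length [2 * eta * sqrt (1 - eta ^+ 2 / 4)]. As the cut domain
    converges to the disk, the disk is not a local minimizer. The eigenvalue has to
    be positive for the inequality to be strict, which is again the Poincaré
    inequality ([second_eigenvalue_gt0]).

    The rest of the text supplies the analysis. The Poincaré inequality on convex
    domains ([poincare]) holds for functions with weak derivatives because the
    increment of such a function along a vector is almost everywhere the integral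
    of its gradient along the segment ([line_identity_ae]); it is then averaged
    over all pairs of points. Eigenfunctions come from minimising the Rayleigh
    quotient ([spectral]); the minimisers exist because the Sobolev space is
    complete ([energy_graph_complete]) and because, by the Poincaré inequality on
    small convex cells, the mass is controlled by a small multiple of the energy and
    finitely many means ([energy_compact]). That there are enough test functions is
    seen from polynomials ([test_family]). The Hausdorff measure is bounded above
    by explicit covers ([premeasure_lipschitz_curve]) and below by separating the
    arcs and projecting each one onto a line ([premeasure_separated],
    [premeasure_ge_projection]). *)

Set Implicit Arguments.
Unset Strict Implicit.
Unset Printing Implicit Defensive.
Import Order.TTheory GRing.Theory Num.Theory.
Import numFieldNormedType.Exports.
Local Open Scope classical_set_scope.
Local Open Scope ring_scope.

(** * Area and affine maps of the plane *)

Notation leb := (@lebesgue_measure _).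
Notation leb2 := (leb \x leb)%E.
Notation mline R := (measurableTypeR R).
(** The plane with the product of the Borel structures of its factors, which is
    the domain of the area measure; it unfolds to [R * R]. *)
Notation mplane R := (measurableTypeR R * measurableTypeR R)%type.

Section AffineMaps.
Context {R : realType}.

Lemma measurable_affine (z s : R) :
  measurable_fun [set: mline R] (fun x : mline R => z + s * x : mline R).
Proof.
have H : measurable_fun [set: mline R] (fun x : mline R => z + s * x : R).
  apply: measurable_funD; first exact: measurable_cst.
  by apply: measurable_funM; [exact: measurable_cst|exact: measurable_id].
exact: H.
Qed.

(** Both sides are measures in [A] that agree on half-open intervals. *)
Lemma lebesgue_affine_preimage (z s : R) (A : set (mline R)) :
  s != 0 -> measurable A ->
  leb A = (`|s|%:E * leb ((fun x : R => z + s * x)%R @^-1` A))%E.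
Proof.
move=> s0 mA; have mT := measurable_affine z s.
pose m : {measure set (measurableTypeR R) -> \bar R} :=
  mscale (NngNum (normr_ge0 s)) (@measure_function_pushforward__canonical__measure_function_Measure _ _ _ _ R leb _ mT).
rewrite (@lebesgue_measure_unique R m)// => _ [[a b]] _ <-.
change (lebesgue_measure `]a, b] = `|s|%:E * leb ((fun x : R => z + s * x)%R @^-1` `]a, b]))%E.
have [sgt0|slt0] : 0 < s \/ s < 0 by move: s0; rewrite neq_lt => /orP[]; [right|left].
  have -> : (fun x : R => z + s * x) @^-1` `]a, b] = `](a - z) / s, (b - z) / s]%classic.
    apply/seteqP; split=> x /=; rewrite !in_itv /= ltr_pdivrMr// ler_pdivlMr// ltrBlDl lerBrDl [x * s]mulrC//.
  rewrite !lebesgue_measure_itv /= !lte_fin ltr_pM2r ?invr_gt0// ltrD2r gtr0_norm//.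
  case: ifP => ab; rewrite ?mule0// -!EFinD -EFinM; congr EFin.
  by field.
have -> : (fun x : R => z + s * x) @^-1` `]a, b] = `[(b - z) / s, (a - z) / s[%classic.
  by apply/seteqP; split=> x /=; rewrite !in_itv /= ler_ndivrMr// ltr_ndivlMr// ltrBlDl lerBrDl [x * s]mulrC// andbC.
rewrite !lebesgue_measure_itv /= !lte_fin ltr_nM2r ?invr_lt0// ltrD2r ltr0_norm//.
case: ifP => ab; rewrite ?mule0// -!EFinD -EFinM; congr EFin.
by field.
Qed.

Definition affine2 (z : R * R) (s : R) (x : R * R) : R * R :=
  (z.1 + s * x.1, z.2 + s * x.2).

Lemma measurable_affine2 z s :
  measurable_fun [set: mplane R] (affine2 z s : mplane R -> mplane R).
Proof.
apply: measurable_fun_pair.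
  by apply: measurableT_comp (measurable_affine _ _) _; exact: measurable_fst.
by apply: measurableT_comp (measurable_affine _ _) _; exact: measurable_snd.
Qed.

(** Both sides are measures in [A] that agree on rectangles. *)
Lemma leb2_affine_preimage (z : R * R) (s : R) (A : set (mplane R)) :
  s != 0 -> measurable A ->
  leb2 A = ((s ^+ 2)%:E * leb2 (affine2 z s @^-1` A))%E.
Proof.
move=> s0 mA; have mT := measurable_affine2 z s.
pose m : {measure set (mplane R) -> \bar R} := mscale (NngNum (sqr_ge0 s))
  (measure_function_pushforward__canonical__measure_function_Measure (@lebesgue_measure R \x @lebesgue_measure R)%E mT).
suff H : forall B C : set (mline R), measurable B -> measurable C ->
    m (B `*` C) = (leb B * leb C)%E.
  exact: (@product_measure_unique _ _ _ _ R leb leb m H A mA).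
move=> {mA}A B mA1 mB.
have E : affine2 z s @^-1` (A `*` B) =
  ((fun x => z.1 + s * x) @^-1` A) `*` ((fun x => z.2 + s * x) @^-1` B) by [].
change ((s ^+ 2)%:E * leb2 (affine2 z s @^-1` (A `*` B)) = leb A * leb B)%E.
rewrite E product_measure1E//.
- rewrite (lebesgue_affine_preimage z.1 s0 mA1) (lebesgue_affine_preimage z.2 s0 mB).
  by rewrite -real_normK ?num_real// expr2 EFinM muleACA.
- by rewrite -[X in measurable X]setTI; exact: measurable_affine.
- by rewrite -[X in measurable X]setTI; exact: measurable_affine.
Qed.

Lemma ge0_integral_affine2 (z : R * R) (s : R) (f : mplane R -> \bar R) :
  s != 0 -> measurable_fun setT f -> (forall x, 0 <= f x)%E ->
  (\int[leb2]_x f x = (s ^+ 2)%:E * \int[leb2]_x f (affine2 z s x))%E.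
Proof.
move=> s0 mf f0; have mT := measurable_affine2 z s.
pose p : {measure set (mplane R) -> \bar R} :=
  measure_function_pushforward__canonical__measure_function_Measure (@lebesgue_measure R \x @lebesgue_measure R)%E mT.
pose m : {measure set (mplane R) -> \bar R} := mscale (NngNum (sqr_ge0 s)) p.
rewrite (@eq_measure_integral _ _ _ _ m); last first.
  by move=> A mA _; exact: leb2_affine_preimage.
transitivity (((s ^+ 2)%:E * \int[p]_x f x)%E).
  exact: (@ge0_integral_mscale _ _ _ p setT measurableT (NngNum (sqr_ge0 s)) f mf (fun x _ => f0 x)).
have := (@ge0_integral_pushforward _ _ _ _ _ _ mT leb2 setT f measurableT mf (fun x _ => f0 x)).
rewrite preimage_setT => E.
by rewrite (_ : (\int[p]_x f x)%E = (\int[leb2]_x f (affine2 z s x))%E).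
Qed.

Lemma ge0_integral_shift (h : R * R) (f : mplane R -> \bar R) :
  measurable_fun setT f -> (forall x, 0 <= f x)%E ->
  (\int[leb2]_x f (x.1 + h.1, x.2 + h.2)%R = \int[leb2]_x f x)%E.
Proof.
move=> mf f0; rewrite (ge0_integral_affine2 h (oner_neq0 R) mf f0).
rewrite expr1n mul1e; apply: eq_integral => x _; rewrite /affine2.
by rewrite !mul1r ![_ + h.1]addrC ![_ + h.2]addrC.
Qed.

Lemma integral_shift (h : R * R) (f : mplane R -> \bar R) :
  measurable_fun setT f ->
  (\int[leb2]_x f (x.1 + h.1, x.2 + h.2)%R = \int[leb2]_x f x)%E.
Proof.
move=> mf; rewrite integralE [RHS]integralE.
rewrite -(ge0_integral_shift h (measurable_funepos mf)); last by [].
rewrite -(ge0_integral_shift h (measurable_funeneg mf)); last by [].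
rewrite (_ : (fun x => f^\+ _)%E = (fun x0 : mplane R => f ((x0.1 + h.1)%R, (x0.2 + h.2)%R))^\+%E); last first.
  by apply/funext => x; rewrite !funeposE.
rewrite (_ : (fun x => f^\- _)%E = (fun x0 : mplane R => f ((x0.1 + h.1)%R, (x0.2 + h.2)%R))^\-%E)//.
by apply/funext => x; rewrite !funenegE.
Qed.

Lemma measurable_shift (h : R * R) :
  measurable_fun [set: mplane R] (fun x => (x.1 + h.1, x.2 + h.2) : mplane R).
Proof.
rewrite (_ : (fun _ => _) = affine2 h 1); first exact: measurable_affine2.
by apply/funext => x; rewrite /affine2 !mul1r [h.1 + _]addrC [h.2 + _]addrC.
Qed.

(** A box given by the rational coordinates of its centre and its half-width. *)
Definition ratbox (q : rat * rat * rat) : set (R * R) :=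
  `]ratr q.1.1 - ratr q.2, ratr q.1.1 + ratr q.2[ `*`
  `]ratr q.1.2 - ratr q.2, ratr q.1.2 + ratr q.2[.

Definition cratbox (q : rat * rat * rat) : set (R * R) :=
  `[ratr q.1.1 - ratr q.2, ratr q.1.1 + ratr q.2] `*`
  `[ratr q.1.2 - ratr q.2, ratr q.1.2 + ratr q.2].

Lemma open_ratbox (A : set (R * R)) x : open A -> A x ->
  exists q, [/\ 0 < (ratr q.2 : R), ratbox q x & cratbox q `<=` A].
Proof.
move=> oA Ax.
have /nbhs_ballP[e /= e0 xeA] : nbhs x A by exact: open_nbhs_nbhs.
have [r] := @rat_in_itvoo R 0 (e / 2) (divr_gt0 e0 (ltr0n _ 2)).
rewrite in_itv/= => /andP[r0 re].
have near_rat (y : R) : exists q, `|y - ratr q| < ratr r.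
  have [q] := @rat_in_itvoo R (y - ratr r) (y + ratr r) ltac:(lra).
  by rewrite in_itv/= => qr; exists q; rewrite ltr_norml; lra.
have [q1 hq1] := near_rat x.1; have [q2 hq2] := near_rat x.2.
have inI (y : R) q : `|y - ratr q| < ratr r <->
    y \in `]ratr q - ratr r, ratr q + ratr r[.
  by rewrite in_itv/= ltr_norml; split => /andP[? ?]; apply/andP; split; lra.
have inC (y : R) q : `|y - ratr q| <= ratr r <->
    y \in `[ratr q - ratr r, ratr q + ratr r].
  by rewrite in_itv/= ler_norml; split => /andP[? ?]; apply/andP; split; lra.
exists (q1, q2, r); split => //; first by split; apply/inI.
move=> [y1 y2] [/= /inC h1 /inC h2]; apply: xeA; split => /=.
  rewrite /ball/= (le_lt_trans (ler_distD (ratr q1) _ _))//.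
  by rewrite [`|ratr q1 - y1|]distrC; lra.
rewrite /ball/= (le_lt_trans (ler_distD (ratr q2) _ _))//.
by rewrite [`|ratr q2 - y2|]distrC; lra.
Qed.

(** Rational boxes form a countable basis of the plane. *)
Lemma open_measurable2 (A : set (R * R)) : open A -> @measurable _ (mplane R) A.
Proof.
move=> oA.
have -> : A = \bigcup_(q in [set q | ratbox q `<=` A]) (ratbox q : set (mplane R)).
  apply/seteqP; split=> [x Ax|x [q /= qA]]; last exact: qA.
  have [q [_ qx qA]] := open_ratbox oA Ax; exists q => //= y qy; apply: qA.
  by move: qy => [/subset_itv_oo_cc h1 /subset_itv_oo_cc h2]; split.
rewrite bigcup_mkcond; apply: countable_bigcupT_measurable => [|q].
  exact: countableP.
case: ifPn => _; last exact: measurable0.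
by apply: measurableX; exact: measurable_itv.
Qed.

End AffineMaps.

(** A name for the area measure that carries its sigma-finiteness, so that it
    can be a factor of a further product. *)
Definition area {R : realType} : set (mplane R) -> \bar R :=
  (@lebesgue_measure R \x @lebesgue_measure R)%E.

HB.instance Definition _ (R : realType) := Measure.copy (@area R)
  (@lebesgue_measure R \x @lebesgue_measure R)%E.

Lemma area_sigma_finite {R : realType} : sigma_finite setT (@area R).
Proof.
have /sigma_finiteP[F [TF ndF Foo]] := sigma_finiteT (@lebesgue_measure R).
exists (fun n => F n `*` F n).
  rewrite -setXTT TF predeqE => -[x y]; split.
    move=> [/= [n _ Fnx] [k _ Gky]]; exists (maxn n k) => //; split.
      by move: x Fnx; exact/subsetPset/ndF/leq_maxl.
    by move: y Gky; exact/subsetPset/ndF/leq_maxr.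
  by move=> [n _ []/= ? ?]; split; exists n.
move=> k; have [? ?] := Foo k; split; first exact: measurableX.
rewrite /area product_measure1E// lte_mul_pinfty// ge0_fin_numE//.
Qed.

HB.instance Definition _ (R : realType) :=
  Measure_isSigmaFinite.Build _ _ _ (@area R) area_sigma_finite.

Lemma plane_tonelli (R : realType) (f : mplane R * mplane R -> \bar R) : 
  measurable_fun setT f -> (forall x, 0 <= f x)%E -> 
  (\int[leb2]_x \int[leb2]_y f (x, y) = \int[leb2]_y \int[leb2]_x f (x, y))%E.
Proof. exact: (@fubini_tonelli _ _ _ _ R area area). Qed.

(** * Smooth bumps *)

Section SmoothFunctions.
Context {R : realType}.

(** The functions [x^-k exp(-1/x)], extended by zero to the left of the
    origin: all of them are [O(x^2)] at the origin, which makes their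
    derivative vanish there. *)
Definition flatexp (k : nat) (x : R) : R :=
  if 0 < x then x^-1 ^+ k * expR (- x^-1) else 0.

Lemma flatexp_ge0 k x : 0 <= flatexp k x.
Proof.
rewrite /flatexp; case: ifP => // x0.
by rewrite mulr_ge0 ?expR_ge0// exprn_ge0// invr_ge0 ltW.
Qed.

(** The exponential series bounds [x^-(k+2)] by a multiple of [exp(1/x)]. *)
Lemma flatexp_le k x : flatexp k x <= (k.+2)`!%:R * x ^+ 2.
Proof.
rewrite /flatexp; case: ifP => [x0|_]; last by rewrite mulr_ge0// sqr_ge0.
have y0 : 0 < x^-1 by rewrite invr_gt0.
have := expR_ge1Dxn k.+1 (ltW y0).
set E := expR x^-1 => hE.
have fk : 0 < (k.+2)`!%:R :> R by rewrite ltr0n fact_gt0.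
have {}hE : x^-1 ^+ k.+2 <= (k.+2)`!%:R * E.
  by rewrite mulrC -ler_pdivrMr//; apply: le_trans hE; rewrite lerDr.
rewrite expRN -/E ler_pdivrMr ?expR_gt0//.
have := ler_wpM2r (sqr_ge0 x) hE; rewrite !exprS.
have -> : x^-1 * (x^-1 * x^-1 ^+ k) * (x * (x * x ^+ 0)) = x^-1 ^+ k.
  by rewrite expr0; field; rewrite gt_eqF.
by move=> H; rewrite (le_trans H)// expr0 mulr1; lra.
Qed.

Lemma flatexp_derive k (x : R) :
  is_derive x (1 : R) (flatexp k) (flatexp k.+2 x - k%:R * flatexp k.+1 x).
Proof.
have [x0|x0|->] := ltgtP x 0.
- rewrite /flatexp [0 < x]ltNge (ltW x0)/= mulr0 subr0.
  have d0 : is_derive x (1 : R) (fun _ : R => 0 : R) 0 by exact: is_derive_cst.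
  apply: near_eq_is_derive d0.
  near=> y; rewrite ifF//; apply/negbTE; rewrite -leNgt ltW//.
  by near: y; exact: lt_nbhsl.
- rewrite {2 3}/flatexp x0.
  apply: (@near_eq_is_derive _ _ _ (fun y : R => y^-1 ^+ k * expR (- y^-1))).
  + near=> y; rewrite /flatexp ifT//; near: y; exact: lt_nbhsr.
  + have xn0 : x != 0 by rewrite gt_eqF.
    have d1 : is_derive x 1 (fun y : R => y^-1) (- x ^- 2).
      have H : is_derive x (1 : R) (fun y : R => (id y)^-1) (- x ^- 2 *: (1 : R)).
        by apply: is_deriveV.
      by apply: (is_derive_eq H); rewrite /GRing.scale /= mulr1.
    have d2 : is_derive x 1 (fun y : R => y^-1 ^+ k) (k%:R * x^-1 ^+ k.-1 * (- x ^- 2)).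
      have H := @is_deriveX _ _ (fun y : R => y^-1) k x 1 _ d1.
      have E : (fun y : R => y^-1 ^+ k) = (fun y : R => y^-1) ^+ k.
        by apply/funext => y; rewrite exprfctE.
      by rewrite E.
    have d3 : is_derive x 1 (fun y : R => expR (- y^-1)) (x ^- 2 * expR (- x^-1)).
      have := @is_derive1_comp R expR (fun y : R => - y^-1) x (expR (- x^-1)) (x ^- 2) _ _.
      move=> H; rewrite mulrC; apply: H.
      by apply: is_derive_eq; rewrite opprK.
    apply: is_derive_eq; rewrite /GRing.scale /=.
    by case: k {d2} => [|k]; rewrite /= ?expr0 ?exprS; field.
- rewrite /flatexp ltxx mulr0 subr0.
  suff H : (fun h : R => h^-1 *: (((flatexp k) \o shift 0) (h *: (1 : R)) - flatexp k 0)) @ 0^' --> (0 : R).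
    by split; [apply/cvg_ex; exists 0; exact: H|exact/cvg_lim].
  apply/cvgrPdist_le => /= e e0; near=> h.
  have hn0 : h != 0 by near: h; exact: nbhs_dnbhs_neq.
  rewrite sub0r normrN /flatexp ltxx subr0 /= addr0 /GRing.scale /= mulr1 -/(flatexp k h).
  rewrite normrM normfV (ger0_norm (flatexp_ge0 _ _)) ler_pdivrMl ?normr_gt0//.
  apply: (le_trans (flatexp_le _ _)); rewrite -real_normK ?num_real// expr2 mulrA mulrC.
  rewrite ler_wpM2l// -ler_pdivlMl ?ltr0n ?fact_gt0//.
  near: h; apply: nbhs_dnbhs; exists ((k.+2)`!%:R^-1 * e) => /=.
    by rewrite mulr_gt0// invr_gt0 ltr0n fact_gt0.
  by move=> y /=; rewrite sub0r normrN => /ltW.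
Unshelve. all: by end_near. Qed.

(** Smoothness as membership in a family closed under differentiation, which
    spares writing down the derivatives of all orders. *)
Definition smooth1 (f : R -> R) := exists D : set (R -> R), D f /\
  forall g, D g -> exists2 g', D g' & forall x, is_derive x (1 : R) g (g' x).

(** The bump is [flatexp 0] composed with a concave parabola; this family is
    closed under differentiation and contains it. *)
Inductive bump_family (c a b : R) : (R -> R) -> Prop :=
| bump_flat k : bump_family c a b (fun x => flatexp k (c * ((x - a) * (b - x))))
| bump_lin p q f : bump_family c a b f ->
    bump_family c a b (fun x => (p * x + q) * f x)
| bump_add f g : bump_family c a b f -> bump_family c a b g ->
    bump_family c a b (fun x => f x + g x).

Definition bump (n : nat) (a b x : R) : R :=
  flatexp 0 (n.+1%:R * ((x - a) * (b - x))).

Lemma smooth1_bump n a b : smooth1 (bump n a b).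
Proof.
exists (bump_family n.+1%:R a b); split; first exact: (bump_flat _ _ _ 0).
set c : R := n.+1%:R.
move=> g; elim=> [k|p q f Df [f' Df' ff']|f h Df [f' Df' ff'] Dh [h' Dh' hh']].
- exists (fun x => ((-2 * c) * x + c * (a + b)) * flatexp k.+2 (c * ((x - a) * (b - x))) +
     (0 * x + - k%:R) * (((-2 * c) * x + c * (a + b)) * flatexp k.+1 (c * ((x - a) * (b - x))))).
    by apply: bump_add; [|apply: bump_lin]; apply: bump_lin; apply: bump_flat.
  move=> x.
  have dw : is_derive x 1 (fun x : R => c * ((x - a) * (b - x))) ((-2 * c) * x + c * (a + b)).
    apply: is_derive_eq; rewrite /GRing.scale /=; lra.
  have := @is_derive1_comp R (flatexp k) _ x _ _ (flatexp_derive k _) dw.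
  move=> H; apply: (is_derive_eq H); set u := flatexp _ _; set v := flatexp _ _; lra.
- exists (fun x => (0 * x + p) * f x + (p * x + q) * f' x).
    by apply: bump_add; apply: bump_lin.
  move=> x; apply: is_derive_eq; rewrite /GRing.scale /=; lra.
- exists (fun x => f' x + h' x); first exact: bump_add.
  by move=> x; apply: is_deriveD.
Qed.

Lemma smooth1_derive f : smooth1 f ->
  exists2 f', smooth1 f' & forall x, is_derive x (1 : R) f (f' x).
Proof.
by move=> [D [Df /[dup] hD /(_ _ Df)[f' Df' ff']]]; exists f' => //; exists D.
Qed.

Lemma smooth1_continuous f : smooth1 f -> continuous f.
Proof.
move=> /smooth1_derive[f' _ ff'] x; apply: differentiable_continuous.
by apply/derivable1_diffP; case: (ff' x).
Qed.

Lemma bump_out n a b x : x <= a \/ b <= x -> a < b -> bump n a b x = 0.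
Proof.
move=> xab ab; rewrite /bump /flatexp ifF//; apply/negbTE; rewrite -leNgt pmulr_rle0//.
by case: xab => h; nra.
Qed.

Lemma bump_ge0 n a b x : 0 <= bump n a b x.
Proof. exact: flatexp_ge0. Qed.

Lemma bump_le1 n a b x : bump n a b x <= 1.
Proof.
rewrite /bump /flatexp; case: ifP => // h.
by rewrite expr0 mul1r -[leRHS]expR0 ler_expR oppr_le0 invr_ge0; exact: ltW.
Qed.

(** The bumps steepen to the indicator of an interval, which turns identities
    tested on smooth functions into identities of integrals over boxes. *)
Lemma bump_cvg a b x : a < b ->
  (fun n => bump n a b x) @ \oo --> (\1_(`]a, b[%classic) x : R).
Proof.
move=> ab; have [xab|xab] := boolP (x \in `]a, b[).
  rewrite indicE mem_set//=.
  have w0 : 0 < (x - a) * (b - x) by move: xab; rewrite in_itv/= => /andP[? ?]; nra.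
  have -> : (fun n => bump n a b x) =
     (fun n => expR (- ((x - a) * (b - x))^-1 * n.+1%:R^-1)).
    apply/funext => n; rewrite /bump /flatexp pmulr_rgt0// w0 expr0 mul1r invfM mulNr; congr (expR (- _)); exact: mulrC.
  set c := - _; have H : (fun n => expR (c * n.+1%:R^-1)) @ \oo --> expR (c * 0).
    apply: continuous_cvg; first exact: continuous_expR.
    by apply: cvgM; [exact: cvg_cst|exact: cvg_harmonic].
  by move: H; rewrite mulr0 expR0.
rewrite indicE memNset//=; last exact/negP.
rewrite (_ : (fun n => _) = cst 0); first exact: cvg_cst.
apply/funext => n; apply: bump_out => //.
by move: xab; rewrite in_itv/= negb_and -!leNgt => /orP.
Qed.

End SmoothFunctions.

(** * Tensor products as test functions *)

Section TestFunctions.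
Context {R : realType}.
Implicit Types (f g : R -> R) (x : R * R).

Definition tensor f g x : R := f x.1 * g x.2.

Lemma tensor_derive1 f g (f' : R) x : is_derive x.1 (1 : R) f f' ->
  is_derive x (@e1 R) (tensor f g) (f' * g x.2).
Proof.
move=> [/cvg_ex[l fl] ff'].
have {ff'}El : l = f' by rewrite -ff'; apply/esym/cvg_lim.
move: fl; rewrite {}El => fl.
suff H : (fun h : R => h^-1 *: ((tensor f g \o shift x) (h *: @e1 R) - tensor f g x)) @ 0^' --> f' * g x.2.
  by split; [apply/cvg_ex; exists (f' * g x.2); exact: H|exact/cvg_lim].
rewrite (_ : (fun h : R => _) =
  (fun h => h^-1 *: ((f \o shift x.1) (h *: (1 : R)) - f x.1) * g x.2)).
  by apply: cvgM; [exact: fl|exact: cvg_cst].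
apply/funext => h; rewrite /tensor /= /GRing.scale /= mulr0 add0r; ring.
Qed.

Lemma tensor_derive2 f g (g' : R) x : is_derive x.2 (1 : R) g g' ->
  is_derive x (@e2 R) (tensor f g) (f x.1 * g').
Proof.
move=> [/cvg_ex[l fl] ff'].
have {ff'}El : l = g' by rewrite -ff'; apply/esym/cvg_lim.
move: fl; rewrite {}El => fl.
suff H : (fun h : R => h^-1 *: ((tensor f g \o shift x) (h *: @e2 R) - tensor f g x)) @ 0^' --> f x.1 * g'.
  by split; [apply/cvg_ex; exists (f x.1 * g'); exact: H|exact/cvg_lim].
rewrite (_ : (fun h : R => _) =
  (fun h => f x.1 * (h^-1 *: ((g \o shift x.2) (h *: (1 : R)) - g x.2)))).
  by apply: cvgM; [exact: cvg_cst|exact: fl].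
apply/funext => h; rewrite /tensor /= /GRing.scale /= mulr0 add0r; ring.
Qed.

Lemma tensor_continuous f g : continuous f -> continuous g -> continuous (tensor f g).
Proof.
move=> cf cg x; apply: cvgM.
  by apply: (@cvg_comp _ _ _ fst f _ (nbhs x.1)); [exact: cvg_fst|exact: cf].
by apply: (@cvg_comp _ _ _ snd g _ (nbhs x.2)); [exact: cvg_snd|exact: cg].
Qed.

Lemma smooth_tensor f g : smooth1 f -> smooth1 g -> smooth (tensor f g).
Proof.
move=> sf sg.
have H s : exists f' g', [/\ smooth1 f', smooth1 g' &
    iter_deriv s (tensor f g) = tensor f' g'].
  elim: s => [|b s [f1 [g1 [sf1 sg1 E]]]]; first by exists f, g.
  have [f2 sf2 df] := smooth1_derive sf1; have [g2 sg2 dg] := smooth1_derive sg1.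
  rewrite /= E; case: b.
    exists f2, g1; split => //; apply/funext => x.
    by have [_ ->] := tensor_derive1 g1 (df x.1).
  exists f1, g2; split => //; apply/funext => x.
  by have [_ ->] := tensor_derive2 f1 (dg x.2).
move=> s; have [f1 [g1 [sf1 sg1 ->]]] := H s; split.
  by apply: tensor_continuous; exact: smooth1_continuous.
have [f2 sf2 df] := smooth1_derive sf1; have [g2 sg2 dg] := smooth1_derive sg1.
by move=> x; split; [case: (tensor_derive1 g1 (df x.1))|case: (tensor_derive2 f1 (dg x.2))].
Qed.

Lemma test_function_tensor (Omega : set (R * R)) f g (a b c d : R) :
  smooth1 f -> smooth1 g ->
  (forall t, ~ `[a, b]%classic t -> f t = 0) ->
  (forall t, ~ `[c, d]%classic t -> g t = 0) ->
  `[a, b]%classic `*` `[c, d]%classic `<=` Omega -> test_function Omega (tensor f g).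
Proof.
move=> sf sg f0 g0 sub; split; first exact: smooth_tensor.
exists (`[a, b]%classic `*` `[c, d]%classic); split => //.
  by apply: compact_setX; exact: segment_compact.
move=> x /not_andP[|] h; rewrite /tensor; first by rewrite f0 ?mul0r.
by rewrite g0 ?mulr0.
Qed.

End TestFunctions.

(** * Integration over the unit interval *)

Lemma EFin_Rintegral d (T : measurableType d) (R : realType)
    (mu : {measure set T -> \bar R}) (D : set T) (f : T -> R) : measurable D ->
  mu.-integrable D (EFin \o f) ->
  (\int[mu]_(x in D) f x)%:E = (\int[mu]_(x in D) (f x)%:E)%E.
Proof. by move=> mD fi; rewrite fineK//; exact: integrable_fin_num. Qed.

Section FubiniUnitInterval.
Context d (T : measurableType d) (R : realType).
Variable mu : {sigma_finite_measure set T -> \bar R}.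

(** A bound on the norms that is uniform over the interval is all that is needed
    to average over a segment and over the plane in either order. *)
Lemma Rfubini01 (A : R -> T -> R) (C : R) :
  measurable_fun setT (fun p : mline R * T => A p.1 p.2) ->
  (forall t, `[0, 1]%classic t -> (\int[mu]_x (`|A t x|)%:E <= C%:E)%E) ->
  [/\ mu.-integrable setT (EFin \o (fun x => \int[leb]_(t in `[0, 1]) A t x)),
  {ae mu, forall x, leb.-integrable `[0, 1] (EFin \o A^~ x)} &
  \int[mu]_x (\int[leb]_(t in `[0, 1]) A t x) =
    \int[leb]_(t in `[0, 1]) (\int[mu]_x A t x)].
Proof.
move=> mA AC.
pose I01 : set (mline R) := `[0, 1]%classic.
have mI : measurable I01 by exact: measurable_itv.
pose F (p : mline R * T) := (A p.1 p.2 * \1_I01 p.1)%:E.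
have mF : measurable_fun setT F.
  apply/measurable_EFinP; apply: measurable_funM => //.
  by apply: measurableT_comp (measurable_fst); exact: measurable_indic.
have mAt t : measurable_fun setT (A t) by exact: (measurable_fun_pair2 t mA).
have iAt t : I01 t -> mu.-integrable setT (EFin \o A t).
  move=> It; apply/integrableP; split; first exact/measurable_EFinP.
  by apply: le_lt_trans (AC t It) _; rewrite ltry.
have iF : (leb \x mu)%E.-integrable setT F.
  apply/(integrable12ltyP _ _ mF).
  apply: (@le_lt_trans _ _ (\int[leb]_(t in I01) C%:E)%E).
    rewrite [leRHS]integral_mkcond; apply: ge0_le_integral => //.
    - by move=> t _; exact: integral_ge0.
    - apply: (@measurable_fun_fubini_tonelli_F _ _ _ _ _ mu (abse \o F)).
        exact: measurableT_comp.
      by move=> p; exact: abse_ge0.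
    - by apply/(measurable_restrictT _ _).1 => //; exact: measurable_cst.
    - move=> t _; rewrite /patch; case: ifPn => tI.
        apply: le_trans (AC t (set_mem tI)); apply: ge0_le_integral => //.
        + by apply: measurableT_comp => //; apply: (measurable_fun_pair2 t mF).
        + by apply/measurable_EFinP; apply: measurableT_comp.
        + by move=> x _; rewrite /F /= indicE tI mulr1.
      under eq_integral do rewrite /F /= indicE (negbTE tI) mulr0 normr0.
      by rewrite integral0.
  have muI : @lebesgue_measure R `[0, 1]%classic = 1%E.
    by rewrite lebesgue_measure_itv/= lte_fin ltr01 -EFinB subr0.
  rewrite integral_cst// [X in (_ * X)%E](_ : _ = 1%E); last exact: muI.
  by rewrite mule1 ltry.
have inner1 t : (\int[mu]_x F (t, x) = ((fun t => \int[mu]_x A t x) \_ I01 t)%:E)%E.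
  rewrite /patch; case: ifPn => tI.
    rewrite EFin_Rintegral//; last exact/iAt/set_mem.
    by apply: eq_integral => x _; rewrite /F /= indicE tI mulr1.
  under eq_integral do rewrite /F /= indicE (negbTE tI) mulr0.
  by rewrite integral0.
have inner2 x : (\int[leb]_t F (t, x) = \int[leb]_(t in I01) (A t x)%:E)%E.
  rewrite [RHS]integral_mkcond; apply: eq_integral => t _.
  by rewrite /F /= indicE /patch; case: ifPn; rewrite ?mulr1// mulr0.
pose G x := (\int[leb]_t F (t, x))%E.
have iG : mu.-integrable setT G.
  have mG : measurable_fun setT G := measurable_fubini_G iF.
  apply/integrableP; split => //.
  apply: le_lt_trans ((integrable21ltyP _ _ mF).1 iF); apply: ge0_le_integral => //.
  - exact: measurableT_comp.
  - apply: (@measurable_fun_fubini_tonelli_G _ _ _ _ _ leb (abse \o F)).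
      exact: measurableT_comp.
    by move=> p; exact: abse_ge0.
  - by move=> x _; apply: le_abse_integral => //; exact: (measurable_fun_pair1 x mF).
have FG x : (EFin \o (fun x => \int[leb]_(t in `[0, 1]) A t x)) x = (fine (G x))%:E.
  by rewrite /G inner2.
have mfG : measurable_fun setT (fun x => (fine (G x))%:E).
  by apply/measurable_EFinP; apply: measurableT_comp => //; exact: measurable_int iG.
have fG : mu.-integrable setT (fun x => (fine (G x))%:E).
  apply: le_integrable iG => // x _.
  by case: (G x) => [r| |] //=; rewrite normr0 leey.
split; first by rewrite (_ : _ \o _ = (fun x => (fine (G x))%:E))//; apply/funext.
  have [N [mN N0 sub]] := ae_integrable2 iF.
  exists N; split => // x /= xN; apply: sub => /= H; apply: xN.
  apply/(integrable_mkcond _ mI); apply: eq_integrable H => // t _.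
  by rewrite /F /= indicE /patch; case: ifPn; rewrite ?mulr1// mulr0.
have E : (\int[mu]_x (fine (G x))%:E = \int[mu]_x G x)%E.
  apply: ae_eq_integral => //; first exact: measurable_int iG.
  have [N [mN N0 sub]] := integrable_ae measurableT iG.
  exists N; split => // x /= xN; apply: sub => /= H; apply: xN => _.
  by rewrite fineK// H.
rewrite [RHS]Rintegral_mkcond /Rintegral.
under [in LHS]eq_integral do rewrite -inner2.
rewrite -/(Rintegral mu setT (fun x => fine (G x))) /Rintegral E.
rewrite -(Fubini iF); congr fine.
by apply: eq_integral => t _; rewrite inner1.
Qed.

End FubiniUnitInterval.

(** The previous lemma for the area measure, whose sigma-finiteness is carried
    by another name of it. *)
Lemma plane_Rfubini01 (R : realType) (A : R -> mplane R -> R) (C : R) :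
  measurable_fun setT (fun p : mline R * mplane R => A p.1 p.2) ->
  (forall t, `[0, 1]%classic t -> (\int[leb2]_x (`|A t x|)%:E <= C%:E)%E) ->
  [/\ leb2.-integrable setT (EFin \o (fun x => \int[leb]_(t in `[0, 1]) A t x)),
  {ae (leb2 : set (mplane R) -> \bar R),
     forall x, leb.-integrable `[0, 1] (EFin \o A^~ x)} &
  \int[leb2]_x (\int[leb]_(t in `[0, 1]) A t x) =
    \int[leb]_(t in `[0, 1]) (\int[leb2]_x A t x)].
Proof. exact: (@Rfubini01 _ _ R area). Qed.

(** * Square-integrable functions *)

Section CompactlySupportedSmooth.
Context {R : realType}.
Implicit Types (f g : R -> R) (a b c d : R).

Definition supp1 f a b := forall t, ~ `[a, b]%classic t -> f t = 0.

Lemma smooth1_shift f (v : R) : smooth1 f -> smooth1 (fun t => f (t - v)).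
Proof.
move=> [D [Df clD]].
exists [set k | exists2 k0, D k0 & k = fun t => k0 (t - v)]; split; first by exists f.
move=> _ [k0 /clD[k1 Dk1 dk] ->]; exists (fun t => k1 (t - v)); first by exists k1.
move=> x; have := @is_derive1_comp R k0 (fun t : R => t - v) x (k1 (x - v)) 1 (dk _) _.
rewrite mulr1; apply; apply: is_derive_eq; exact: subr0.
Qed.

Lemma supp1_shift f a b v : supp1 f a b -> supp1 (fun t => f (t - v)) (a + v) (b + v).
Proof.
move=> f0 t /= tab; apply: f0; rewrite /= in_itv/= => h; apply: tab.
by move: h; rewrite in_itv/= lerBrDr lerBlDr.
Qed.

Lemma smooth1_supp_derive f a b : smooth1 f -> supp1 f a b ->
  exists f', [/\ smooth1 f', supp1 f' a b & forall x, is_derive x (1 : R) f (f' x)].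
Proof.
move=> /smooth1_derive[f' sf' df] f0; exists f'; split => // t tab.
have d0 : is_derive t (1 : R) (fun _ : R => 0 : R) 0 by exact: is_derive_cst.
have [_ <-] := df t; have [_ <-] := d0; apply: near_eq_derive.
have /closed_openC oC : closed `[a, b]%classic by exact: interval_closed.
have : nbhs t (~` `[a, b]%classic) by exact: open_nbhs_nbhs.
by apply: filterS => s /f0.
Qed.

Lemma smooth1_bounded f a b : smooth1 f -> supp1 f a b ->
  exists M : R, forall t, `|f t| <= M.
Proof.
move=> sf f0; have [ab|ba] := leP a b; last first.
  exists 0 => t; rewrite f0 ?normr0//= in_itv/= => /andP[h1 h2].
  by have := le_trans h1 h2; rewrite leNgt ba.
have cf : {within `[a, b], continuous (fun t => `|f t|)}.
  apply: continuous_subspaceT => x; apply: continuous_comp.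
    exact: smooth1_continuous.
  exact: norm_continuous.
have [z zab zmax] := EVT_max ab cf; exists `|f z| => t.
have [tab|tab] := boolP (t \in `[a, b]); first exact: zmax.
by rewrite f0 ?normr0//; exact/negP.
Qed.

Lemma smooth1_measurable f : smooth1 f -> measurable_fun [set: mline R] (f : mline R -> R).
Proof. by move=> sf; apply: continuous_measurable_fun; exact: smooth1_continuous. Qed.

Lemma tensor_measurable f g : smooth1 f -> smooth1 g ->
  measurable_fun [set: mplane R] (tensor f g : mplane R -> R).
Proof.
move=> sf sg; apply: measurable_funM.
  by apply: measurableT_comp (smooth1_measurable sf) _; exact: measurable_fst.
by apply: measurableT_comp (smooth1_measurable sg) _; exact: measurable_snd.
Qed.

Lemma tensor_bounded f g a b c d : smooth1 f -> smooth1 g -> supp1 f a b ->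
  supp1 g c d -> exists M : R, forall x, `|tensor f g x| <= M.
Proof.
move=> sf sg f0 g0; have [M1 h1] := smooth1_bounded sf f0.
have [M2 h2] := smooth1_bounded sg g0; exists (M1 * M2) => x.
by rewrite normrM ler_pM.
Qed.

End CompactlySupportedSmooth.

Section PlaneSets.
Context {R : realType}.
Implicit Type Omega : set (R * R).

Lemma bounded_leb2_lty Omega : bounded_set Omega ->
  @measurable _ (mplane R) Omega -> (leb2 (Omega : set (mplane R)) < +oo)%E.
Proof.
move=> [M [Mr bM]] mO.
pose N := Num.max 0 M + 1.
have sub : Omega `<=` `[- N, N]%classic `*` `[- N, N]%classic.
  move=> x Ox; have : `|x| <= N.
    by apply: (bM N) => //; rewrite /N ltr_pwDr// le_max lexx orbT.
  by rewrite /Num.norm /= /mx_norm ge_max => /andP[h1 h2]; split; rewrite /= in_itv/= -ler_norml.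
pose B : set (mplane R) := `[- N, N]%classic `*` `[- N, N]%classic.
have mI : @measurable _ (mline R) `[- N, N]%classic by exact: measurable_itv.
have mB : measurable B by exact: measurableX.
apply: (@le_lt_trans _ _ (leb2 B)); first by apply: le_measure; rewrite ?inE.
rewrite product_measure1E//.
have muI : @lebesgue_measure R `[- N, N]%classic = (N - - N)%:E.
  rewrite lebesgue_measure_itv/= lte_fin ifT ?EFinB//.
  have : 0 < N by rewrite /N ltr_wpDl// le_max lexx.
  by lra.
rewrite [ltLHS](_ : _ = ((N - - N)%:E * (N - - N)%:E)%E); last by rewrite -muI.
by rewrite -EFinM ltry.
Qed.

Lemma admissible_measurable Omega : admissible Omega -> @measurable _ (mplane R) Omega.
Proof. by case=> _ _ oO _; exact: open_measurable2. Qed.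

Lemma admissible_lty Omega : admissible Omega -> (leb2 (Omega : set (mplane R)) < +oo)%E.
Proof.
by move=> aO; apply: bounded_leb2_lty; [case: aO|exact: admissible_measurable].
Qed.

Lemma convex_setE Omega : convex_set Omega <->
  forall x y (t : R), Omega x -> Omega y -> 0 <= t <= 1 ->
    Omega (t * x.1 + (1 - t) * y.1, t * x.2 + (1 - t) * y.2).
Proof.
split=> [cO x y t Ox Oy /andP[t0 t1]|cO x y l].
  have := cO x y (Itv01 t0 t1) (mem_set Ox) (mem_set Oy).
  by rewrite inE.
rewrite !inE => Ox Oy; have := cO x y l%:num Ox Oy.
by apply; rewrite ge0 le1.
Qed.

End PlaneSets.

Section L2Functions.
Context {R : realType}.
Implicit Types (Omega : set (R * R)) (u v : R * R -> R).

Lemma L2_measurable Omega u : L2 Omega u ->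
  @measurable_fun _ _ (mplane R) _ Omega u.
Proof. by case. Qed.

Lemma L2_measurableT Omega u : @measurable _ (mplane R) Omega -> L2 Omega u ->
  @measurable_fun _ _ (mplane R) _ setT (u \_ Omega).
Proof. by move=> mO [mu _]; exact/(measurable_restrictT _ _).1. Qed.

Lemma L2_integrable_sqr Omega u : L2 Omega u ->
  leb2.-integrable Omega (EFin \o (fun x => u x ^+ 2)).
Proof.
move=> [mu fu]; apply/integrableP; split.
  by apply/measurable_EFinP; apply: measurable_funX; exact: mu.
rewrite (eq_integral (fun x : mplane R => (u x ^+ 2)%:E))// => x _ /=.
by rewrite ger0_norm// sqr_ge0.
Qed.

Lemma L2_integrableM Omega u v : @measurable _ (mplane R) Omega ->
  L2 Omega u -> L2 Omega v -> leb2.-integrable Omega (EFin \o (fun x => u x * v x)).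
Proof.
move=> mO Lu Lv.
have := integrableD mO (L2_integrable_sqr Lu) (L2_integrable_sqr Lv).
apply: le_integrable => //.
  by apply/measurable_EFinP; apply: measurable_funM; exact: L2_measurable.
move=> x _ /=; rewrite lee_fin [leRHS]ger0_norm ?addr_ge0 ?sqr_ge0//.
by rewrite ler_norml; apply/andP; split; nra.
Qed.

Lemma L2_cst Omega (c : R) : @measurable _ (mplane R) Omega ->
  (leb2 (Omega : set (mplane R)) < +oo)%E -> L2 Omega (fun=> c).
Proof.
move=> mO fO; split; first exact: measurable_cst.
by rewrite integral_cst// lte_mul_pinfty ?lee_fin ?sqr_ge0.
Qed.

Lemma L2_integrable Omega u : @measurable _ (mplane R) Omega ->
  (leb2 (Omega : set (mplane R)) < +oo)%E -> L2 Omega u ->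
  leb2.-integrable Omega (EFin \o u).
Proof.
move=> mO fO Lu; have := L2_integrableM mO Lu (L2_cst 1 mO fO).
by apply: eq_integrable => // x _ /=; rewrite mulr1.
Qed.

Lemma L2_integrableT Omega u : @measurable _ (mplane R) Omega ->
  (leb2 (Omega : set (mplane R)) < +oo)%E -> L2 Omega u ->
  leb2.-integrable setT (EFin \o (u \_ Omega)).
Proof.
by move=> mO fO /(L2_integrable mO fO)/(integrable_mkcond _ mO); rewrite restrict_EFin.
Qed.

Lemma L2D Omega u v : @measurable _ (mplane R) Omega ->
  L2 Omega u -> L2 Omega v -> L2 Omega (fun x => u x + v x).
Proof.
move=> mO Lu Lv; split.
  by have [mu _] := Lu; have [mv _] := Lv; exact: measurable_funD.
have i2 := integrableD mO (integrableD mO (L2_integrable_sqr Lu) (L2_integrable_sqr Lv))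
  (integrableD mO (L2_integrableM mO Lu Lv) (L2_integrableM mO Lu Lv)).
have := integrable_lty mO i2; congr (_ < _)%E.
by apply: eq_integral => x _ /=; rewrite -!EFinD; congr EFin; ring.
Qed.

Lemma L2Z Omega u (c : R) : @measurable _ (mplane R) Omega ->
  L2 Omega u -> L2 Omega (fun x => c * u x).
Proof.
move=> mO Lu; split.
  by have [mu _] := Lu; apply: measurable_funM => //; exact: measurable_cst.
have := integrable_lty mO (integrableZl mO (c ^+ 2) (L2_integrable_sqr Lu)).
by congr (_ < _)%E; apply: eq_integral => x _ /=; rewrite -EFinM exprMn.
Qed.

Lemma L2_sub Omega A u : @measurable _ (mplane R) Omega ->
  @measurable _ (mplane R) A -> A `<=` Omega -> L2 Omega u -> L2 A u.
Proof.
move=> mO mA AO [mu fu]; split; first exact: measurable_funS mu.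
apply: le_lt_trans fu; apply: ge0_subset_integral => //.
- by apply/measurable_EFinP; apply: measurable_funX; exact: mu.
- by move=> x _; rewrite lee_fin sqr_ge0.
Qed.

End L2Functions.

(** * Increments of a Sobolev function along a vector *)

Section LineIdentity.
Context {R : realType}.
Implicit Types (Omega : set (R * R)) (u : R * R -> R).

Lemma L2_bounded Omega u (M : R) : @measurable _ (mplane R) Omega ->
  (leb2 (Omega : set (mplane R)) < +oo)%E ->
  @measurable_fun _ _ (mplane R) _ Omega u -> (forall x, Omega x -> `|u x| <= M) -> L2 Omega u.
Proof.
move=> mO fO mu uM; split; first exact: mu.
have iM : (\int[leb2]_(x in Omega) (M ^+ 2)%:E < +oo)%E by case: (L2_cst M mO fO).
apply: le_lt_trans iM; apply: ge0_le_integral => //.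
- by move=> x _; rewrite lee_fin sqr_ge0.
- by apply/measurable_EFinP; apply: measurable_funX; exact: mu.
- move=> x Ox; rewrite lee_fin -[leLHS]real_normK ?num_real//.
  by rewrite ler_pXn2r ?nnegrE ?(le_trans (normr_ge0 _) (uM _ Ox)) ?uM.
Qed.

Lemma RintegralT Omega (f : R * R -> R) :
  \int[leb2]_(x in Omega) f x = \int[leb2]_x (f \_ Omega) x.
Proof. exact: Rintegral_mkcond. Qed.

Lemma restrM Omega (f k : R * R -> R) : (fun x => f x * k x) \_ Omega = (fun x => (f \_ Omega) x * k x).
Proof. by apply/funext => x; rewrite !patchE; case: ifPn => // _; rewrite mul0r. Qed.

Variables (Omega : set (R * R)) (u : R * R -> R) (g : (R * R -> R) * (R * R -> R)).
Hypotheses (aO : admissible Omega) (H1u : H1 Omega u g).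
Variables (h : R * R).

Let mO : @measurable _ (mplane R) Omega := admissible_measurable aO.
Let fO : (leb2 (Omega : set (mplane R)) < +oo)%E := admissible_lty aO.

Definition dirgrad (x : R * R) := h.1 * g.1 x + h.2 * g.2 x.

(** The gradient is extended by zero, so that the integrand makes sense for the
    points from which the segment leaves the domain. *)
Definition line_integral (x : R * R) : R :=
  \int[leb]_(t in `[0, 1]) (dirgrad \_ Omega) (x.1 + t * h.1, x.2 + t * h.2).

Lemma L2_dirgrad : L2 Omega dirgrad.
Proof. by case: H1u => _ L1 L2' _ _; apply: L2D => //; exact: L2Z. Qed.

Section Tensor.
Variables (f1 f2 f1' f2' : R -> R) (a b c d : R).
Hypotheses (sf1 : smooth1 f1) (sf2 : smooth1 f2) (sf1' : smooth1 f1') (sf2' : smooth1 f2').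
Hypotheses (s1 : supp1 f1 a b) (s2 : supp1 f2 c d) (s1' : supp1 f1' a b) (s2' : supp1 f2' c d).
Hypotheses (d1 : forall x, is_derive x (1 : R) f1 (f1' x)).
Hypotheses (d2 : forall x, is_derive x (1 : R) f2 (f2' x)).

Let k x := h.1 * tensor f1' f2 x + h.2 * tensor f1 f2' x.

(** The weak derivative in an arbitrary direction, tested on a tensor. *)
Lemma weak_dirgrad : `[a, b]%classic `*` `[c, d]%classic `<=` Omega ->
  \int[leb2]_x ((u \_ Omega) x * k x) =
  - \int[leb2]_x ((dirgrad \_ Omega) x * tensor f1 f2 x).
Proof.
move=> sub; have tf := test_function_tensor sf1 sf2 s1 s2 sub.
case: H1u => Lu L1 L2' /(_ _ tf) W1 /(_ _ tf) W2.
have E1 x : 'D_(@e1 R) (tensor f1 f2) x = tensor f1' f2 x.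
  by have [_ ->] := tensor_derive1 f2 (d1 x.1).
have E2 x : 'D_(@e2 R) (tensor f1 f2) x = tensor f1 f2' x.
  by have [_ ->] := tensor_derive2 f1 (d2 x.2).
have LT (p q : R -> R) : smooth1 p -> smooth1 q -> supp1 p a b -> supp1 q c d ->
    L2 Omega (tensor p q).
  move=> sp sq p0 q0; have [M tM] := tensor_bounded sp sq p0 q0.
  apply: (@L2_bounded _ _ M) => //.
  by apply: measurable_funTS; exact: tensor_measurable.
rewrite -restrM -RintegralT -restrM -RintegralT.
have I1 := L2_integrableM mO Lu (LT _ _ sf1' sf2 s1' s2).
have I2 := L2_integrableM mO Lu (LT _ _ sf1 sf2' s1 s2').
have I3 := L2_integrableM mO L1 (LT _ _ sf1 sf2 s1 s2).
have I4 := L2_integrableM mO L2' (LT _ _ sf1 sf2 s1 s2).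
have -> : \int[leb2]_(x in Omega) (u x * k x) =
   h.1 * \int[leb2]_(x in Omega) (u x * tensor f1' f2 x) +
   h.2 * \int[leb2]_(x in Omega) (u x * tensor f1 f2' x).
  rewrite -!RintegralZl//.
  rewrite -RintegralD//.
  - by apply: eq_Rintegral => x _; rewrite /k; ring.
  - exact: (integrableZl mO h.1 I1).
  - exact: (integrableZl mO h.2 I2).
rewrite (_ : \int[leb2]_(x in Omega) (u x * tensor f1' f2 x) = - \int[leb2]_(x in Omega) (g.1 x * tensor f1 f2 x)); last first.
  by rewrite -W1; apply: eq_Rintegral => x _; rewrite E1.
rewrite (_ : \int[leb2]_(x in Omega) (u x * tensor f1 f2' x) = - \int[leb2]_(x in Omega) (g.2 x * tensor f1 f2 x)); last first.
  by rewrite -W2; apply: eq_Rintegral => x _; rewrite E2.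
have -> : \int[leb2]_(x in Omega) (dirgrad x * tensor f1 f2 x) =
   h.1 * \int[leb2]_(x in Omega) (g.1 x * tensor f1 f2 x) +
   h.2 * \int[leb2]_(x in Omega) (g.2 x * tensor f1 f2 x).
  rewrite -!RintegralZl//.
  rewrite -RintegralD//.
  - by apply: eq_Rintegral => x _; rewrite /dirgrad; ring.
  - exact: (integrableZl mO h.1 I3).
  - exact: (integrableZl mO h.2 I4).
by ring.
Qed.

(** The fundamental theorem of calculus along the segment from [x] to
    [x - h]. *)
Lemma tensor_FTC (x : R * R) :
  tensor f1 f2 (x.1 - h.1, x.2 - h.2) - tensor f1 f2 x =
  - \int[leb]_(t in `[0, 1]) k (x.1 - t * h.1, x.2 - t * h.2).
Proof.
pose F (t : R) := - (f1 (x.1 - t * h.1) * f2 (x.2 - t * h.2)).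
have dl (z v t : R) : is_derive t (1 : R) (fun t : R => z - t * v) (- v).
  by apply: is_derive_eq; rewrite /GRing.scale /=; ring.
have dF t : is_derive t (1 : R) F (k (x.1 - t * h.1, x.2 - t * h.2)).
  have D1 := @is_derive1_comp R f1 (fun t : R => x.1 - t * h.1) t _ _ (d1 _) (dl _ _ _).
  have D2 := @is_derive1_comp R f2 (fun t : R => x.2 - t * h.2) t _ _ (d2 _) (dl _ _ _).
  have D := is_deriveN (is_deriveM D1 D2).
  by apply: (is_derive_eq D); rewrite /k /tensor /GRing.scale /=; ring.
have cF : continuous F.
  by move=> t; apply: differentiable_continuous; apply/derivable1_diffP; case: (dF t).
have ck : continuous (fun t : R => k (x.1 - t * h.1, x.2 - t * h.2)).
  have cl (p : R -> R) (z v : R) : smooth1 p -> continuous (fun t : R => p (z - t * v)).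
    move=> sp t; apply: (@continuous_comp _ _ _ (fun t : R => z - t * v) p).
      by apply: differentiable_continuous; apply/derivable1_diffP; case: (dl z v t).
    exact: smooth1_continuous.
  move=> t; apply: cvgD; apply: cvgM; try exact: cvg_cst.
    by apply: cvgM; exact: cl.
  by apply: cvgM; exact: cl.
rewrite /Rintegral (@continuous_FTC2 _ _ F).
- by rewrite /F /= !mul1r !mul0r !subr0 /tensor /=; ring.
- exact: ltr01.
- exact: continuous_subspaceT.
- split; first by move=> t _; case: (dF t).
    by apply: cvg_at_right_filter; exact: cF.
  by apply: cvg_at_left_filter; exact: cF.
- by move=> t _; rewrite derive1E; case: (dF t).
Qed.

End Tensor.
End LineIdentity.

Section LineIdentityTested.
Context {R : realType}.
Implicit Types (w : R * R -> R).

Lemma measurable_along (h : R * R) w : @measurable_fun _ _ (mplane R) _ setT w ->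
  measurable_fun setT (fun p : mline R * mplane R =>
     w (p.2.1 + p.1 * h.1, p.2.2 + p.1 * h.2)).
Proof.
move=> mw; apply: (@measurableT_comp _ _ _ _ (mplane R) _ w) => //.
have m1 : measurable_fun setT (fun p : mline R * mplane R => p.1 : R) by exact: measurable_fst.
have m2 : measurable_fun setT (fun p : mline R * mplane R => p.2.1 : R).
  by apply: (measurableT_comp measurable_fst); exact: measurable_snd.
have m3 : measurable_fun setT (fun p : mline R * mplane R => p.2.2 : R).
  by apply: (measurableT_comp measurable_snd); exact: measurable_snd.
apply: measurable_fun_pair.
  have H : measurable_fun setT (fun p : mline R * mplane R => (p.2.1 + p.1 * h.1 : R)).
    by apply: measurable_funD => //; apply: measurable_funM => //; exact: measurable_cst.
  exact: H.
have H : measurable_fun setT (fun p : mline R * mplane R => (p.2.2 + p.1 * h.2 : R)).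
  by apply: measurable_funD => //; apply: measurable_funM => //; exact: measurable_cst.
exact: H.
Qed.

Lemma integral_abs_shift (v : R * R) w : @measurable_fun _ _ (mplane R) _ setT w ->
  (\int[leb2]_x (`|w (x.1 + v.1, x.2 + v.2)|)%:E = \int[leb2]_x (`|w x|)%:E)%E.
Proof.
move=> mw; apply: (@ge0_integral_shift R v (fun x : mplane R => (`|w x|)%:E)).
  by apply/measurable_EFinP; apply: measurableT_comp.
by move=> x; rewrite lee_fin.
Qed.

Lemma Rintegral_shift (v : R * R) w : @measurable_fun _ _ (mplane R) _ setT w ->
  \int[leb2]_x w (x.1 + v.1, x.2 + v.2) = \int[leb2]_x w x.
Proof.
move=> mw; rewrite /Rintegral; congr fine.
by apply: (@integral_shift R v (EFin \o w)); exact/measurable_EFinP.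
Qed.

Lemma integrable_bounded_mul w (q : R * R -> R) (M : R) :
  leb2.-integrable (setT : set (mplane R)) (EFin \o w) ->
  @measurable_fun _ _ (mplane R) _ setT q ->
  (forall x, `|q x| <= M) -> leb2.-integrable (setT : set (mplane R)) (EFin \o (fun x => w x * q x)).
Proof.
move=> iw mq qM; have := integrableZl measurableT M iw; apply: le_integrable => //.
  apply/measurable_EFinP; apply: measurable_funM => //.
  by apply/measurable_EFinP; exact: measurable_int iw.
move=> x _ /=; rewrite lee_fin !normrM mulrC ler_wpM2r// (le_trans (qM x))//.
exact: ler_norm.
Qed.

Variables (Omega : set (R * R)) (u : R * R -> R) (g : (R * R -> R) * (R * R -> R)).
Hypotheses (aO : admissible Omega) (H1u : H1 Omega u g).
Variables (h : R * R).

Let mO : @measurable _ (mplane R) Omega := admissible_measurable aO.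
Let fO : (leb2 (Omega : set (mplane R)) < +oo)%E := admissible_lty aO.
Let U : R * R -> R := u \_ Omega.
Let G : R * R -> R := (dirgrad g h) \_ Omega.

Let iU : leb2.-integrable (setT : set (mplane R)) (EFin \o U).
Proof. by apply: L2_integrableT => //; case: H1u. Qed.

Let iG : leb2.-integrable (setT : set (mplane R)) (EFin \o G).
Proof. by apply: L2_integrableT => //; exact: L2_dirgrad H1u h. Qed.

Let mU : @measurable_fun _ _ (mplane R) _ setT U.
Proof. by apply/measurable_EFinP; exact: measurable_int iU. Qed.

Let mG : @measurable_fun _ _ (mplane R) _ setT G.
Proof. by apply/measurable_EFinP; exact: measurable_int iG. Qed.

Lemma line_integral_integrable :
  leb2.-integrable (setT : set (mplane R)) (EFin \o line_integral Omega g h) /\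
  {ae (leb2 : set (mplane R) -> \bar R), forall x, leb.-integrable `[0, 1]
     (EFin \o (fun t => G (x.1 + t * h.1, x.2 + t * h.2)))}.
Proof.
pose A (t : R) (x : mplane R) := G (x.1 + t * h.1, x.2 + t * h.2).
have [||] := @plane_Rfubini01 R A (fine (\int[leb2]_x (`|G x|)%:E)).
- exact: measurable_along.
- move=> t _; rewrite (integral_abs_shift (t * h.1, t * h.2) mG) fineK//.
  exact: (integrable_fin_num measurableT (integrable_norm iG)).
- by move=> I1 I2 _; split.
Qed.

Variables (f1 f2 : R -> R) (a b c d : R).
Hypotheses (sf1 : smooth1 f1) (sf2 : smooth1 f2) (s1 : supp1 f1 a b) (s2 : supp1 f2 c d).

(** Moving the translation to the test function [psi] turns the increment of [u]
    into [u] tested against [psi (x - h) - psi x], which is an average over the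
    segment of derivatives of translates of [psi]. The weak gradient moves these
    derivatives to [u], and undoing the translations gives the line integral. By
    convexity the translates of the supporting box stay inside the domain. *)
Lemma line_identity_tensor :
  `[a, b]%classic `*` `[c, d]%classic `<=` Omega ->
  (forall x, (`[a, b]%classic `*` `[c, d]%classic) x -> Omega (x.1 + h.1, x.2 + h.2)) ->
  \int[leb2]_x ((U (x.1 + h.1, x.2 + h.2) - U x) * tensor f1 f2 x) =
  \int[leb2]_x (line_integral Omega g h x * tensor f1 f2 x).
Proof.
move=> sub subh.
have [f1' [sf1' s1' d1]] := smooth1_supp_derive sf1 s1.
have [f2' [sf2' s2' d2]] := smooth1_supp_derive sf2 s2.
set psi := tensor f1 f2.
pose k x := h.1 * tensor f1' f2 x + h.2 * tensor f1 f2' x.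
have mpsi : @measurable_fun _ _ (mplane R) _ setT psi by exact: tensor_measurable.
have mk : @measurable_fun _ _ (mplane R) _ setT k.
  by apply: measurable_funD; apply: measurable_funM; try exact: measurable_cst;
    exact: tensor_measurable.
have [M psiM] : exists M, forall x, `|psi x| <= M by exact: tensor_bounded s1 s2.
have [N kN] : exists N, forall x, `|k x| <= N.
  have [N1 h1] := tensor_bounded sf1' sf2 s1' s2.
  have [N2 h2] := tensor_bounded sf1 sf2' s1 s2'.
  exists (`|h.1| * N1 + `|h.2| * N2) => x; apply: (le_trans (ler_normD _ _)).
  by apply: lerD; rewrite normrM; apply: ler_wpM2l.
have mAn v (q : R * R -> R) : @measurable_fun _ _ (mplane R) _ setT q ->
    @measurable_fun _ _ (mplane R) _ setT (fun x => q (x.1 + v.1, x.2 + v.2)).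
  by move=> mq; apply: (@measurableT_comp _ _ _ _ (mplane R) _ q) => //; exact: measurable_shift.
have iUh : leb2.-integrable (setT : set (mplane R)) (EFin \o (fun x => U (x.1 + h.1, x.2 + h.2))).
  apply/integrableP; split; first by apply/measurable_EFinP; exact: mAn.
  by rewrite (integral_abs_shift h mU); case/integrableP : iU.
have iUpsi := integrable_bounded_mul iU mpsi psiM.
have iUhpsi := integrable_bounded_mul iUh mpsi psiM.
have psih : forall x, `|psi (x.1 - h.1, x.2 - h.2)| <= M by move=> x; exact: psiM.
have mpsih : @measurable_fun _ _ (mplane R) _ setT (fun x => psi (x.1 - h.1, x.2 - h.2)).
  exact: (mAn (- h.1, - h.2)).
have iUpsih := integrable_bounded_mul iU mpsih psih.
have -> : \int[leb2]_x ((U (x.1 + h.1, x.2 + h.2) - U x) * psi x) =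
    \int[leb2]_x (U x * psi (x.1 - h.1, x.2 - h.2)) - \int[leb2]_x (U x * psi x).
  rewrite -(Rintegral_shift h (w := fun x => U x * psi (x.1 - h.1, x.2 - h.2))) /=; last first.
    exact: measurable_funM.
  rewrite -RintegralB//=; first last.
    by apply: eq_integrable iUhpsi => // x _ /=; rewrite !addrK.
  by apply: eq_Rintegral => x _; rewrite !addrK /=; case: (x) => ? ? /=; ring.
rewrite -RintegralB//=.
pose A1 (t : R) (x : mplane R) := - U x * k (x.1 - t * h.1, x.2 - t * h.2).
have mkA : measurable_fun setT (fun p : mline R * mplane R =>
     k (p.2.1 - p.1 * h.1, p.2.2 - p.1 * h.2)).
  have := measurable_along (- h.1, - h.2) mk; congr measurable_fun.
  by apply/funext => p /=; rewrite !mulrN.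
have mk1 (x : R * R) : measurable_fun setT (fun t : mline R => k (x.1 - t * h.1, x.2 - t * h.2)).
  exact: (measurable_fun_pair1 (x : mplane R) mkA).
have I01 : (@lebesgue_measure R `[0%R, 1%R]%classic < +oo)%E.
  by rewrite lebesgue_measure_itv/= lte_fin ltr01 -EFinB ltry.
have mI01 : @measurable _ (mline R) `[0%R, 1%R]%classic by exact: measurable_itv.
have ik (x : R * R) : leb.-integrable `[0, 1]
    (EFin \o (fun t => k (x.1 - t * h.1, x.2 - t * h.2))).
  apply: measurable_bounded_integrable => //; first exact: measurable_funTS.
  by exists N; split; [exact: num_real|move=> y Ny t _; exact: le_trans (kN _) (ltW Ny)].
have Nge0 : 0 <= N by exact: le_trans (kN h).
pose C := fine (\int[leb2]_x (`|U x|)%:E)%E.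
have CE : (\int[leb2]_x (`|U x|)%:E)%E = C%:E.
  by rewrite fineK//; exact: (integrable_fin_num measurableT (integrable_norm iU)).
have mabs w : @measurable_fun _ _ (mplane R) _ setT w ->
    @measurable_fun _ _ (mplane R) _ setT (fun x => (`|w x|)%:E).
  by move=> mw; apply/measurable_EFinP; apply: measurableT_comp.
have [||iA1 _ EA1] := @plane_Rfubini01 R A1 (N * C).
- apply: measurable_funM => //.
  by apply: measurableT_comp => //; apply: (measurableT_comp mU); exact: measurable_snd.
- move=> t _; rewrite EFinM -CE -ge0_integralZl_EFin//; last exact: mabs.
  apply: ge0_le_integral => //.
  + apply: mabs; apply: measurable_funM; first exact: measurableT_comp.
    exact: (measurable_fun_pair2 t mkA).
  + by apply: emeasurable_funM => //; exact: mabs.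
  + by move=> x _; rewrite -EFinM lee_fin normrM normrN mulrC ler_wpM2r.
transitivity (\int[leb2]_x \int[leb]_(t in `[0, 1]) A1 t x).
  apply: eq_Rintegral => x _; rewrite RintegralZl//.
  by rewrite -mulrBr (tensor_FTC h sf1 sf2 sf1' sf2' d1 d2) mulrN mulNr.
rewrite {}EA1.
pose A3 (t : R) (x : mplane R) := G (x.1 + t * h.1, x.2 + t * h.2) * psi x.
have box_t t : 0 <= t <= 1 ->
    `[a + t * h.1, b + t * h.1]%classic `*` `[c + t * h.2, d + t * h.2]%classic `<=` Omega.
  move=> t01 x [/= x1 x2].
  have Bx : (`[a, b]%classic `*` `[c, d]%classic) (x.1 - t * h.1, x.2 - t * h.2).
    by move: x1 x2; rewrite /= !in_itv/= !lerBrDr !lerBlDr.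
  case: aO => _ _ _ /convex_setE cO.
  have := cO _ _ t (subh _ Bx) (sub _ Bx) t01.
  by congr Omega; case: (x) => y1 y2 /=; congr (_, _); ring.
have E13 t : `[0, 1]%classic t -> \int[leb2]_x A1 t x = \int[leb2]_x A3 t x.
  rewrite /= in_itv/= => t01.
  have W := weak_dirgrad aO H1u h (smooth1_shift (t * h.1) sf1) (smooth1_shift (t * h.2) sf2)
    (smooth1_shift (t * h.1) sf1') (smooth1_shift (t * h.2) sf2')
    (supp1_shift (v := t * h.1) s1) (supp1_shift (v := t * h.2) s2)
    (supp1_shift (v := t * h.1) s1') (supp1_shift (v := t * h.2) s2').
  have ds (p p' : R -> R) (v : R) : (forall x, is_derive x (1 : R) p (p' x)) ->
      forall x, is_derive x (1 : R) (fun s => p (s - v)) (p' (x - v)).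
    move=> dp x; have := @is_derive1_comp R p (fun t : R => t - v) x (p' (x - v)) 1 (dp _) _.
    by rewrite mulr1; apply; apply: is_derive_eq; exact: subr0.
  have {}W := W (ds _ _ _ d1) (ds _ _ _ d2) (box_t t t01).
  rewrite -(Rintegral_shift (- (t * h.1), - (t * h.2)) (w := A3 t)); last first.
    by apply: measurable_funM => //; exact: (mAn (t * h.1, t * h.2)).
  rewrite (_ : \int[leb2]_x A1 t x = - \int[leb2]_x (U x * k (x.1 - t * h.1, x.2 - t * h.2))).
    rewrite [X in - X = _]W opprK; apply: eq_Rintegral => x _.
    by rewrite /A3 /= !subrK; case: (x).
  have iUk := integrable_bounded_mul iU (mAn (- (t * h.1), - (t * h.2)) _ mk) (fun x => kN _).
  rewrite -[RHS]mulN1r -RintegralZl//; apply: eq_Rintegral => x _.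
  by rewrite /A1 mulN1r mulNr.
transitivity (\int[leb]_(t in `[0, 1]) \int[leb2]_x A3 t x).
  by apply: eq_Rintegral => t; rewrite inE => /E13.
pose D := fine (\int[leb2]_x (`|G x|)%:E)%E.
have DE : (\int[leb2]_x (`|G x|)%:E)%E = D%:E.
  by rewrite fineK//; exact: (integrable_fin_num measurableT (integrable_norm iG)).
have Mge0 : 0 <= M by exact: le_trans (psiM h).
have [||iA3 _ <-] := @plane_Rfubini01 R A3 (M * D).
- apply: measurable_funM; first exact: (measurable_along h mG).
  by apply: (measurableT_comp mpsi); exact: measurable_snd.
- move=> t _; rewrite EFinM -DE -(integral_abs_shift (t * h.1, t * h.2) mG).
  have mGt := mAn (t * h.1, t * h.2) _ mG.
  rewrite -ge0_integralZl_EFin//; last exact: mabs.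
  apply: ge0_le_integral => //.
  + by apply: mabs; exact: measurable_funM.
  + by apply: emeasurable_funM => //; exact: mabs.
  + by move=> x _; rewrite -EFinM lee_fin normrM mulrC ler_wpM2r.
have [iL [Z [mZ Z0 sub0]]] := line_integral_integrable.
rewrite /Rintegral; congr fine; apply: ae_eq_integral => //.
- exact: measurable_int iA3.
- exact: measurable_int (integrable_bounded_mul iL mpsi psiM).
- exists Z; split => // x /= xZ; apply: sub0 => /= ix; apply: xZ => _.
  congr EFin; rewrite -RintegralZr//.
Qed.

End LineIdentityTested.

(** * Functions whose integrals over boxes vanish *)

Section NullIntegrals.

(** Sets over which an integrable function integrates to zero form a Dynkin
    class, also when they are pulled back along a measurable map. *)
Lemma integral_preimage_dynkin d d' (S : measurableType d) (T : measurableType d')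
    (R : realType) (mu : {measure set S -> \bar R}) (phi : S -> T) (Q : set S)
    (F : S -> \bar R) (G : set (set T)) :
  measurable_fun setT phi -> measurable Q -> mu.-integrable Q F ->
  @measurable _ T = <<s G >> -> setI_closed G ->
  (\int[mu]_(x in Q) F x = 0)%E ->
  (forall A, G A -> \int[mu]_(x in phi @^-1` A `&` Q) F x = 0)%E ->
  forall A, measurable A -> (\int[mu]_(x in phi @^-1` A `&` Q) F x = 0)%E.
Proof.
move=> mphi mQ iF GE GI Q0 GA A; rewrite GE.
have mpre B : measurable B -> measurable (phi @^-1` B).
  by move=> mB; rewrite -[X in measurable X]setTI; exact: mphi.
have mF := measurable_int _ iF.
apply: (@dynkin_induction _ T G (fun A => (\int[mu]_(x in phi @^-1` A `&` Q) F x = 0)%E)) => //.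
- by rewrite preimage_setT setTI.
- move=> B mB IB.
  have mB' := measurableI _ _ (mpre _ mB) mQ.
  have mC' := measurableI _ _ (mpre _ (measurableC mB)) mQ.
  have EQ : Q = (phi @^-1` B `&` Q) `|` (phi @^-1` (~` B) `&` Q).
    by rewrite preimage_setC -setIUl setUv setTI.
  move: Q0; rewrite {1}EQ integral_setU//.
  + by rewrite IB add0e.
  + by rewrite -EQ.
  + by apply/disj_set2P; apply/seteqP; split => x //= [[? _] [? _]].
- move=> B mB tB IB.
  rewrite preimage_bigcup setI_bigcupl integral_bigcup//.
  + by rewrite eseries0//.
  + apply/trivIsetP => i j _ _ ij; move/trivIsetP : tB => /(_ i j Logic.I Logic.I ij) E.
    by rewrite setIACA -preimage_setI E preimage_set0 set0I.
  + by move=> k; apply: measurableI => //; exact: mpre.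
  + apply: integrableS iF => //; last by move=> x [k _ []].
    by apply: bigcup_measurable => k _; apply: measurableI => //; exact: mpre.
Qed.

Context {R : realType}.

Lemma rays_setI_closed : setI_closed (@RGenOInfty.G R).
Proof.
move=> _ _ [x ->] [y ->]; exists (Num.max x y).
by apply/seteqP; split => z /=; rewrite !in_itv/= !andbT gt_max => /andP.
Qed.

(** The vanishing of the integral passes from boxes to all products by applying
    the Dynkin argument to one coordinate at a time, and hence to all measurable
    sets. *)
Lemma null_on_box (F : mplane R -> \bar R) (a b c d : R) :
  leb2.-integrable (`]a, b[%classic `*` `]c, d[%classic) F ->
  (forall a' b' c' d', a <= a' -> b' <= b -> c <= c' -> d' <= d ->
     (\int[leb2]_(x in `]a', b'[%classic `*` `]c', d'[%classic) F x = 0)%E) ->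
  ae_eq leb2 (`]a, b[%classic `*` `]c, d[%classic) F (cst 0%E).
Proof.
move=> iF F0.
pose Q : set (mplane R) := `]a, b[%classic `*` `]c, d[%classic.
have mI (x y : R) : @measurable _ (mline R) `]x, y[%classic by exact: measurable_itv.
have mQ : measurable Q by exact: measurableX.
have rayE (x y z : R) : `]z, +oo[%classic `&` `]x, y[%classic = `]Num.max z x, y[%classic :> set R.
  by apply/seteqP; split => t /=; rewrite !in_itv/= !andbT gt_max; [move=> [-> /andP[-> ->]]|move=> /andP[/andP[-> ->] ->]].
have step1 (A : set (mline R)) c' d' : c <= c' -> d' <= d -> measurable A ->
    (\int[leb2]_(x in (A `&` `]a, b[%classic) `*` `]c', d'[%classic) F x = 0)%E.
  move=> cc dd mA.
  have sQ : `]a, b[%classic `*` `]c', d'[%classic `<=` Q.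
    by move=> x [x1 x2]; split => //; apply: subset_itvW x2.
  have mQ' : measurable (`]a, b[%classic `*` `]c', d'[%classic : set (mplane R)) by exact: measurableX.
  have := @integral_preimage_dynkin _ _ (mplane R) (mline R) R leb2 fst
    (`]a, b[%classic `*` `]c', d'[%classic) F (@RGenOInfty.G R) measurable_fst mQ'
    (integrableS mQ mQ' sQ iF) (RGenOInfty.measurableE R) rays_setI_closed
    (F0 _ _ _ _ (lexx a) (lexx b) cc dd) _ A mA.
  rewrite (_ : fst @^-1` A `&` _ = (A `&` `]a, b[%classic) `*` `]c', d'[%classic); last first.
    by apply/seteqP; split => x /=; [move=> [? [? ?]]|move=> [[? ?] ?]].
  apply => _ [z ->].
  rewrite (_ : _ `&` _ = `]Num.max z a, b[%classic `*` `]c', d'[%classic); last first.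
    by rewrite -rayE; apply/seteqP; split => x /=; tauto.
  by apply: F0; rewrite // le_max lexx orbT.
have step2 (A B : set (mline R)) : measurable A -> measurable B ->
    (\int[leb2]_(x in (A `*` B) `&` Q) F x = 0)%E.
  move=> mA mB.
  have mQ' : measurable ((A `&` `]a, b[%classic) `*` `]c, d[%classic : set (mplane R)).
    by apply: measurableX => //; exact: measurableI.
  have sQ : (A `&` `]a, b[%classic) `*` `]c, d[%classic `<=` Q by move=> x [[? ?] ?]; split.
  have := @integral_preimage_dynkin _ _ (mplane R) (mline R) R leb2 snd
    ((A `&` `]a, b[%classic) `*` `]c, d[%classic) F (@RGenOInfty.G R) measurable_snd mQ'
    (integrableS mQ mQ' sQ iF) (RGenOInfty.measurableE R) rays_setI_closed
    (step1 A _ _ (lexx c) (lexx d) mA) _ B mB.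
  rewrite (_ : snd @^-1` B `&` _ = (A `*` B) `&` Q); last first.
    by apply/seteqP; split => x /=; [move=> [? [[? ?] ?]]|move=> [[? ?] [? ?]]].
  apply => _ [z ->].
  rewrite (_ : _ `&` _ = (A `&` `]a, b[%classic) `*` `]Num.max z c, d[%classic); last first.
    by rewrite -rayE; apply/seteqP; split => x /=; tauto.
  by apply: step1; rewrite // le_max lexx orbT.
have step3 (E : set (mplane R)) : measurable E -> (\int[leb2]_(x in E `&` Q) F x = 0)%E.
  move=> mE.
  have := @integral_preimage_dynkin _ _ (mplane R) (mplane R) R leb2 id Q F _
    (@measurable_id _ (mplane R) setT) mQ iF (measurable_prod_measurableType (mline R) (mline R)) _ _ _ E mE.
  apply.
  - move=> _ _ [A mA [B mB <-]] [A' mA' [B' mB' <-]]; exists (A `&` A').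
      exact: measurableI.
    by exists (B `&` B'); [exact: measurableI|rewrite setXI].
  - have := step2 setT setT measurableT measurableT.
    by rewrite setXTT setTI.
  - by move=> _ [A mA [B mB <-]]; exact: step2.
apply: integral_ae_eq => //.
move=> E EQ mE; rewrite integral0; have := step3 E mE.
by rewrite (_ : E `&` Q = E)//; apply/seteqP; split => [x []//|x Ex]; split => //; exact: EQ.
Qed.

(** Rational boxes cover an open set, so that countably many null sets suffice. *)
Lemma ae_zero_of_boxes (W : set (R * R)) (F : mplane R -> R) : open W ->
  leb2.-integrable setT (EFin \o F) ->
  (forall a b c d, a < b -> c < d -> `[a, b]%classic `*` `[c, d]%classic `<=` W ->
     (\int[leb2]_(x in `]a, b[%classic `*` `]c, d[%classic) (F x)%:E = 0)%E) ->
  {ae (leb2 : set (mplane R) -> \bar R), forall x, W x -> F x = 0}.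
Proof.
move=> oW iF F0.
have H (q : rat * rat * rat) : {ae (leb2 : set (mplane R) -> \bar R),
    forall x, 0 < (ratr q.2 : R) -> ratbox q x -> cratbox q `<=` W -> F x = 0}.
  have [q0|q0] := pselect (0 < (ratr q.2 : R)); last by apply: aeW.
  have [qW|qW] := pselect (@cratbox R q `<=` W); last by apply: aeW => x _ _.
  have mI (x y : R) : @measurable _ (mline R) `]x, y[%classic by exact: measurable_itv.
  have [||N [mN N0 sub]] := @null_on_box (EFin \o F) (ratr q.1.1 - ratr q.2)
    (ratr q.1.1 + ratr q.2) (ratr q.1.2 - ratr q.2) (ratr q.1.2 + ratr q.2).
  - by apply: integrableS iF => //; exact: measurableX.
  - move=> a' b' c' d' ha hb hc hd.
    have emp (x y : R) : y <= x -> `]x, y[%classic = set0 :> set R.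
      by move=> yx; rewrite set_itv_ge// -leNgt bnd_simp.
    have [ab|ba] := ltP a' b'; last by rewrite (emp _ _ ba) set0X integral_set0.
    have [cd|dc] := ltP c' d'; last by rewrite (emp _ _ dc) setX0 integral_set0.
    apply: F0 => // x [x1 x2]; apply: qW; split.
      by move: x1; rewrite /= !in_itv/= => /andP[? ?]; apply/andP; split; lra.
    by move: x2; rewrite /= !in_itv/= => /andP[? ?]; apply/andP; split; lra.
  - exists N; split => // x /= xN; apply: sub => /= xE; apply: xN => _ xq _.
    by have := xE xq => -[].
have : {ae (leb2 : set (mplane R) -> \bar R), forall x (n : nat),
    if @unpickle (rat * rat * rat)%type n is Some q then
      0 < (ratr q.2 : R) -> ratbox q x -> cratbox q `<=` W -> F x = 0 else True}.
  by apply/ae_foralln => n; case: (unpickle n) => [q|]; [exact: H|exact: aeW].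
move=> [N [mN N0 sub]]; exists N; split => // x /= xN; apply: sub => /= Hx; apply: xN.
move=> Wx; have [q [q0 qx qW]] := open_ratbox oW Wx.
by have := Hx (pickle q); rewrite pickleK; apply.
Qed.

End NullIntegrals.

(** * The increment as a line integral *)

Section LineIdentityAE.
Context {R : realType}.
Variables (Omega : set (R * R)) (u : R * R -> R) (g : (R * R -> R) * (R * R -> R)).
Hypotheses (aO : admissible Omega) (H1u : H1 Omega u g).
Variable h : R * R.

Let mO : @measurable _ (mplane R) Omega := admissible_measurable aO.
Let fO : (leb2 (Omega : set (mplane R)) < +oo)%E := admissible_lty aO.

Lemma continuous_shift2 (v : R * R) : continuous (fun x : R * R => (x.1 + v.1, x.2 + v.2)).
Proof.
by move=> x; exact: (@cvgD _ _ _ _ _ (fun x : R * R => x) (fun=> v) x v cvg_id (cvg_cst v)).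
Qed.

Lemma open_shift2 (A : set (R * R)) (v : R * R) : open A ->
  open [set x | A (x.1 + v.1, x.2 + v.2)].
Proof. 
move=> oA; have /continuousP : continuous (fun x : R * R => (x.1 + v.1, x.2 + v.2)).
  exact: continuous_shift2.
exact.
Qed.

(** Testing on bumps that steepen to the indicator of a box shows that the
    difference of the two sides has zero integral over every box. *)
Lemma line_identity_ae : {ae (leb2 : set (mplane R) -> \bar R), forall x,
  Omega x -> Omega (x.1 + h.1, x.2 + h.2) ->
  u (x.1 + h.1, x.2 + h.2) - u x = line_integral Omega g h x}.
Proof.
set W := Omega `&` [set x | Omega (x.1 + h.1, x.2 + h.2)].
have oW : open W by case: aO => _ _ oO _; apply: openI => //; exact: open_shift2.
set U : R * R -> R := u \_ Omega.
pose F (x : mplane R) := (U (x.1 + h.1, x.2 + h.2) - U x) - line_integral Omega g h x.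
have Lu : L2 Omega u by case: H1u.
have iU : leb2.-integrable (setT : set (mplane R)) (EFin \o U) by exact: L2_integrableT.
have mU : @measurable_fun _ _ (mplane R) _ setT U by apply/measurable_EFinP; exact: measurable_int iU.
have iUh : leb2.-integrable (setT : set (mplane R)) (EFin \o (fun x => U (x.1 + h.1, x.2 + h.2))).
  apply/integrableP; split.
    apply/measurable_EFinP; apply: (@measurableT_comp _ _ _ _ (mplane R) _ U) => //.
    exact: measurable_shift.
  by rewrite (integral_abs_shift h mU); case/integrableP : iU.
have [iL _] := line_integral_integrable aO H1u h.
have iD : leb2.-integrable (setT : set (mplane R)) (EFin \o (fun x => U (x.1 + h.1, x.2 + h.2) - U x)).
  exact: (integrableB measurableT iUh iU).
have iF : leb2.-integrable (setT : set (mplane R)) (EFin \o F) by exact: (integrableB measurableT iD iL).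
have mF : @measurable_fun _ _ (mplane R) _ setT F by apply/measurable_EFinP; exact: measurable_int iF.
suff [N [mN N0 sub]] : {ae (leb2 : set (mplane R) -> \bar R), forall x, W x -> F x = 0}.
  exists N; split => // x /= xN; apply: sub => /= H; apply: xN => Ox Oxh.
  by have /eqP := H (conj Ox Oxh); rewrite subr_eq0 /U !patchE !mem_set// => /eqP.
apply: ae_zero_of_boxes => // a b c d ab cd sW.
pose psi n := tensor (bump n a b) (bump n c d).
have s1 n : supp1 (bump n a b) a b.
  move=> t /= tab; apply: bump_out => //; move: tab; rewrite in_itv/= => /negP.
  by rewrite negb_and -!ltNge => /orP[]/ltW; [left|right].
have s2 n : supp1 (bump n c d) c d.
  move=> t /= tab; apply: bump_out => //; move: tab; rewrite in_itv/= => /negP.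
  by rewrite negb_and -!ltNge => /orP[]/ltW; [left|right].
have mpsi n : @measurable_fun _ _ (mplane R) _ setT (psi n).
  by apply: tensor_measurable; exact: smooth1_bump.
have psi1 n x : `|psi n x| <= 1.
  rewrite normrM !ger0_norm ?bump_ge0//.
  by apply: mulr_ile1; rewrite ?bump_ge0 ?bump_le1.
have Epsi n : (\int[leb2]_x (F x * psi n x)%:E = 0)%E.
  have E := line_identity_tensor aO H1u (h := h) (smooth1_bump n a b) (smooth1_bump n c d)
     (s1 n) (s2 n) (fun x xB => (sW x xB).1) (fun x xB => (sW x xB).2).
  have i1 := integrable_bounded_mul iD (mpsi n) (psi1 n).
  have i2 := integrable_bounded_mul iL (mpsi n) (psi1 n).
  have i3 := integrable_bounded_mul iF (mpsi n) (psi1 n).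
  rewrite -(EFin_Rintegral measurableT i3); congr EFin.
  rewrite (_ : \int[leb2]_x _ = \int[leb2]_x
    ((U (x.1 + h.1, x.2 + h.2) - U x) * psi n x - line_integral Omega g h x * psi n x)); last first.
    by apply: eq_Rintegral => x _; rewrite /F mulrBl.
  by rewrite RintegralB// E subrr.
pose box : set (mplane R) := `]a, b[%classic `*` `]c, d[%classic.
have mbox : measurable box by apply: measurableX; exact: measurable_itv.
have lim_psi x : (fun n => (F x * psi n x)%:E) @ \oo --> (F x * (\1_box x))%:E.
  apply: cvg_EFin; first exact: nearW.
  apply: cvgM; first exact: cvg_cst.
  rewrite (_ : \1_box x = \1_(`]a, b[%classic) x.1 * \1_(`]c, d[%classic) x.2); last first.
    by rewrite /box !indicE in_setX; case: (_ \in _); case: (_ \in _); rewrite /= ?mulr1 ?mulr0 ?mul0r.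
  by apply: cvgM; exact: bump_cvg.
have mF1 : @measurable_fun _ _ (mplane R) _ setT (fun x => (F x * (\1_box x))%:E).
  by apply/measurable_EFinP; apply: measurable_funM => //; exact: measurable_indic.
have mFn n : @measurable_fun _ _ (mplane R) _ setT (fun x => (F x * psi n x)%:E).
  by apply/measurable_EFinP; apply: measurable_funM.
have [] := @dominated_convergence _ _ R leb2 setT measurableT
   (fun n x => (F x * psi n x)%:E) (fun x => (F x * (\1_box x))%:E)
   (fun x => (`|F x|)%:E) mFn mF1.
- by apply: aeW => x _; exact: lim_psi.
- by have := integrable_norm iF.
- apply: aeW => x n _; rewrite /= lee_fin normrM ler_piMr//.
- move=> _ _ H.
  have {}H : (fun n : nat => 0%E : \bar R) @ \oo --> (\int[leb2]_x (F x * (\1_box x))%:E)%E.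
    by move: H; under eq_fun do rewrite Epsi.
  have E0 := cvg_lim (@ereal_hausdorff R) H; rewrite lim_cst// in E0.
  rewrite integral_mkcond [RHS]E0; apply: eq_integral => x _.
  by rewrite /= patchE indicE; case: ifPn => _; rewrite ?mulr1 ?mulr0.
Qed.

End LineIdentityAE.

Section Jensen.
Context {R : realType}.

(** The square of a mean is at most the mean of the squares. A function that is
    not square-integrable makes the right-hand side infinite. *)
Lemma jensen01 (f : mline R -> R) : measurable_fun setT f ->
  (((\int[leb]_(t in `[0, 1]) f t) ^+ 2)%:E <= \int[leb]_(t in `[0%R, 1%R]) (f t ^+ 2)%:E)%E.
Proof.
move=> mf; have mI : @measurable _ (mline R) `[0, 1]%classic by exact: measurable_itv.
have I1 : @lebesgue_measure R `[0, 1]%classic = 1%E.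
  by rewrite lebesgue_measure_itv/= lte_fin ltr01 -EFinB subr0.
have [foo|] := ltP (\int[leb]_(t in `[0%R, 1%R]) (f t ^+ 2)%:E)%E +oo%E; last first.
  by rewrite leye_eq => /eqP ->; exact: leey.
have if2 : leb.-integrable `[0, 1] (EFin \o (fun t => f t ^+ 2)).
  apply/integrableP; split.
    by apply/measurable_EFinP; apply: measurable_funTS; exact: measurable_funX.
  rewrite (eq_integral (fun t : mline R => (f t ^+ 2)%:E))// => x _ /=.
  by rewrite ger0_norm// sqr_ge0.
have ic (c : R) : leb.-integrable `[0, 1] (EFin \o (fun _ : R => c)).
  apply/integrableP; split; first exact: measurable_cst.
  rewrite integral_cst// [X in (_ * X)%E](_ : _ = 1%E); last exact: I1.
  by rewrite mule1 ltry.
have if1 : leb.-integrable `[0, 1] (EFin \o f).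
  have := integrableD mI if2 (ic 1); apply: le_integrable => //.
    by apply/measurable_EFinP; exact: measurable_funTS.
  move=> x _ /=; rewrite lee_fin [leRHS]ger0_norm ?addr_ge0 ?sqr_ge0//.
  by rewrite ler_norml; apply/andP; split; nra.
rewrite -(EFin_Rintegral mI if2) lee_fin.
set m := \int[leb]_(t in `[0, 1]) f t.
have : 0 <= \int[leb]_(t in `[0, 1]) (f t - m) ^+ 2.
  by apply: Rintegral_ge0 => t _; exact: sqr_ge0.
have i2 : leb.-integrable `[0, 1] (EFin \o (fun t => 2 * m * f t)) by exact: (integrableZl mI (2 * m) if1).
have i3 : leb.-integrable `[0, 1] (EFin \o (fun t => f t ^+ 2 - 2 * m * f t)) by exact: (integrableB mI if2 i2).
rewrite (_ : \int[leb]_(t in `[0, 1]) _ = \int[leb]_(t in `[0, 1]) ((f t ^+ 2 - 2 * m * f t) + m ^+ 2)); last first.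
  by apply: eq_Rintegral => t _; ring.
rewrite RintegralD// RintegralB// RintegralZl// Rintegral_cst// -/m.
rewrite [fine _](_ : _ = 1); last by rewrite -[RHS]/(fine 1%E) -I1.
by rewrite mulr1; lra.
Qed.

End Jensen.

(** * The Poincaré inequality *)

Section Poincare.
Context {R : realType}.
Variables (Omega : set (R * R)) (u : R * R -> R) (g : (R * R -> R) * (R * R -> R)).
Hypotheses (aO : admissible Omega) (H1u : H1 Omega u g).

Let mO : @measurable _ (mplane R) Omega := admissible_measurable aO.
Let fO : (leb2 (Omega : set (mplane R)) < +oo)%E := admissible_lty aO.

Definition gradsq (x : R * R) : R := g.1 x ^+ 2 + g.2 x ^+ 2.

Let Gam : R * R -> R := gradsq \_ Omega.
Let U : R * R -> R := u \_ Omega.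
Let I1 : mplane R -> R := \1_(Omega : set (mplane R)).

Let Gam_ge0 x : 0 <= Gam x.
Proof. by rewrite /Gam patchE; case: ifPn => // _; rewrite addr_ge0 ?sqr_ge0. Qed.

Let mGam : @measurable_fun _ _ (mplane R) _ setT Gam.
Proof.
have mg : @measurable_fun _ _ (mplane R) _ Omega gradsq.
  case: H1u => _ [m1 _] [m2 _] _ _.
  by apply: measurable_funD; apply: measurable_funX; [exact: m1|exact: m2].
exact/(measurable_restrictT _ _).1.
Qed.

Let mU : @measurable_fun _ _ (mplane R) _ setT U.
Proof. by apply: L2_measurableT => //; case: H1u. Qed.

Let mI1 : @measurable_fun _ _ (mplane R) _ setT I1.
Proof. exact: measurable_indic. Qed.

Let I1_ge0 x : 0 <= I1 x. Proof. by rewrite /I1 indicE. Qed.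

Variable K : R.
Hypothesis diamK : forall x y, Omega x -> Omega y ->
  (x.1 - y.1) ^+ 2 + (x.2 - y.2) ^+ 2 <= K.

Let K0 : 0 <= K.
Proof.
by case: aO => -[x Ox] _ _ _; have := diamK Ox Ox; rewrite !subrr expr0n/= addr0.
Qed.

Let mI01 : @measurable _ (mline R) `[0, 1]%classic. Proof. exact: measurable_itv. Qed.

Let lebI01 : @lebesgue_measure R `[0, 1]%classic = 1%E.
Proof. by rewrite lebesgue_measure_itv/= lte_fin ltr01 -EFinB subr0. Qed.

Let sqdiff (h x : mplane R) : R :=
  I1 x * I1 (x.1 + h.1, x.2 + h.2) * (U (x.1 + h.1, x.2 + h.2) - U x) ^+ 2.

(** If a segment of direction [h] in the convex set contains [z], then so does the
    set contain one of the points [z - h / 2] and [z + h / 2]. Unlike the ends of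
    the segment these do not depend on the position of [z] in it. *)
Let midpoint_indicator (h z : mplane R) : R :=
  K * (I1 (z.1 - h.1 / 2, z.2 - h.2 / 2) + I1 (z.1 + h.1 / 2, z.2 + h.2 / 2)) * Gam z.

(** [z] being the point of parameter [t], convexity puts [z - h / 2] in the
    domain if [t >= 1/2], and [z + h / 2] otherwise. *)
Let segment_bound (h x : mplane R) (t : R) : 0 <= t <= 1 ->
  I1 x * I1 (x.1 + h.1, x.2 + h.2) * ((h.1 ^+ 2 + h.2 ^+ 2) * Gam (x.1 + t * h.1, x.2 + t * h.2))
  <= midpoint_indicator h (x.1 + t * h.1, x.2 + t * h.2).
Proof.
move=> /andP[t0 t1]; set z := (x.1 + t * h.1, x.2 + t * h.2).
rewrite {1}/I1 indicE; have [Ox|_] := boolP (x \in _); last first.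
  by rewrite !mul0r !mulr_ge0// addr_ge0.
rewrite {1}/I1 indicE; have [Oxh|_] := boolP ((_, _) \in _); last first.
  by rewrite !(mul0r, mulr0) !mulr_ge0// addr_ge0.
rewrite !mul1r; apply: ler_wpM2r => //.
move: Ox Oxh; rewrite !inE => Ox Oxh.
have hK : h.1 ^+ 2 + h.2 ^+ 2 <= K.
  have := diamK Oxh Ox; congr (_ <= _); rewrite /=; ring.
apply: (le_trans hK); rewrite ler_peMr// .
have cO := (convex_setE Omega).1 (let: And4 _ _ _ c := aO in c).
have [th|th] := leP (2^-1) t.
- rewrite [X in _ <= X + _](_ : _ = 1) ?lerDl//.
  rewrite /I1 indicE mem_set//.
  have := cO _ _ (t - 2^-1) Oxh Ox.
  rewrite (_ : (z.1 - h.1 / 2, z.2 - h.2 / 2) = ((t - 2^-1) * (x.1 + h.1) + (1 - (t - 2^-1)) * x.1, (t - 2^-1) * (x.2 + h.2) + (1 - (t - 2^-1)) * x.2)).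
    by apply; apply/andP; split; lra.
  by rewrite /z /=; congr (_, _); field.
- rewrite [X in _ <= _ + X](_ : _ = 1) ?lerDr//.
  rewrite /I1 indicE mem_set//.
  have := cO _ _ (t + 2^-1) Oxh Ox.
  rewrite (_ : (z.1 + h.1 / 2, z.2 + h.2 / 2) = ((t + 2^-1) * (x.1 + h.1) + (1 - (t + 2^-1)) * x.1, (t + 2^-1) * (x.2 + h.2) + (1 - (t + 2^-1)) * x.2)).
    by apply; apply/andP; split; lra.
  by rewrite /z /=; congr (_, _); field.
Qed.

Let mshift (v : R * R) (w : R * R -> R) : @measurable_fun _ _ (mplane R) _ setT w ->
  @measurable_fun _ _ (mplane R) _ setT (fun x => w (x.1 + v.1, x.2 + v.2)).
Proof.
by move=> mw; apply: (@measurableT_comp _ _ _ _ (mplane R) _ w) => //; exact: measurable_shift.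
Qed.

Let mmid h : measurable_fun setT (midpoint_indicator h).
Proof.
rewrite /midpoint_indicator; apply: measurable_funM => //.
apply: measurable_funM; first exact: measurable_cst.
apply: measurable_funD; first exact: (mshift (- (h.1 / 2), - (h.2 / 2)) mI1).
exact: (mshift (h.1 / 2, h.2 / 2) mI1).
Qed.

Let mid_ge0 h x : 0 <= midpoint_indicator h x.
Proof. by rewrite !mulr_ge0// addr_ge0. Qed.

(** The increment is a line integral, bounded by Jensen; the translation by
    [t * h] then centres the integration at the point [z] of the segment. *)
Let diff_le_mid (h : R * R) :
  (\int[leb2]_x (sqdiff h x)%:E <= \int[leb2]_z (midpoint_indicator h z)%:E)%E.
Proof.
pose Psi (p : mline R * mplane R) : \bar R :=
  ((\1_(`[0, 1]%classic : set (mline R)) p.1) *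
   (I1 p.2 * I1 (p.2.1 + h.1, p.2.2 + h.2) *
   ((h.1 ^+ 2 + h.2 ^+ 2) * Gam (p.2.1 + p.1 * h.1, p.2.2 + p.1 * h.2))))%:E.
have hh0 : 0 <= h.1 ^+ 2 + h.2 ^+ 2 by rewrite addr_ge0 ?sqr_ge0.
have Psi0 p : (0 <= Psi p)%E by rewrite lee_fin !mulr_ge0// indicE.
have mPsi : measurable_fun setT Psi.
  apply/measurable_EFinP; apply: measurable_funM.
    by apply: measurableT_comp (measurable_fst); exact: measurable_indic.
  apply: measurable_funM; last first.
    by apply: measurable_funM; [exact: measurable_cst|exact: (measurable_along h mGam)].
  have mII : measurable_fun setT (fun x : mplane R => I1 x * I1 (x.1 + h.1, x.2 + h.2)).
    by apply: measurable_funM => //; exact: (mshift h mI1).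
  by apply: (measurableT_comp mII); exact: measurable_snd.
have -> : (\int[leb2]_z (midpoint_indicator h z)%:E =
    \int[leb]_t ((\1_(`[0%R, 1%R]%classic : set (mline R)) t)%:E * \int[leb2]_z (midpoint_indicator h z)%:E))%E.
  rewrite ge0_integralZr//.
  - rewrite integral_indic// setIT [X in (X * _)%E](_ : _ = 1%E) ?mul1e//; exact: lebI01.
  - by apply/measurable_EFinP; exact: measurable_indic.
  - by apply: integral_ge0 => x _; rewrite lee_fin mid_ge0.
apply: (@le_trans _ _ (\int[leb2]_x \int[leb]_t Psi (t, x))%E).
  have mPsix x : measurable_fun setT (fun t => Psi (t, x)) by exact: (measurable_fun_pair1 x mPsi).
  apply: ae_ge0_le_integral => //.
  - by move=> x _; rewrite lee_fin; apply: mulr_ge0; [exact: mulr_ge0|exact: sqr_ge0].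
  - apply/measurable_EFinP; apply: measurable_funM.
      by apply: measurable_funM => //; exact: (mshift h mI1).
    by apply: measurable_funX; apply: measurable_funB => //; exact: (mshift h mU).
  - by move=> x _; apply: integral_ge0.
  - exact: (@measurable_fun_fubini_tonelli_G _ _ _ _ _ (@lebesgue_measure R) Psi).
  - have [N [mN N0 sub]] := line_identity_ae aO H1u h.
    exists N; split => // x /= xN; apply: sub => /= H; apply: xN => _.
    rewrite /sqdiff {1}/I1 indicE; have [Ox|_] := boolP (x \in _); last first.
      by rewrite !mul0r; apply: integral_ge0.
    rewrite {1}/I1 indicE; have [Oxh|_] := boolP ((_, _) \in _); last first.
      by rewrite !(mul0r, mulr0); apply: integral_ge0.
    rewrite !mul1r; move: (Ox) (Oxh); rewrite !inE => Ox' Oxh'.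
    rewrite /U !patchE Ox Oxh (H Ox' Oxh') /line_integral.
    have mt : measurable_fun setT (fun t : mline R => (dirgrad g h \_ Omega) (x.1 + t * h.1, x.2 + t * h.2)).
      apply: (measurable_fun_pair1 (x : mplane R) (measurable_along h _)).
      by apply: L2_measurableT => //; exact: (L2_dirgrad aO H1u h).
    apply: (le_trans (jensen01 mt)); rewrite integral_mkcond; apply: ge0_le_integral => //.
    + by move=> t _; rewrite patchE; case: ifPn => // _; rewrite lee_fin sqr_ge0.
    + have mt2 : measurable_fun (`[0, 1]%classic : set (mline R)) (fun t : mline R =>
          ((dirgrad g h \_ Omega) (x.1 + t * h.1, x.2 + t * h.2) ^+ 2)%:E).
        by apply: measurable_funTS; apply/measurable_EFinP; exact: measurable_funX.
      exact: ((measurable_restrictT _ mI01).1 mt2).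
    + move=> t _; rewrite patchE /Psi /= indicE; case: ifPn => _; last by rewrite mul0r.
      rewrite mul1r lee_fin /I1 !indicE Ox Oxh !mul1r /Gam !patchE; case: ifPn => _.
        by rewrite -subr_ge0 /dirgrad /gradsq; set a := g.1 _; set b := g.2 _; rewrite (_ : _ - _ = (h.1 * b - h.2 * a) ^+ 2) ?sqr_ge0//; ring.
      by rewrite expr0n/= mulr0.
rewrite -(@fubini_tonelli _ _ _ _ _ (@lebesgue_measure R) area Psi)//.
apply: ge0_le_integral => //.
- by move=> t _; apply: integral_ge0.
- exact: (@measurable_fun_fubini_tonelli_F _ _ _ _ _ area Psi).
- by apply: emeasurable_funM; [apply/measurable_EFinP; exact: measurable_indic|exact: measurable_cst].
- move=> t _; have [tI|tI] := boolP (t \in (`[0, 1]%classic : set (mline R))); last first.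
    have E0 : \1_(`[0, 1]%classic : set (mline R)) t = 0 :> R by rewrite indicE (negbTE tI).
    rewrite /Psi /= E0 mul0e; under eq_integral do rewrite mul0r.
    by rewrite integral0.
  have E1 : \1_(`[0, 1]%classic : set (mline R)) t = 1 :> R by rewrite indicE tI.
  rewrite /Psi /= E1 mul1e.
  rewrite -(@ge0_integral_shift R (t * h.1, t * h.2) (fun z => (midpoint_indicator h z)%:E)); last 2 first.
  + exact/measurable_EFinP.
  + by move=> x; rewrite lee_fin.
  apply: ge0_le_integral => //.
  + by move=> x _; rewrite lee_fin !mulr_ge0.
  + apply/measurable_EFinP; apply: measurable_funM => //.
    apply: measurable_funM; last first.
      by apply: measurable_funM; [exact: measurable_cst|exact: (mshift (t * h.1, t * h.2) mGam)].
    by apply: measurable_funM => //; exact: (mshift h mI1).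
  + by apply/measurable_EFinP; exact: (mshift (t * h.1, t * h.2) (mmid h)).
  + move=> x _; rewrite lee_fin mul1r; apply: segment_bound.
    by move: tI; rewrite inE/= in_itv.
Qed.

Let mcomb (c : R) (w : R * R -> R) : @measurable_fun _ _ (mplane R) _ setT w ->
  measurable_fun setT (fun p : mplane R * mplane R =>
     w (p.2.1 + c * p.1.1, p.2.2 + c * p.1.2)).
Proof.
move=> mw; apply: (@measurableT_comp _ _ _ _ (mplane R) _ w) => //.
have m11 : measurable_fun setT (fun p : mplane R * mplane R => p.1.1 : R).
  by apply: (measurableT_comp measurable_fst); exact: measurable_fst.
have m12 : measurable_fun setT (fun p : mplane R * mplane R => p.1.2 : R).
  by apply: (measurableT_comp measurable_snd); exact: measurable_fst.
have m21 : measurable_fun setT (fun p : mplane R * mplane R => p.2.1 : R).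
  by apply: (measurableT_comp measurable_fst); exact: measurable_snd.
have m22 : measurable_fun setT (fun p : mplane R * mplane R => p.2.2 : R).
  by apply: (measurableT_comp measurable_snd); exact: measurable_snd.
apply: measurable_fun_pair.
  have H : measurable_fun setT (fun p : mplane R * mplane R => p.2.1 + c * p.1.1 : R).
    by apply: measurable_funD => //; apply: measurable_funM => //; exact: measurable_cst.
  exact: H.
have H : measurable_fun setT (fun p : mplane R * mplane R => p.2.2 + c * p.1.2 : R).
  by apply: measurable_funD => //; apply: measurable_funM => //; exact: measurable_cst.
exact: H.
Qed.

Let msnd (w : R * R -> R) : @measurable_fun _ _ (mplane R) _ setT w ->
  measurable_fun setT (fun p : mplane R * mplane R => w p.2).
Proof. by move=> mw; apply: (measurableT_comp mw); exact: measurable_snd. Qed.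

Let msqdiff : measurable_fun setT (fun p : mplane R * mplane R => (sqdiff p.1 p.2)%:E).
Proof.
have E (w : R * R -> R) : (fun p : mplane R * mplane R => w (p.2.1 + p.1.1, p.2.2 + p.1.2)) =
    (fun p => w (p.2.1 + 1 * p.1.1, p.2.2 + 1 * p.1.2)).
  by apply/funext => p; rewrite !mul1r.
apply/measurable_EFinP; rewrite /sqdiff; apply: measurable_funM.
  apply: measurable_funM; first exact: msnd.
  by rewrite (E I1); exact: mcomb.
apply: measurable_funX; apply: measurable_funB; last exact: msnd.
by rewrite (E U); exact: mcomb.
Qed.

Let mmid2 : measurable_fun setT (fun p : mplane R * mplane R => (midpoint_indicator p.1 p.2)%:E).
Proof.
apply/measurable_EFinP; rewrite /midpoint_indicator; apply: measurable_funM; last exact: msnd.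
apply: measurable_funM; first exact: measurable_cst.
apply: measurable_funD.
  rewrite (_ : (fun _ => _) = (fun p : mplane R * mplane R => I1 (p.2.1 + (- 2^-1) * p.1.1, p.2.2 + (- 2^-1) * p.1.2))).
    exact: mcomb.
  by apply/funext => p; rewrite !mulNr ![2^-1 * _]mulrC.
rewrite (_ : (fun _ => _) = (fun p : mplane R * mplane R => I1 (p.2.1 + 2^-1 * p.1.1, p.2.2 + 2^-1 * p.1.2))).
  exact: mcomb.
by apply/funext => p; rewrite ![2^-1 * _]mulrC.
Qed.

Let m : R := fine (leb2 (Omega : set (mplane R))).

Let mE : leb2 (Omega : set (mplane R)) = m%:E.
Proof. by rewrite fineK// ge0_fin_numE. Qed.

Let integral_I1 : (\int[leb2]_x (I1 x)%:E = m%:E)%E.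
Proof. by rewrite integral_indic// setIT. Qed.

(** The factor [4] is the Jacobian of the change of variables [h -> z + s * h]. *)
Let integral_half (z : R * R) (s : R) : s ^+ 2 = 4^-1 ->
  (\int[leb2]_h (I1 (z.1 + s * h.1, z.2 + s * h.2)%R)%:E = (4 * m)%:E)%E.
Proof.
move=> s2; have s0 : s != 0.
  by apply/eqP => s0; move: s2; rewrite s0 expr0n/=; lra.
have mI : measurable_fun setT (fun x : mplane R => (I1 x)%:E) by exact/measurable_EFinP.
have := ge0_integral_affine2 z s0 mI (fun x => I1_ge0 x).
rewrite integral_I1 s2 => E; rewrite EFinM E muleA -EFinM divff ?mul1e//.
Qed.

Let integral_mid : (\int[leb2]_h \int[leb2]_z (midpoint_indicator h z)%:E =
  (8 * K * m)%:E * \int[leb2]_z (Gam z)%:E)%E.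
Proof.
rewrite (plane_tonelli mmid2); last by move=> p; rewrite lee_fin.
have mGamE : measurable_fun setT (fun z : mplane R => (Gam z)%:E) by exact/measurable_EFinP.
rewrite -ge0_integralZl_EFin//; last first.
- by rewrite !mulr_ge0// /m fine_ge0.
- by move=> z _; rewrite lee_fin.
apply: eq_integral => z _.
have mIs (s : R) : measurable_fun setT (fun h : mplane R => (I1 (z.1 + s * h.1, z.2 + s * h.2)%R)%:E).
  apply/measurable_EFinP; apply: (@measurableT_comp _ _ _ _ (mplane R) _ I1) => //.
  exact: measurable_affine2.
rewrite (eq_integral (fun h : mplane R => (K * Gam z)%:E *
   ((I1 (z.1 + (- 2^-1) * h.1, z.2 + (- 2^-1) * h.2)%R)%:E + (I1 (z.1 + 2^-1 * h.1, z.2 + 2^-1 * h.2)%R)%:E))%E); last first.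
  move=> h _; rewrite /midpoint_indicator -EFinD -EFinM; congr EFin.
  by rewrite !mulNr ![2^-1 * _]mulrC; ring.
rewrite ge0_integralZl_EFin//; last 3 first.
- by move=> h _; rewrite adde_ge0// lee_fin.
- exact: emeasurable_funD.
- exact: mulr_ge0.
rewrite ge0_integralD//; last 2 first.
- by move=> h _; rewrite lee_fin.
- by move=> h _; rewrite lee_fin.
rewrite !integral_half ?sqrrN; try by field.
by rewrite -EFinD -!EFinM; congr EFin; ring.
Qed.

Let S1 : R := \int[leb2]_x U x.
Let S2 : R := \int[leb2]_x (U x ^+ 2).
Let A0 : R := \int[leb2]_x Gam x.

Let iU : leb2.-integrable (setT : set (mplane R)) (EFin \o U).
Proof. by apply: L2_integrableT => //; case: H1u. Qed.

Let U2E : (fun x => U x ^+ 2) = (fun x => u x ^+ 2) \_ Omega.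
Proof. by apply/funext => x; rewrite /U !patchE; case: ifPn => // _; rewrite expr0n. Qed.

Let iU2 : leb2.-integrable (setT : set (mplane R)) (EFin \o (fun x => U x ^+ 2)).
Proof.
rewrite U2E -restrict_EFin; apply/(integrable_mkcond _ mO).1.
by apply: L2_integrable_sqr; case: H1u.
Qed.

Let iI1 : leb2.-integrable (setT : set (mplane R)) (EFin \o I1).
Proof.
apply/integrableP; split; first exact/measurable_EFinP.
rewrite (eq_integral (fun x : mplane R => (I1 x)%:E)) ?integral_I1 ?ltry// => x _ /=.
by rewrite ger0_norm.
Qed.

Let iGam : leb2.-integrable (setT : set (mplane R)) (EFin \o Gam).
Proof.
rewrite /Gam -restrict_EFin; apply/(integrable_mkcond _ mO).1.
case: H1u => _ L1 L2' _ _.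
exact: (integrableD mO (L2_integrable_sqr L1) (L2_integrable_sqr L2')).
Qed.

Let I1U x : I1 x * U x = U x.
Proof. by rewrite /I1 indicE /U patchE; case: ifPn => _; rewrite ?mul1r// mul0r. Qed.

Let mR : \int[leb2]_x I1 x = m.
Proof. by rewrite /Rintegral integral_I1. Qed.

Let inner_int (c : R) : (\int[leb2]_y (I1 y * (U y - c) ^+ 2)%:E = (S2 - 2 * c * S1 + c ^+ 2 * m)%:E)%E.
Proof.
have i1 : leb2.-integrable (setT : set (mplane R)) (EFin \o (fun x => 2 * c * U x)) by exact: (integrableZl measurableT (2 * c) iU).
have i2 : leb2.-integrable (setT : set (mplane R)) (EFin \o (fun x => c ^+ 2 * I1 x)) by exact: (integrableZl measurableT (c ^+ 2) iI1).
have i3 : leb2.-integrable (setT : set (mplane R)) (EFin \o (fun x => U x ^+ 2 - 2 * c * U x)) by exact: (integrableB measurableT iU2 i1).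
rewrite (eq_integral (fun y : mplane R => ((U y ^+ 2 - 2 * c * U y) + c ^+ 2 * I1 y)%:E)); last first.
  by move=> y _; congr EFin; rewrite -{1 2}(I1U y) -(I1U y) /I1 indicE; case: (y \in _) => /=; ring.
rewrite -(EFin_Rintegral measurableT (integrableD measurableT i3 i2)) RintegralD// RintegralB// !RintegralZl// mR.
exact: erefl.
Qed.

(** Expanding the square of [u y - u x] over all pairs of points. *)
Let integral_sqdiff : (\int[leb2]_h \int[leb2]_x (sqdiff h x)%:E = (2 * m * S2 - 2 * S1 ^+ 2)%:E)%E.
Proof.
rewrite (plane_tonelli msqdiff); last first.
  by move=> p; rewrite lee_fin; apply: mulr_ge0; [exact: mulr_ge0|exact: sqr_ge0].
have i1 : leb2.-integrable (setT : set (mplane R)) (EFin \o (fun x => S2 * I1 x)) by exact: (integrableZl measurableT S2 iI1).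
have i2 : leb2.-integrable (setT : set (mplane R)) (EFin \o (fun x => 2 * S1 * U x)) by exact: (integrableZl measurableT (2 * S1) iU).
have i3 : leb2.-integrable (setT : set (mplane R)) (EFin \o (fun x => m * U x ^+ 2)) by exact: (integrableZl measurableT m iU2).
have i4 : leb2.-integrable (setT : set (mplane R)) (EFin \o (fun x => S2 * I1 x - 2 * S1 * U x)) by exact: (integrableB measurableT i1 i2).
rewrite (eq_integral (fun x : mplane R => ((S2 * I1 x - 2 * S1 * U x) + m * U x ^+ 2)%:E)); last first.
  move=> x _.
  have mq : measurable_fun setT (fun y : mplane R => (I1 y * (U y - U x) ^+ 2)%:E).
    apply/measurable_EFinP; apply: measurable_funM => //; apply: measurable_funX.
    by apply: measurable_funB => //; exact: measurable_cst.
  have q0 (y : mplane R) : (0 <= (I1 y * (U y - U x) ^+ 2)%:E)%E by rewrite lee_fin mulr_ge0// sqr_ge0.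
  rewrite (eq_integral (fun h : mplane R => (I1 x)%:E * (I1 (h.1 + x.1, h.2 + x.2)%R * (U (h.1 + x.1, h.2 + x.2)%R - U x) ^+ 2)%:E)%E); last first.
    by move=> h _; rewrite /sqdiff -EFinM -mulrA [h.1 + _]addrC [h.2 + _]addrC.
  have mqs : measurable_fun setT (fun h : mplane R => (I1 (h.1 + x.1, h.2 + x.2)%R * (U (h.1 + x.1, h.2 + x.2)%R - U x) ^+ 2)%:E).
    exact: (measurableT_comp mq (measurable_shift x)).
  rewrite ge0_integralZl_EFin// (ge0_integral_shift x mq q0) inner_int -EFinM; congr EFin.
  have UI := I1U x; have [E|E] : I1 x = 1 \/ I1 x = 0.
    by rewrite /I1 indicE; case: (x \in _); [left|right].
  - by rewrite E; ring.
  - by rewrite -UI E; ring.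
rewrite -(EFin_Rintegral measurableT (integrableD measurableT i4 i3)) RintegralD// RintegralB// !RintegralZl// mR.
by congr EFin; rewrite -/S1 -/S2; ring.
Qed.

(** Averaging the segment estimate over all pairs of points, [h] ranges over the
    increments for which [z - h / 2] or [z + h / 2] lies in the domain, a set of
    area at most [8 * m]; half of it is left because the square is counted for
    each ordered pair. *)
Lemma poincare :
  m * \int[leb2]_(x in Omega) (u x ^+ 2) <=
  (\int[leb2]_(x in Omega) u x) ^+ 2 + 4 * K * m * \int[leb2]_(x in Omega) gradsq x.
Proof.
have E2 : \int[leb2]_(x in Omega) (u x ^+ 2) = S2 by rewrite RintegralT -U2E.
have E1 : \int[leb2]_(x in Omega) u x = S1 by exact: RintegralT.
have E0 : \int[leb2]_(x in Omega) gradsq x = A0 by exact: RintegralT.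
rewrite E0 E1 E2.
have : (\int[leb2]_h \int[leb2]_x (sqdiff h x)%:E <=
        \int[leb2]_h \int[leb2]_z (midpoint_indicator h z)%:E)%E.
  apply: ge0_le_integral => //.
  - move=> h _; apply: integral_ge0 => x _; rewrite lee_fin.
    by apply: mulr_ge0; [exact: mulr_ge0|exact: sqr_ge0].
  - apply: (@measurable_fun_fubini_tonelli_F _ _ _ _ _ area _ msqdiff).
    by move=> p; rewrite lee_fin; apply: mulr_ge0; [exact: mulr_ge0|exact: sqr_ge0].
  - by apply: (@measurable_fun_fubini_tonelli_F _ _ _ _ _ area _ mmid2) => p; rewrite lee_fin.
rewrite integral_sqdiff integral_mid -(EFin_Rintegral measurableT iGam) -EFinM lee_fin -/A0; lra.
Qed.

End Poincare.

(** * Eigenvectors of a pair of quadratic forms *)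

(** The image of an ultrafilter: a bounded functional maps an ultrafilter of
    vectors to one of bounded reals, which converges. *)
Lemma ultra_fmap (S T : Type) (f : S -> T) (U : set_system S) :
  UltraFilter U -> UltraFilter (f @ U).
Proof.
move=> UU; have PU : ProperFilter U by exact: ultra_proper.
apply: Build_UltraFilter => G PG fG; apply/seteqP; split => [A GA|]; last exact: fG.
have [//|fC] := in_ultra_setVsetC (f @^-1` A) UU.
have /filter_ex[x []//] : G (A `&` ~` A) by apply: filterI => //; exact: fG.
Qed.

Section AbstractSpectral.
Context {R : realType} {V : lmodType R}.
Implicit Types (a b : V -> V -> R) (u v w : V).

Record semi_inner b : Prop := SemiInner {
  formC : forall u v, b u v = b v u ;
  formDl : forall u v w, b (u + v) w = b u w + b v w ;
  formZl : forall (c : R) u v, b (c *: u) v = c * b u v ;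
  form_ge0 : forall u, 0 <= b u u }.

Section Form.
Variable b : V -> V -> R.
Hypothesis hb : semi_inner b.

Lemma formDr u v w : b w (u + v) = b w u + b w v.
Proof. by rewrite !(formC hb w) (formDl hb). Qed.

Lemma formZr (c : R) u v : b u (c *: v) = c * b u v.
Proof. by rewrite !(formC hb u) (formZl hb). Qed.

Lemma form0l v : b 0 v = 0.
Proof. by have := formZl hb 0 0 v; rewrite scale0r mul0r. Qed.

Lemma formNl u v : b (- u) v = - b u v.
Proof. by rewrite -scaleN1r (formZl hb) mulN1r. Qed.

Lemma formNr u v : b u (- v) = - b u v.
Proof. by rewrite !(formC hb u) formNl. Qed.

Lemma form_suml (I : Type) (r : seq I) (P : pred I) (F : I -> V) v :
  b (\sum_(i <- r | P i) F i) v = \sum_(i <- r | P i) b (F i) v.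
Proof.
elim/big_rec2 : _ => [|i y1 y2 _ <-]; first exact: form0l.
exact: formDl hb _ _ _.
Qed.

Lemma form_sumr (I : Type) (r : seq I) (P : pred I) (F : I -> V) v :
  b v (\sum_(i <- r | P i) F i) = \sum_(i <- r | P i) b v (F i).
Proof. by rewrite formC// form_suml; apply: eq_bigr => i _; exact: formC. Qed.

Lemma form_sqD u v : b (u + v) (u + v) = b u u + 2 * b u v + b v v.
Proof. rewrite !formDr !(formDl hb) (formC hb v u); ring. Qed.

Lemma form_sqB u v : b (u - v) (u - v) = b u u - 2 * b u v + b v v.
Proof. rewrite form_sqD formNr formNl formNr; ring. Qed.

Lemma form_parallelogram u v :
  b (u - v) (u - v) = 2 * b u u + 2 * b v v - b (u + v) (u + v).
Proof. rewrite form_sqB form_sqD; ring. Qed.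

Lemma form_sqZ (c : R) u : b (c *: u) (c *: u) = c ^+ 2 * b u u.
Proof. by rewrite (formZl hb) formZr mulrA expr2. Qed.

(** Young's form of the Cauchy-Schwarz inequality. *)
Lemma form_sqD_le (t : R) u v : 0 < t ->
  b (u + v) (u + v) <= (1 + t) * b u u + (1 + t^-1) * b v v.
Proof.
move=> t0; have := form_ge0 hb (t *: u - v).
rewrite form_sqB form_sqZ (formZl hb) form_sqD => H.
have := ler_wpM2l (ltW (_ : 0 < t^-1)) H; rewrite invr_gt0 => /(_ t0).
rewrite mulr0 !mulrDr (_ : t^-1 * (t ^+ 2 * b u u) = t * b u u); last by field; rewrite gt_eqF.
rewrite (_ : t^-1 * - (2 * (t * b u v)) = - (2 * b u v)); last by field; rewrite gt_eqF.
by lra.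
Qed.

Lemma form_CS u v : b u v ^+ 2 <= b u u * b v v.
Proof.
have [v0|v0] := eqVneq (b v v) 0.
  have H (t : R) : 0 <= b u u + t * b u v.
    have := form_ge0 hb (u + (t / 2) *: v).
    by rewrite form_sqD form_sqZ formZr v0; lra.
  have uv0 : b u v = 0.
    apply/eqP; rewrite -[_ == _]negbK; apply/negP => /eqP uv.
    have := H (- (b u u + 1) / b u v).
    by rewrite mulfVK; [lra|exact/eqP].
  by rewrite uv0 v0 mulr0 expr0n.
have vp : 0 < b v v by rewrite lt_def v0 form_ge0.
have := form_ge0 hb (b v v *: u - b u v *: v).
rewrite form_sqB !form_sqZ (formZl hb) formZr => H.
have {}H : 0 <= b v v * (b v v * b u u - b u v ^+ 2) by move: H; lra.
by move: H; rewrite pmulr_rge0//; lra.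
Qed.

End Form.

Variables a b : V -> V -> R.
Hypotheses (ha : semi_inner a) (hb : semi_inner b).

Definition graph_converges (v : nat -> V) w := forall e : R, 0 < e ->
  exists N, forall n, (N <= n)%N -> a (v n - w) (v n - w) + b (v n - w) (v n - w) <= e.

(** Completeness for the form [a + b]. *)
Definition graph_complete := forall v : nat -> V,
  (forall e : R, 0 < e -> exists N, forall m n, (N <= m)%N -> (N <= n)%N ->
     a (v m - v n) (v m - v n) + b (v m - v n) (v m - v n) <= e) ->
  exists w, graph_converges v w.

Definition bounded_functional (l : V -> R) :=
  [/\ forall u v, l (u - v) = l u - l v & exists C, forall v, l v ^+ 2 <= C * b v v].

(** Compactness of the embedding of the form domain, in the guise of an
    inequality: up to an arbitrarily small multiple of [a], the form [b] is
    controlled by finitely many bounded functionals. *)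
Definition form_compact := forall eta : R, 0 < eta -> exists L : seq (V -> R),
  (forall l, List.In l L -> bounded_functional l) /\
  forall v, b v v <= eta * a v v + \sum_(l <- L) l v ^+ 2.

Hypothesis cplt : graph_complete.
Hypothesis cpct : form_compact.

Section Minimisation.
Variable D : V -> Prop.
Hypothesis DD : forall u v, D u -> D v -> D (u + v).
Hypothesis DZ : forall (c : R) u, D u -> D (c *: u).
Hypothesis Dclosed : forall (v : nat -> V) w, (forall n : nat, D (v n)) -> graph_converges v w -> D w.
Variable v0 : V.
Hypotheses (Dv0 : D v0) (bv0 : 0 < b v0 v0).

Let rayleigh := [set a v v | v in [set v | D v /\ b v v = 1]].
Let lam := inf rayleigh.

Let ray_lb : lbound rayleigh 0.
Proof. by move=> _ [v _ <-]; exact: form_ge0. Qed.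

Let normalize v : 0 < b v v -> b ((Num.sqrt (b v v))^-1 *: v) ((Num.sqrt (b v v))^-1 *: v) = 1.
Proof. by move=> bv; rewrite form_sqZ// exprVn sqr_sqrtr ?ltW// mulVf// gt_eqF. Qed.

Let ray_n0 : rayleigh !=set0.
Proof.
exists (a ((Num.sqrt (b v0 v0))^-1 *: v0) ((Num.sqrt (b v0 v0))^-1 *: v0)).
by exists ((Num.sqrt (b v0 v0))^-1 *: v0) => //; split; [exact: DZ|exact: normalize].
Qed.

Let ray_inf : has_inf rayleigh.
Proof. by split; [exact: ray_n0|exists 0; exact: ray_lb]. Qed.

Let lam_ge0 : 0 <= lam.
Proof. by apply: lb_le_inf; [exact: ray_n0|exact: ray_lb]. Qed.

Let lam_le v : D v -> lam * b v v <= a v v.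
Proof.
move=> Dv; have [bv|bv] := ltP 0 (b v v); last first.
  have -> : b v v = 0 by apply/eqP; rewrite eq_le bv form_ge0.
  by rewrite mulr0; exact: form_ge0.
have : lam <= a ((Num.sqrt (b v v))^-1 *: v) ((Num.sqrt (b v v))^-1 *: v).
  apply: ge_inf; first by case: ray_inf.
  by exists ((Num.sqrt (b v v))^-1 *: v) => //; split; [exact: DZ|exact: normalize].
rewrite form_sqZ// exprVn (sqr_sqrtr (ltW bv)) => H.
by rewrite -ler_pdivlMr// [_ / _]mulrC.
Qed.

Let near_min (d : R) := [set v | [/\ D v, b v v = 1 & a v v <= lam + d]].

Let near_min_n0 d : 0 < d -> near_min d !=set0.
Proof.
move=> d0; have [_ [v [Dv bv] <-] av] := inf_adherent d0 ray_inf.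
by exists v; split => //; exact: ltW.
Qed.

Let minF : set_system V := [set A | exists2 d : R, 0 < d & near_min d `<=` A].

Let minF_proper : ProperFilter minF.
Proof.
split; first by move=> [d d0 sub]; have [v /sub] := near_min_n0 d0.
split.
- by exists 1.
- move=> P Q [d d0 sP] [e e0 sQ]; exists (Num.min d e); first by rewrite lt_min d0.
  move=> v [Dv bv av]; split; [apply: sP|apply: sQ]; split => //; apply: (le_trans av).
    by rewrite lerD2l ge_min lexx.
  by rewrite lerD2l ge_min lexx orbT.
- by move=> P Q PQ [d d0 sP]; exists d => //; exact: subset_trans PQ.
Qed.

(** Along an ultrafilter of almost minimisers every bounded functional
    converges, so compactness makes the ultrafilter Cauchy for [b], and the
    parallelogram identity makes it Cauchy for [a]. *)
Let small_sets (e : R) : 0 < e -> forall U : set_system V, UltraFilter U -> minF `<=` U ->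
  exists2 E, U E & (forall v, E v -> near_min e v) /\
    forall v w, E v -> E w -> a (v - w) (v - w) + b (v - w) (v - w) <= e.
Proof.
move=> e0 U UU FU.
have PU : ProperFilter U by exact: ultra_proper.
have Unear d : 0 < d -> U (near_min d) by move=> d0; apply: FU; exists d.
have smallb (k : R) : 0 < k -> exists2 E, U E & forall v w, E v -> E w -> b (v - w) (v - w) <= k.
  move=> k0; pose eta := k / (8 * (lam + 1)).
  have l1 : 0 < lam + 1 by rewrite ltr_wpDl.
  have eta0 : 0 < eta by rewrite divr_gt0// mulr_gt0.
  have [L [Lb Lle]] := cpct eta0.
  have [E UE HE] : exists2 E, U E & forall v w, E v -> E w -> \sum_(l <- L) l (v - w) ^+ 2 <= k / 2.
    have k20 : 0 < k / 2 by rewrite divr_gt0.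
    move: {Lle} (k / 2) k20; elim: L Lb => [|l L IH] Lb c c0.
      by exists setT; [exact: filterT|move=> v w _ _; rewrite big_nil ltW].
    have Lb' l' : List.In l' L -> bounded_functional l' by move=> l'L; apply: Lb; right.
    have c2 : 0 < c / 2 by rewrite divr_gt0.
    have [E UE HE] := IH Lb' _ c2.
    have [lB [C lC]] := Lb l (or_introl erefl).
    pose M := Num.sqrt C.
    have lM v : near_min 1 v -> `|l v| <= M.
      move=> [_ bv _]; rewrite -sqrtr_sqr ler_wsqrtr//.
      by have := lC v; rewrite bv mulr1.
    have UM : (l @ U) `[- M, M]%classic.
      apply: (@filterS _ _ _ (near_min 1)); last exact: Unear.
      by move=> v /lM; rewrite /= in_itv/= ler_norml.
    have := @segment_compact R (- M) M; rewrite compact_ultra.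
    move=> /(_ _ _ UM)[|x [_ lx]]; first exact: ultra_fmap.
    pose r := Num.sqrt (c / 8).
    have r0 : 0 < r by rewrite sqrtr_gt0 divr_gt0.
    have Ul : U [set v | `|x - l v| < r].
      by have /cvgrPdist_lt /(_ r r0) := lx.
    exists (E `&` [set v | `|x - l v| < r]); first exact: filterI.
    move=> v w [Ev lv] [Ew lw]; rewrite big_cons lB (splitr c) lerD ?HE//.
    have h : `|l v - l w| <= 2 * r.
      rewrite (_ : l v - l w = (x - l w) - (x - l v)); last by ring.
      by rewrite (le_trans (ler_normB _ _))//; move: lv lw => /= ? ?; lra.
    rewrite -real_normK ?num_real// (_ : c / 2 = (2 * r) ^+ 2).
      by rewrite ler_pXn2r ?nnegrE// mulr_ge0// ltW.
    by rewrite exprMn sqr_sqrtr ?divr_ge0 ?ltW//; field.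
  exists (E `&` near_min 1); first by apply: filterI => //; exact: Unear.
  move=> v w [Ev [Dv bv av]] [Ew [Dw bw aw]].
  apply: (le_trans (Lle _)).
  have avw : a (v - w) (v - w) <= 4 * (lam + 1).
    rewrite form_parallelogram//; have := form_ge0 ha (v + w); lra.
  have : eta * a (v - w) (v - w) <= k / 2.
    apply: (le_trans (ler_wpM2l (ltW eta0) avw)).
    by rewrite /eta le_eqVlt; apply/orP; left; apply/eqP; field; rewrite gt_eqF.
  by have := HE _ _ Ev Ew; lra.
pose d := Num.min e (e / 8).
have d0 : 0 < d by rewrite lt_min e0 divr_gt0.
have k0 : 0 < e / (2 * (lam + 1)) by rewrite divr_gt0// mulr_gt0// ltr_wpDl.
have [E UE HE] := smallb _ k0.
exists (E `&` near_min d); first by apply: filterI => //; exact: Unear.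
split.
  move=> v [_ [Dv bv av]]; split => //; apply: (le_trans av).
  by rewrite lerD2l ge_min lexx.
move=> v w [Ev [Dv bv av]] [Ew [Dw bw aw]].
have de : d <= e / 8 by rewrite ge_min lexx orbT.
have Hb := HE _ _ Ev Ew.
have Hl := lam_le (DD Dv Dw).
have P := form_parallelogram hb v w.
rewrite (form_parallelogram ha).
have key : (lam + 1) * b (v - w) (v - w) <= e / 2.
  rewrite (_ : e / 2 = (lam + 1) * (e / (2 * (lam + 1)))); last first.
    by field; rewrite gt_eqF// ltr_wpDl.
  by rewrite ler_wpM2l// addr_ge0.
have bs : b (v + w) (v + w) = 4 - b (v - w) (v - w) by lra.
rewrite bs in Hl.
nra.
Qed.

(** Nested small sets of almost minimisers give a Cauchy sequence, whose limit is
    a minimiser because both forms are continuous along it. *)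
Lemma rayleigh_minimiser : exists u, [/\ D u, b u u = 1 &
  forall v, D v -> a u u * b v v <= a v v].
Proof.
have [U [UU FU]] := ultraFilterLemma minF_proper.
have PU : ProperFilter U by exact: ultra_proper.
have e_gt0 n : 0 < (n.+1%:R : R)^-1 by rewrite invr_gt0.
have /choice[E HE] n : exists E, U E /\ ((forall v, E v -> near_min n.+1%:R^-1 v) /\
    forall v w, E v -> E w -> a (v - w) (v - w) + b (v - w) (v - w) <= n.+1%:R^-1).
  by have [E UE HE] := small_sets (e_gt0 n) UU FU; exists E.
have /choice[v Hv] n : exists v, forall k, (k <= n)%N -> E k v.
  have : U [set w | forall k, (k <= n)%N -> E k w].
    elim: n => [|n IH].
      have [U0 _] := HE 0%N; apply: filterS U0 => w Ew k.
      by rewrite leqn0 => /eqP ->.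
    have [Un _] := HE n.+1; apply: filterS2 IH Un => w H1 H2 k.
    by rewrite leq_eqVlt => /orP[/eqP ->//|]; rewrite ltnS; exact: H1.
  by move=> /filter_ex[w Ew]; exists w => k kn; exact: Ew.
have invN (e : R) : 0 < e -> exists N : nat, N.+1%:R^-1 <= e.
  move=> e0; exists (Num.truncn e^-1); rewrite invf_ple ?posrE//.
  by rewrite ltW// truncnS_gt// invr_ge0 ltW.
have [|w vw] := cplt (v := v).
  move=> e /invN[N Ne]; exists N => m n Nm Nn.
  have [_ [_ H]] := HE N.
  by apply: le_trans Ne; apply: H; exact: Hv.
have Dv n : D (v n) by have [_ [/(_ _ (Hv n n (leqnn n)))[]]] := HE n.
have bv n : b (v n) (v n) = 1 by have [_ [/(_ _ (Hv n n (leqnn n)))[]]] := HE n.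
have av k n : (k <= n)%N -> a (v n) (v n) <= lam + k.+1%:R^-1.
  by move=> kn; have [_ [/(_ _ (Hv n k kn))[]]] := HE k.
have Dw := Dclosed Dv vw.
have eps_le (x y : R) : (forall t : R, 0 < t -> t <= 1 -> x <= (1 + t) * y + t) -> x <= y.
  move=> H; apply/ler_addgt0Pr => e e0.
  pose t := Num.min 1 (e / (1 + `|y|)).
  have y1 : 0 < 1 + `|y| by rewrite ltr_wpDr.
  have t0 : 0 < t by rewrite lt_min ltr01 divr_gt0.
  have := H t t0; rewrite ge_min lexx => /(_ isT) Ht.
  have te : t * (1 + `|y|) <= e by rewrite -ler_pdivlMr// ge_min lexx orbT.
  have : t * y <= t * `|y| by rewrite ler_wpM2l ?ler_norm// ltW.
  by lra.
(* passing to the limit in either form, up to an arbitrary t *)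
have pass (q : V -> V -> R) (hq : semi_inner q) t : 0 < t -> t <= 1 ->
    (forall x, q x x <= a x x + b x x) ->
    exists N, forall n, (N <= n)%N ->
      (1 + t^-1) * q (w - v n) (w - v n) <= t /\ (1 + t^-1) * q (v n - w) (v n - w) <= t.
  move=> t0 t1 qab; have t10 : 0 < 1 + t^-1 by rewrite ltr_wpDr// invr_ge0 ltW.
  have [N HN] := vw (t / (1 + t^-1)) (divr_gt0 t0 t10).
  exists N => n /HN; rewrite -opprB => H.
  rewrite ![(1 + _) * _]mulrC -!ler_pdivlMr//.
  have E2 : q (- (w - v n)) (- (w - v n)) = q (w - v n) (w - v n).
    by rewrite formNl// formNr// opprK.
  by rewrite E2; split; rewrite -E2; exact: le_trans (qab _) H.
have ale x : a x x <= a x x + b x x by rewrite lerDl form_ge0.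
have ble x : b x x <= a x x + b x x by rewrite lerDr form_ge0.
have bw : b w w = 1.
  apply/eqP; rewrite eq_le; apply/andP; split; apply: eps_le => t t0 t1.
    have [N HN] := pass b hb t t0 t1 ble; have [H _] := HN N (leqnn N).
    have := form_sqD_le hb (v N) (w - v N) t0; rewrite addrC subrK bv; lra.
  have [N HN] := pass b hb t t0 t1 ble; have [_ H] := HN N (leqnn N).
  have := form_sqD_le hb w (v N - w) t0; rewrite addrC subrK bv; lra.
have aw : a w w <= lam.
  apply: eps_le => t t0 t1.
  have t40 : 0 < t / 4 by rewrite divr_gt0.
  have t41 : t / 4 <= 1 by lra.
  have [N HN] := pass a ha (t / 4) t40 t41 ale; have [k kt] := invN _ t40.
  have [H _] := HN (maxn N k) (leq_maxl _ _).
  have := form_sqD_le ha (v (maxn N k)) (w - v (maxn N k)) t40.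
  have Hav : (1 + t / 4) * a (v (maxn N k)) (v (maxn N k)) <= (1 + t / 4) * (lam + t / 4).
    rewrite ler_wpM2l ?addr_ge0 ?(ltW t40)//.
    by apply: (le_trans (av _ _ (leq_maxr N k))); rewrite lerD2l.
  rewrite [v _ + _]addrC subrK => Hf.
  have tl : 0 <= t * lam by rewrite mulr_ge0// ltW.
  have tt : t * t <= t by rewrite ler_piMr// ltW.
  apply: (le_trans Hf); apply: (le_trans (lerD Hav H)); lra.
exists w; split => // x Dx; apply: le_trans (lam_le Dx).
by rewrite ler_wpM2r// form_ge0.
Qed.

End Minimisation.

Definition eigenvector (l : R) (u : V) := forall phi, a u phi = l * b u phi.

(** Linear independence modulo the kernel of [b]. *)
Definition form_free n (W : 'I_n -> V) := forall c : 'I_n -> R,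
  b (\sum_(i < n) c i *: W i) (\sum_(i < n) c i *: W i) = 0 -> forall i, c i = 0.

(** The minimality of each eigenvector on the orthogonal complement of the
    previous ones is kept with the eigenvalue equation, because the comparison of
    two domains rests on it. *)
Definition eigensystem n (lam : nat -> R) (u : nat -> V) :=
  [/\ forall i j, (i < n)%N -> (j < n)%N -> b (u i) (u j) = (i == j)%:R,
      forall i, (i < n)%N -> eigenvector (lam i) (u i) &
      forall i v, (i < n)%N -> (forall j, (j < i)%N -> b (u j) v = 0) ->
        lam i * b v v <= a v v].

(** Fewer linear conditions than dimensions leave a nonzero vector. *)
Lemma free_orthogonal N (W : 'I_N -> V) n (l : 'I_n -> V -> R) :
  form_free W -> (forall i (c : 'I_N -> R), l i (\sum_j c j *: W j) = \sum_j c j * l i (W j)) ->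
  (n < N)%N -> exists c : 'I_N -> R, 0 < b (\sum_j c j *: W j) (\sum_j c j *: W j) /\
    forall i, l i (\sum_j c j *: W j) = 0.
Proof.
move=> fW ll nN.
pose M : 'M[R]_(N, n) := \matrix_(j, i) l i (W j).
have kn0 : kermx M != 0.
  rewrite kermx_eq0; apply/negP => /eqP rM.
  by have := rank_leq_col M; rewrite rM leqNgt nN.
have [j rj] : exists j, row j (kermx M) != 0.
  apply/existsP; rewrite -[[exists _, _]]negbK negb_exists; apply/negP => /forallP H.
  by case/negP: kn0; apply/eqP/row_matrixP => j; rewrite row0; apply/eqP; have := H j; rewrite negbK.
set c := row j (kermx M); exists (c 0); split.
  rewrite lt_def form_ge0// andbT; apply/eqP => /fW c0.
  by case/negP: rj; apply/eqP/rowP => i; rewrite -/c c0 mxE.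
have cM : c *m M = 0 by rewrite /c -row_mul mulmx_ker row0.
move=> i; rewrite ll; have := congr1 (fun A : 'rV_n => A 0 i) cM.
by rewrite mxE [RHS]mxE => E; rewrite -[RHS]E; apply: eq_bigr => k _; rewrite [M _ _]mxE.
Qed.

Lemma form_sumZr (u : V) N (W : 'I_N -> V) (c : 'I_N -> R) :
  b u (\sum_j c j *: W j) = \sum_j c j * b u (W j).
Proof. by rewrite form_sumr//; apply: eq_bigr => j _; rewrite formZr. Qed.

(** A minimiser of the Rayleigh quotient on the orthogonal complement satisfies
    the Euler equation there; it satisfies it on the previous eigenvectors by
    orthogonality. *)
Lemma eigensystem_step n lam (u : nat -> V) v0 : eigensystem n lam u ->
  (forall j, (j < n)%N -> b (u j) v0 = 0) -> 0 < b v0 v0 ->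
  exists lam' (u' : nat -> V), eigensystem n.+1 lam' u' /\
    forall i, (i < n)%N -> lam' i = lam i /\ u' i = u i.
Proof.
move=> [uo ue um] v0u bv0.
pose D v := forall j, (j < n)%N -> b (u j) v = 0.
have [w [Dw bw wm]] : exists w, [/\ D w, b w w = 1 & forall v, D v -> a w w * b v v <= a v v].
  apply: (@rayleigh_minimiser D _ _ _ v0) => //.
  - by move=> x y Dx Dy j jn; rewrite formDr// Dx// Dy// addr0.
  - by move=> c x Dx j jn; rewrite formZr// Dx// mulr0.
  - move=> v x Dv vx j jn; apply/eqP; rewrite -sqrf_eq0 -[_ == _]negbK; apply/negP => h.
    have bx : 0 < b (u j) x ^+ 2 by rewrite lt_def h sqr_ge0.
    have [N HN] := vx (b (u j) x ^+ 2 / 2) (divr_gt0 bx (ltr0n _ 2)).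
    have := HN N (leqnn N); have := form_ge0 ha (v N - x).
    have := form_CS hb (u j) (v N - x).
    by rewrite formDr// formNr// Dv// sub0r sqrrN uo// eqxx mul1r; lra.
exists (fun i => if i == n then a w w else lam i), (fun i => if i == n then w else u i).
have ltne i : (i < n)%N -> (i == n) = false by move=> /ltn_eqF.
split; last by move=> i /ltne ->.
split.
- move=> i j; rewrite !ltnS (leq_eqVlt i n) (leq_eqVlt j n).
  move=> /orP[/eqP ->|ni] /orP[/eqP ->|nj].
  + by rewrite !eqxx bw.
  + by rewrite eqxx (ltne _ nj) formC// Dw// eq_sym (ltne _ nj).
  + by rewrite eqxx (ltne _ ni) Dw.
  + by rewrite (ltne _ ni) (ltne _ nj) uo.
- move=> i; rewrite ltnS leq_eqVlt => /orP[/eqP ->|ni]; last by rewrite (ltne _ ni); exact: ue.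
  rewrite eqxx.
  have EL phi : D phi -> a w phi = a w w * b w phi.
    move=> Dphi; set l := a w w.
    have Q (t : R) : 0 <= 2 * t * (a w phi - l * b w phi) + t ^+ 2 * (a phi phi - l * b phi phi).
      have Dt : D (w + t *: phi).
        by move=> j jn; rewrite formDr// formZr// Dw// Dphi// mulr0 addr0.
      have := wm _ Dt; rewrite !form_sqD// !form_sqZ// !formZr// bw -/l; lra.
    apply/eqP; rewrite -subr_eq0; apply/eqP; set x := _ - _; set y := a phi phi - l * b phi phi in Q.
    apply/eqP; rewrite -[_ == _]negbK; apply/negP => x0.
    pose t := - x / (1 + `|y|).
    have y1 : 0 < 1 + `|y| by rewrite ltr_wpDr.
    have := Q t; rewrite -/x.
    have : y <= `|y| by exact: ler_norm.
    have xx : 0 < x ^+ 2 by rewrite lt_def sqrf_eq0 x0 sqr_ge0.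
    have -> : 2 * t * x + t ^+ 2 * y = x ^+ 2 / (1 + `|y|) ^+ 2 * (y - 2 * (1 + `|y|)).
      by rewrite /t; field; rewrite gt_eqF.
    move=> yy; rewrite pmulr_rge0; first by have := normr_ge0 y; lra.
    by rewrite divr_gt0// exprn_gt0.
  move=> phi; pose phi' := phi - \sum_(j < n) b (u j) phi *: u j.
  have Dphi' : D phi'.
    move=> j jn; rewrite formDr// formNr// form_sumr// (bigD1 (Ordinal jn))//= formZr// uo// eqxx mulr1.
    rewrite big1 ?addr0 ?subrr// => k kj; rewrite formZr// uo//.
    rewrite eq_sym [_ == _](_ : _ = false) ?mulr0//.
    by apply/negbTE; apply: contra kj => /eqP kj; apply/eqP/val_inj.
  have au (q : V -> V -> R) (hq : semi_inner q) : (forall j, (j < n)%N -> q w (u j) = 0) ->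
      q w phi = q w phi'.
    move=> qu; rewrite formDr// formNr// form_sumr// big1 ?subr0// => j _.
    by rewrite formZr// qu ?mulr0.
  rewrite (au a ha) ?(au b hb); first exact: EL.
    by move=> j jn; rewrite formC// Dw.
  by move=> j jn; rewrite formC// ue// Dw// mulr0.
- move=> i v; rewrite ltnS leq_eqVlt => /orP[/eqP ->|ni] H.
    rewrite eqxx; apply: wm => j jn.
    by have := H j jn; rewrite (ltne _ jn).
  rewrite (ltne _ ni); apply: um => // j ji.
  by have := H j ji; rewrite (ltne _ (ltn_trans ji ni)).
Qed.

Theorem spectral N (W : 'I_N -> V) : form_free W -> exists lam (u : nat -> V), eigensystem N lam u.
Proof.
move=> fW; suff H n : (n <= N)%N -> exists lam (u : nat -> V), eigensystem n lam u by exact: H.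
elim: n => [|n IH] nN; first by exists (fun=> 0), (fun=> 0); split.
have [lam [u es]] := IH (ltnW nN).
have [c [bv vo]] := @free_orthogonal N W n (fun i v => b (u i) v) fW
  (fun i c => form_sumZr _ _ _) nN.
have [lam' [u' [es' _]]] := eigensystem_step es (fun j jn => vo (Ordinal jn)) bv.
by exists lam', u'.
Qed.

(** A space of test vectors of dimension [N] contains a nonzero vector orthogonal
    to the first [i < N] eigenvectors. *)
Lemma eigensystem_le_test N lam (u : nat -> V) (W : 'I_N -> V) t : eigensystem N lam u -> form_free W ->
  (forall c : 'I_N -> R, a (\sum_j c j *: W j) (\sum_j c j *: W j) <=
     t * b (\sum_j c j *: W j) (\sum_j c j *: W j)) ->
  forall i, (i < N)%N -> lam i <= t.
Proof.
move=> [_ _ um] fW Wt i iN.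
have [c [bv vo]] := @free_orthogonal N W i (fun j v => b (u j) v) fW
  (fun i c => form_sumZr _ _ _) iN.
have := um i _ iN (fun j ji => vo (Ordinal ji)).
by move=> /le_trans /(_ (Wt c)); rewrite ler_pM2r.
Qed.

Lemma eigensystem_monotone N lam (u : nat -> V) i j : eigensystem N lam u -> (i <= j)%N -> (j < N)%N ->
  lam i <= lam j.
Proof.
move=> [uo ue um] ij jN.
have := um i (u j) (leq_ltn_trans ij jN); rewrite (ue j jN) uo// eqxx !mulr1; apply.
by move=> k ki; rewrite uo ?(ltn_trans ki (leq_ltn_trans ij jN))// ltn_eqF// (leq_trans ki).
Qed.

Lemma eigensystem_free N lam (u : nat -> V) : eigensystem N lam u -> form_free (fun i : 'I_N => u i).
Proof.
move=> [uo _ _] c; set v := \sum_i _ => v0 i.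
have : b (u i) v = c i.
  rewrite form_sumZr (bigD1 i)//= uo// eqxx mulr1 big1 ?addr0// => j ji.
  by rewrite uo// [_ == _](_ : _ = false) ?mulr0//; apply/negbTE; rewrite eq_sym; exact: ji.
have := form_CS hb (u i) v; rewrite v0 mulr0 => h <-.
by apply/eqP; rewrite -sqrf_eq0 eq_le h sqr_ge0.
Qed.

(** Orthonormality and the eigenvalue equations make both forms diagonal. *)
Lemma eigensystem_span N lam (u : nat -> V) (c : 'I_N -> R) t : eigensystem N lam u ->
  (forall i, (i < N)%N -> lam i <= t) ->
  let v := \sum_i c i *: u i in
  b v v = \sum_i c i ^+ 2 /\ a v v <= t * b v v.
Proof.
move=> [uo ue _] lt v.
have bu (i : 'I_N) : b (u i) v = c i.
  rewrite form_sumZr (bigD1 i)//= uo// eqxx mulr1 big1 ?addr0// => j ji.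
  by rewrite uo// [_ == _](_ : _ = false) ?mulr0//; apply/negbTE; rewrite eq_sym; exact: ji.
have bvv : b v v = \sum_i c i ^+ 2.
  by rewrite {1}/v form_suml//; apply: eq_bigr => i _; rewrite (formZl hb) bu expr2.
split=> //; rewrite bvv mulr_sumr {1}/v form_suml//; apply: ler_sum => i _.
rewrite (formZl ha) ue// bu mulrCA -expr2 ler_wpM2r ?sqr_ge0//.
exact: lt.
Qed.

End AbstractSpectral.

(** * Completeness of the space of square-integrable functions *)

Section RieszFischer.
Context d (T : measurableType d) (R : realType).
Variables (mu : {measure set T -> \bar R}) (D : set T).
Hypothesis mD : measurable D.

Let sqint (f : T -> R) : \bar R := (\int[mu]_(x in D) (f x ^+ 2)%:E)%E.

Lemma limn_einf_le (u : (\bar R)^nat) (e : \bar R) N :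
  (forall k, (N <= k)%N -> (u k <= e)%E) -> (limn_einf u <= e)%E.
Proof.
move=> ue; rewrite limn_einf_lim; apply: lime_le; first exact: is_cvg_einfs.
apply: nearW => n; apply: le_trans (ue (maxn n N) (leq_maxr _ _)).
by apply: ereal_inf_lbound; exists (maxn n N) => //=; exact: leq_maxl.
Qed.

(** The series of the increments is dominated by a geometric series. *)
Lemma geometric_cvg (f : nat -> R) (c : R) :
  (forall k, `|f k.+1 - f k| <= c * (2^-1) ^+ k) -> cvgn f.
Proof.
move=> fc; have c0 : 0 <= c.
  by have := fc 0%N; rewrite expr0 mulr1; apply: le_trans.
have : cvgn (series (telescope f)).
  apply: normed_cvg; apply: (@series_le_cvg _ _ (geometric c 2^-1)).
  - by move=> n; exact: normr_ge0.
  - by move=> n; rewrite /geometric/= mulr_ge0// exprn_ge0.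
  - by move=> n; exact: fc.
  - by apply: is_cvg_geometric_series; rewrite ger0_norm ?invr_ge0// invf_lt1// ltr1n.
rewrite telescopeK => /cvg_ex[l fl]; apply/cvg_ex; exists (l + f 0%N).
have H : (fun n => (f n - f 0%N) + f 0%N) @ \oo --> l + f 0%N.
  by apply: cvgD; [exact: fl|exact: cvg_cst].
by move: H; rewrite (_ : (fun n => _) = f)//; apply/funext => n; rewrite subrK.
Qed.

(** Riesz-Fischer. Along a subsequence with [|f_(k+1) - f_k|^2 <= 8^-k] the weighted
    sum of the squares of the increments, with weights [4^k], has a finite
    integral. Where the sum is finite the increments are geometrically small, so
    that the subsequence converges almost everywhere; Fatou then bounds the
    distance to the limit. *)
Theorem L2_complete_measure (v : nat -> T -> R) : (forall n, measurable_fun D (v n)) ->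
  (forall e : R, 0 < e -> exists N, forall m n, (N <= m)%N -> (N <= n)%N ->
     (sqint (fun x => v m x - v n x)%R <= e%:E)%E) ->
  exists2 w : T -> R, measurable_fun D w &
  forall e : R, 0 < e -> exists N, forall n, (N <= n)%N ->
     (sqint (fun x => v n x - w x)%R <= e%:E)%E.
Proof.
move=> mv cv.
pose eps k : R := 4^-1 ^+ k / (2 ^ k.+1)%:R.
have eps0 k : 0 < eps k.
  by rewrite divr_gt0// ?exprn_gt0// ?invr_gt0// ltr0n expn_gt0.
have /choice[K HK] k : exists N, forall m n, (N <= m)%N -> (N <= n)%N ->
    (sqint (fun x => v m x - v n x)%R <= (eps k)%:E)%E by exact: cv.
pose s k := (\sum_(i < k.+1) (K i).+1)%N.
have sK k : (K k <= s k)%N by rewrite /s big_ord_recr/= addnS leqW ?leq_addl.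
have ks k : (k <= s k)%N.
  elim: k => // k IH; rewrite /s big_ord_recr/= addnS ltnS.
  by rewrite (leq_trans IH)// leq_addr.
have sS k : (s k <= s k.+1)%N by rewrite /s [leqRHS]big_ord_recr/= leq_addr.
pose f k := v (s k).
have mf k : measurable_fun D (f k) by exact: mv.
have fS k : (sqint (fun x => f k.+1 x - f k x)%R <= (eps k)%:E)%E.
  by apply: HK; [exact: leq_trans (sK k) (sS k)|exact: sK].
pose gt k x : \bar R := (4 ^+ k * (f k.+1 x - f k x) ^+ 2)%:E.
have gt0 k x : (0 <= gt k x)%E by rewrite lee_fin; apply: mulr_ge0; [exact: exprn_ge0|exact: sqr_ge0].
have mgt k : measurable_fun D (gt k).
  apply/measurable_EFinP; apply: measurable_funM; first exact: measurable_cst.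
  by apply: measurable_funX; exact: measurable_funB.
pose G x := (\sum_(0 <= k <oo) gt k x)%E.
have mG : measurable_fun D G by apply: ge0_emeasurable_sum => // k x _ _; exact: gt0.
have G0 x : (0 <= G x)%E by apply: nneseries_ge0 => k _ _; exact: gt0.
have iG : mu.-integrable D G.
  apply/integrableP; split => //.
  apply: (@le_lt_trans _ _ 1%:E); last by rewrite ltry.
  rewrite (eq_integral G); last by move=> x _; rewrite gee0_abs.
  rewrite /G integral_nneseries//.
  apply: le_trans (epsilon_trick0 xpredT ler01).
  apply: lee_nneseries => [k _ _|k _]; first by apply: integral_ge0 => x _; exact: gt0.
  rewrite /gt; under eq_integral do rewrite EFinM.
  rewrite ge0_integralZl_EFin//; last 2 first.
  - by move=> x _; rewrite lee_fin sqr_ge0.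
  - by apply/measurable_EFinP; apply: measurable_funX; exact: measurable_funB.
  apply: (@le_trans _ _ ((4 ^+ k)%:E * (eps k)%:E)%E).
    by rewrite lee_pmul2l// ?lte_fin ?exprn_gt0//; exact: fS.
  rewrite -EFinM lee_fin /eps mulrA -exprMn divff// expr1n//.
pose good := D `&` [set x | (G x < +oo)%E].
have mgood : measurable good by exact: emeasurable_fun_infty_o.
pose h k x := f k x * \1_good x.
have mh k : measurable_fun D (h k) by apply: measurable_funM => //; exact: measurable_indic.
have cvh x : cvgn (h ^~ x).
  rewrite /h indicE; have [xg|xg] := boolP (x \in good); last first.
    have -> : (fun k => f k x * false%:R) = cst 0 by apply/funext => k; rewrite mulr0.
  exact: is_cvg_cst.
  have -> : (fun k => f k x * true%:R) = f ^~ x by apply/funext => k; rewrite mulr1.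
  have [Dx Gx] : good x by exact: set_mem.
  have Gf : G x \is a fin_num by rewrite ge0_fin_numE.
  apply: (@geometric_cvg _ (Num.sqrt (fine (G x)))) => k.
  have : (gt k x <= G x)%E.
    apply: le_trans (nneseries_lim_ge k.+1 (fun i _ _ => gt0 i x)).
    rewrite big_nat_recr//= leeDr//; apply: sume_ge0 => i _; exact: gt0.
  move=> H; rewrite -(fineK Gf) lee_fin in H.
  have h2 : 0 <= (2^-1 : R) ^+ k by rewrite exprn_ge0.
  rewrite -[leLHS]sqrtr_sqr; have -> : (2^-1 : R) ^+ k = Num.sqrt (((2^-1) ^+ k) ^+ 2).
    by rewrite sqrtr_sqr ger0_norm.
  rewrite -sqrtrM ?fine_ge0//; apply: ler_wsqrtr.
  rewrite -exprM mulnC exprM (_ : (2^-1 : R) ^+ 2 = 4^-1); last by field.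
  by rewrite -ler_pdivrMr ?exprn_gt0 ?invr_gt0// exprVn invrK mulrC.
pose w x := lim (h ^~ x @ \oo).
have hw x : (h ^~ x) @ \oo --> w x by exact: cvh.
have mw : measurable_fun D w by apply: (measurable_fun_cvg mh) => x _; exact: hw.
exists w => // e e0; have [N HN] := cv e e0; exists N => n Nn.
pose F k x : \bar R := ((v n x - h k x) ^+ 2)%:E.
have mF k : measurable_fun D (F k).
  by apply/measurable_EFinP; apply: measurable_funX; exact: measurable_funB.
have F0 k x : D x -> (0 <= F k x)%E by move=> _; rewrite lee_fin sqr_ge0.
have := fatou mu mD mF F0.
rewrite (eq_integral (fun x => ((v n x - w x) ^+ 2)%:E)); last first.
  move=> x _; suff : F ^~ x @ \oo --> ((v n x - w x) ^+ 2)%:E by move/cvg_limn_einf_sup => [-> _].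
  apply: cvg_EFin; first exact: nearW.
  have H : (fun k => v n x - h k x) @ \oo --> v n x - w x.
    by apply: cvgB; [exact: cvg_cst|exact: hw].
  exact: (cvgM H H).
move=> /le_trans; apply; apply: (@limn_einf_le _ _ N) => k Nk.
have Nsk : (N <= s k)%N by exact: leq_trans Nk (ks k).
have -> : (\int[mu]_(x in D) F k x = sqint (fun x => v n x - v (s k) x)%R)%E; last exact: HN.
apply: ge0_ae_eq_integral => //.
- by apply/measurable_EFinP; apply: measurable_funX; exact: measurable_funB.
- by move=> x _; rewrite lee_fin sqr_ge0.
- by move=> x _; rewrite lee_fin sqr_ge0.
have [B [mB B0 sub]] := integrable_ae mD iG; exists B; split => // x /= nx; apply: sub => /= H.
apply: nx => Dx; rewrite /F /h indicE mem_set ?mulr1//.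
by split => //=; rewrite -ge0_fin_numE//; exact: H.
Qed.

End RieszFischer.

(** * The Sobolev space of a domain *)

Section InnerProduct.
Context {R : realType}.
Variable Omega : set (R * R).
Hypothesis mO : @measurable _ (mplane R) Omega.
Implicit Types (u v w : R * R -> R).

Definition ip u v : R := \int[leb2]_(x in Omega) (u x * v x).

Lemma ipC u v : ip u v = ip v u.
Proof. by apply: eq_Rintegral => x _; rewrite mulrC. Qed.

Lemma ipDl u v w : L2 Omega u -> L2 Omega v -> L2 Omega w ->
  ip (fun x => u x + v x) w = ip u w + ip v w.
Proof.
move=> Lu Lv Lw; rewrite /ip -RintegralD//; [|exact: L2_integrableM|exact: L2_integrableM].
by apply: eq_Rintegral => x _; rewrite mulrDl.
Qed.

Lemma ipZl (c : R) u v : L2 Omega u -> L2 Omega v -> ip (fun x => c * u x) v = c * ip u v.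
Proof.
move=> Lu Lv; rewrite /ip -RintegralZl//; last exact: L2_integrableM.
by apply: eq_Rintegral => x _; rewrite mulrA.
Qed.

Lemma L2N u : L2 Omega u -> L2 Omega (fun x => - u x).
Proof.
move=> Lu; have := L2Z (-1) mO Lu; rewrite (_ : (fun x => -1 * u x) = fun x => - u x)//.
by apply/funext => x; rewrite mulN1r.
Qed.

Lemma L2B u v : L2 Omega u -> L2 Omega v -> L2 Omega (fun x => u x - v x).
Proof. by move=> Lu /L2N; exact: L2D. Qed.

Lemma ip_ge0 u : 0 <= ip u u.
Proof. by apply: Rintegral_ge0 => x _; rewrite -expr2 sqr_ge0. Qed.

Lemma ipE u : L2 Omega u -> (\int[leb2]_(x in Omega) (u x ^+ 2)%:E = (ip u u)%:E)%E.
Proof. by move=> Lu; rewrite -(EFin_Rintegral mO (L2_integrable_sqr Lu)). Qed.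

(** A nonnegative quadratic polynomial has a nonpositive discriminant. *)
Lemma discriminant (a b c : R) : 0 <= c ->
  (forall t, 0 <= a + 2 * t * b + t ^+ 2 * c) -> b ^+ 2 <= a * c.
Proof.
move=> c0 H; have [c_0|cn0] := eqVneq c 0.
  have [->|b0] := eqVneq b 0; first by rewrite c_0 mulr0 expr0n.
  have := H (- (a + 1) / (2 * b)).
  rewrite c_0 mulr0 addr0 (_ : 2 * _ * b = - (a + 1)); last by field.
  lra.
have cp : 0 < c by rewrite lt_def cn0.
have := H (- b / c); rewrite (_ : _ + _ = (a * c - b ^+ 2) / c); last by field.
by rewrite pmulr_lge0 ?invr_gt0// subr_ge0.
Qed.

Lemma ip_CS u v : L2 Omega u -> L2 Omega v -> ip u v ^+ 2 <= ip u u * ip v v.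
Proof.
move=> Lu Lv; apply: discriminant => [|t]; first exact: ip_ge0.
have Ltv : L2 Omega (fun x => t * v x) by exact: L2Z.
have Lw : L2 Omega (fun x => u x + t * v x) by exact: L2D.
have := ip_ge0 (fun x => u x + t * v x).
rewrite ipDl// [ip u _]ipC [ip (fun x => t * v x) (fun x => u x + _)]ipC !ipDl// !ipZl//.
rewrite [ip u (fun x => t * v x)]ipC [ip v (fun x => t * v x)]ipC !ipZl// [ip v u]ipC expr2; lra.
Qed.

End InnerProduct.

Section TestFunctions.
Context {R : realType}.
Implicit Types (Omega K : set (R * R)) (phi : R * R -> R).

Lemma continuous_measurable2 phi : continuous phi -> @measurable_fun _ _ (mplane R) _ setT phi.
Proof.
move=> cphi; apply: (measurability _ (RGenOpens.measurableE R)) => _ [_ [a [b ->] <-]].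
by rewrite setTI; apply: open_measurable2; apply: open_comp => // x _; exact: cphi.
Qed.

Lemma plane_compact_closed K : compact K -> closed K.
Proof. by apply: compact_closed; exact: norm_hausdorff. Qed.

Lemma continuous_compact_bounded phi K : continuous phi -> compact K ->
  (forall x, ~ K x -> phi x = 0) -> exists M, forall x, `|phi x| <= M.
Proof.
move=> cphi cK phi0.
have : compact (phi @` K) by apply: continuous_compact => //; exact: continuous_subspaceT.
move=> /compact_bounded[M [Mr HM]]; exists (`|M| + 1) => x.
have [Kx|nK] := pselect (K x); last by rewrite phi0// normr0 addr_ge0.
apply: (HM (`|M| + 1)); first by rewrite (le_lt_trans (ler_norm _))// ltrDl.
by exists x.
Qed.

Lemma iter_deriv_out s phi K : closed K -> (forall x, ~ K x -> phi x = 0) ->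
  forall x, ~ K x -> iter_deriv s phi x = 0.
Proof.
move=> cK phi0; elim: s => // b s IH x nK /=.
transitivity ('D_(if b then @e1 R else @e2 R) (fun _ : R * R => 0 : R^o) x); last exact: derive_cst.
apply: near_eq_derive; have oK : open (~` K) by exact: closed_openC.
have : nbhs x (~` K) by exact: open_nbhs_nbhs.
by apply: filterS => y /IH.
Qed.

Lemma test_function_L2 Omega phi s : @measurable _ (mplane R) Omega ->
  (leb2 (Omega : set (mplane R)) < +oo)%E -> test_function Omega phi ->
  L2 Omega (iter_deriv s phi).
Proof.
move=> mO fO [sphi [K [cK KO phi0]]].
have [cd _] := sphi s.
have d0 := iter_deriv_out s (plane_compact_closed cK) phi0.
have [M HM] := continuous_compact_bounded cd cK d0.
apply: (L2_bounded (M := M)) => //.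
by apply: (@measurable_funS _ _ (mplane R) _ setT) => //; exact: continuous_measurable2.
Qed.

Lemma test_function_sub Omega (A : set (R * R)) phi : A `<=` Omega ->
  test_function A phi -> test_function Omega phi.
Proof.
move=> AO [sphi [K [cK KA phi0]]]; split => //; exists K; split => //.
exact: subset_trans AO.
Qed.

Lemma restrict_supp (A Omega : set (R * R)) (f : R * R -> R) : A `<=` Omega -> (forall x, ~ A x -> f x = 0) ->
  \int[leb2]_(x in Omega) f x = \int[leb2]_(x in A) f x.
Proof.
move=> AO f0; rewrite RintegralT [RHS]RintegralT; apply: eq_Rintegral => x _.
rewrite !patchE; case: ifPn => [xO|xO]; case: ifPn => // xA.
  by rewrite f0// -notin_setE.
by case/negP: xO; apply/mem_set/AO/set_mem.
Qed.

(** A function supported in the smaller set is also a test function for the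
    larger one. *)
Lemma weak_derivative_sub Omega (A : set (R * R)) (b : bool) u g : A `<=` Omega ->
  weak_derivative Omega (if b then e1 else e2) u g ->
  weak_derivative A (if b then e1 else e2) u g.
Proof.
move=> AO W phi tphi; have := W phi (test_function_sub AO tphi).
have [sphi [K [cK KA phi0]]] := tphi.
have out s x : ~ A x -> iter_deriv s phi x = 0.
  by move=> nA; apply: (iter_deriv_out s (plane_compact_closed cK) phi0) => /KA.
rewrite (restrict_supp AO); last by move=> x /(out [:: b]) /= ->; rewrite mulr0.
by rewrite (restrict_supp AO) => // x /(out [::]) /= ->; rewrite mulr0.
Qed.

Lemma H1_sub Omega (A : set (R * R)) u g : @measurable _ (mplane R) Omega ->
  @measurable _ (mplane R) A -> A `<=` Omega -> H1 Omega u g -> H1 A u g.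
Proof.
move=> mO mA AO [Lu L1 L2' W1 W2]; split; try exact: L2_sub AO _.
  exact: (weak_derivative_sub (b := true) AO W1).
exact: (weak_derivative_sub (b := false) AO W2).
Qed.

End TestFunctions.

Section H1Space.
Context {R : realType}.
Variable Omega : set (R * R).
Hypothesis aO : admissible Omega.
Implicit Types (u v : R * R -> R).

Let mO : @measurable _ (mplane R) Omega := admissible_measurable aO.
Let fO : (leb2 (Omega : set (mplane R)) < +oo)%E := admissible_lty aO.

Lemma weak_derivativeE b u g : weak_derivative Omega (if b then e1 else e2) u g <->
  forall phi, test_function Omega phi ->
    ip Omega u (iter_deriv [:: b] phi) = - ip Omega g phi.
Proof. by []. Qed.

Lemma weak_derivative_lin b u g v h (c : R) : L2 Omega u -> L2 Omega g -> L2 Omega v -> L2 Omega h ->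
  weak_derivative Omega (if b then e1 else e2) u g ->
  weak_derivative Omega (if b then e1 else e2) v h ->
  weak_derivative Omega (if b then e1 else e2) (fun x => c * u x + v x) (fun x => c * g x + h x).
Proof.
move=> Lu Lg Lv Lh /weak_derivativeE Wu /weak_derivativeE Wv; apply/weak_derivativeE => phi tphi.
have L0 := test_function_L2 [::] mO fO tphi; have L1 := test_function_L2 [:: b] mO fO tphi.
have Lcu := L2Z c mO Lu; have Lcg := L2Z c mO Lg.
by rewrite !ipDl// !ipZl// Wu// Wv// mulrN opprD.
Qed.

(** The defining identity is continuous for the mean-square norm, since test
    functions and their derivatives are square-integrable. *)
Lemma weak_derivative_lim b (u g : nat -> R * R -> R) v h :
  (forall n, L2 Omega (u n)) -> (forall n, L2 Omega (g n)) -> L2 Omega v -> L2 Omega h ->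
  (forall n, weak_derivative Omega (if b then e1 else e2) (u n) (g n)) ->
  (forall e, 0 < e -> exists n, ip Omega (fun x => u n x - v x) (fun x => u n x - v x) <= e /\
     ip Omega (fun x => g n x - h x) (fun x => g n x - h x) <= e) ->
  weak_derivative Omega (if b then e1 else e2) v h.
Proof.
move=> Lu Lg Lv Lh W cvg; apply/weak_derivativeE => phi tphi.
have L0 := test_function_L2 [::] mO fO tphi; have L1 := test_function_L2 [:: b] mO fO tphi.
set D := iter_deriv [:: b] phi in L1 *.
pose M := ip Omega D D + ip Omega phi phi.
have M0 : 0 <= M by rewrite addr_ge0 ?ip_ge0.
apply/eqP; rewrite -subr_eq0 -sqrf_eq0 eq_le sqr_ge0 andbT opprK; apply/ler_addgt0Pl => e e0.
rewrite addr0.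
have [|n [Hu Hg]] := cvg (e / (2 * (M + 1))); first by rewrite divr_gt0// mulr_gt0// ltr_wpDl.
have LU := L2B mO (Lu n) Lv; have LG := L2B mO (Lg n) Lh.
have /weak_derivativeE/(_ _ tphi) Wn := W n.
have EB (f k p : R * R -> R) : L2 Omega f -> L2 Omega k -> L2 Omega p ->
    ip Omega (fun x => f x - k x) p = ip Omega f p - ip Omega k p.
  move=> Lf Lk Lp; have LN := L2Z (-1) mO Lk.
  rewrite (_ : (fun x => f x - k x) = fun x => f x + -1 * k x); last first.
    by apply/funext => x; rewrite mulN1r.
  by rewrite ipDl// ipZl// mulN1r.
have -> : ip Omega v D + ip Omega h phi = - (ip Omega (fun x => u n x - v x) D + ip Omega (fun x => g n x - h x) phi).
  by rewrite !EB// Wn; ring.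
have C1 := ip_CS mO LU L1; have C2 := ip_CS mO LG L0.
rewrite sqrrN.
set x := ip Omega _ D in C1 *; set y := ip Omega _ phi in C2 *.
have : (x + y) ^+ 2 <= 2 * (x ^+ 2 + y ^+ 2) by have := sqr_ge0 (x - y); lra.
move/le_trans; apply.
have h1 : x ^+ 2 <= e / (2 * (M + 1)) * ip Omega D D by rewrite (le_trans C1)// ler_wpM2r// ip_ge0.
have h2 : y ^+ 2 <= e / (2 * (M + 1)) * ip Omega phi phi by rewrite (le_trans C2)// ler_wpM2r// ip_ge0.
apply: (@le_trans _ _ (2 * (e / (2 * (M + 1)) * M))); first by rewrite /M; lra.
rewrite (_ : 2 * _ = e * (M / (M + 1))); last by field; rewrite gt_eqF// ltr_wpDl.
by rewrite ger_pMr// ler_pdivrMr ?mul1r ?lerDl// ltr_wpDl.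
Qed.

Lemma H1_lin u g v h (c : R) : H1 Omega u g -> H1 Omega v h ->
  H1 Omega (fun x => c * u x + v x) ((fun x => c * g.1 x + h.1 x), (fun x => c * g.2 x + h.2 x)).
Proof.
move=> [Lu L1 L2' W1 W2] [Lv M1 M2 V1 V2].
split => /=; do ?[by apply: L2D => //; exact: L2Z].
  exact: (weak_derivative_lin (b := true)).
exact: (weak_derivative_lin (b := false)).
Qed.

Lemma H1_0 : H1 Omega (fun=> 0) ((fun=> 0), (fun=> 0)).
Proof.
have L0 := L2_cst 0 mO fO.
have ip0 (f : R * R -> R) : \int[leb2]_(x in Omega) (0 * f x) = 0.
  transitivity (\int[leb2]_(x in Omega) (0 : R)).
    by apply: eq_Rintegral => x _; rewrite mul0r.
  by rewrite /Rintegral integral0.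
by split => // phi _; rewrite !ip0 oppr0.
Qed.

End H1Space.

(** $H^1(\Omega)$ as a vector space of pairs (function, weak gradient). The
    admissibility of the domain is part of the predicate, so that the space is
    a submodule whatever the set: it is reduced to zero if the set is not
    admissible. *)
Section H1Module.
Context {R : realType}.
Variable Omega : set (R * R).

Definition H1pairs : {pred ((R * R -> R) * ((R * R -> R) * (R * R -> R)))%type} :=
  fun p => `[< p = 0 \/ admissible Omega /\ H1 Omega p.1 p.2 >].

Lemma H1pairs_submod : submod_closed H1pairs.
Proof.
split; first by apply/asboolP; left.
move=> c p q /asboolP Hp /asboolP Hq; apply/asboolP.
have [aO|nO] := pselect (admissible Omega); last first.
  by case: Hp => [->|[//]]; case: Hq => [->|[//]]; left; rewrite scaler0 addr0.
right; split=> //.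
have H1p r : r = 0 \/ admissible Omega /\ H1 Omega r.1 r.2 -> H1 Omega r.1 r.2.
  by case=> [->|[//]]; exact: H1_0.
exact: (H1_lin aO c (H1p p Hp) (H1p q Hq)).
Qed.

HB.instance Definition _ := GRing.isSubmodClosed.Build R _ H1pairs H1pairs_submod.

Record H1space := H1Space { H1val : ((R * R -> R) * ((R * R -> R) * (R * R -> R)))%type;
  _ : H1val \in H1pairs }.

HB.instance Definition _ := [isSub for H1val].
HB.instance Definition _ := [Choice of H1space by <:].
HB.instance Definition _ := [SubChoice_isSubLmodule of H1space by <:].

End H1Module.

Section NeumannForms.
Context {R : realType}.
Variable Omega : set (R * R).
Hypothesis aO : admissible Omega.
Implicit Types (u v w : H1space Omega).

Let mO : @measurable _ (mplane R) Omega := admissible_measurable aO.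
Let fO : (leb2 (Omega : set (mplane R)) < +oo)%E := admissible_lty aO.

Definition H1fun u : R * R -> R := (H1val u).1.
Definition H1grad u : (R * R -> R) * (R * R -> R) := (H1val u).2.

Lemma H1P u : H1 Omega (H1fun u) (H1grad u).
Proof.
case: u => p Hp; have [E|[//]] := asboolP _ Hp.
rewrite /H1fun /H1grad /= E; exact: H1_0.
Qed.

Lemma H1fun_L2 u : L2 Omega (H1fun u). Proof. by case: (H1P u). Qed.
Lemma H1grad1_L2 u : L2 Omega (H1grad u).1. Proof. by case: (H1P u). Qed.
Lemma H1grad2_L2 u : L2 Omega (H1grad u).2. Proof. by case: (H1P u). Qed.
Hint Resolve H1fun_L2 H1grad1_L2 H1grad2_L2 : core.

Lemma H1valD u v : H1val (u + v) = H1val u + H1val v. Proof. exact: (raddfD val). Qed.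
Lemma H1valZ (c : R) u : H1val (c *: u) = c *: H1val u. Proof. exact: (linearZ_LR val). Qed.

Lemma H1_mk (f : R * R -> R) g : H1 Omega f g -> exists v : H1space Omega, H1val v = (f, g).
Proof.
move=> H1f; have Hp : (f, g) \in @H1pairs R Omega by apply/asboolP; right.
by exists (H1Space Hp).
Qed.

Definition mass u v : R := ip Omega (H1fun u) (H1fun v).
Definition energy u v : R :=
  ip Omega (H1grad u).1 (H1grad v).1 + ip Omega (H1grad u).2 (H1grad v).2.

Lemma mass_semi_inner : semi_inner mass.
Proof.
split=> [u v|u v w|c u v|u].
- exact: ipC.
- by rewrite /mass -ipDl// /H1fun H1valD.
- by rewrite /mass -ipZl// /H1fun H1valZ.
- exact: ip_ge0.
Qed.

Lemma energy_semi_inner : semi_inner energy.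
Proof.
split=> [u v|u v w|c u v|u].
- by rewrite /energy ipC [X in _ + X]ipC.
- by rewrite /energy addrACA -!ipDl// /H1grad H1valD.
- by rewrite /energy mulrDr -!ipZl// /H1grad H1valZ.
- by rewrite addr_ge0// ip_ge0.
Qed.

Lemma limit_L2 (v : nat -> R * R -> R) : (forall n, L2 Omega (v n)) ->
  (forall e : R, 0 < e -> exists N, forall m n, (N <= m)%N -> (N <= n)%N ->
     ip Omega (fun x => v m x - v n x) (fun x => v m x - v n x) <= e) ->
  exists w : R * R -> R, L2 Omega w /\
  forall e : R, 0 < e -> exists N, forall n, (N <= n)%N ->
     ip Omega (fun x => v n x - w x) (fun x => v n x - w x) <= e.
Proof.
move=> Lv cv.
have [||w mw Hw] := @L2_complete_measure _ (mplane R) R leb2 Omega mO v.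
- by move=> n; exact: L2_measurable.
- move=> e /cv[N HN]; exists N => m n Nm Nn.
  have /(ipE mO) E : L2 Omega (fun x => v m x - v n x) by exact: L2B.
  by move: (HN m n Nm Nn); rewrite -lee_fin -E.
have LB n : (\int[leb2]_(x in Omega) ((v n x - w x) ^+ 2)%:E < +oo)%E ->
    L2 Omega (fun x => v n x - w x).
  move=> H; split => //; apply: (@measurable_funB _ (mplane R)) => //; exact: L2_measurable.
have Lw : L2 Omega w.
  have [N HN] := Hw 1 ltr01; have /LB LN := le_lt_trans (HN N (leqnn N)) (ltry 1).
  have := L2B mO (Lv N) LN; rewrite (_ : (fun x => _ - (_ - _)) = w)//.
  by apply/funext => x; ring.
exists w; split => // e /Hw[N HN]; exists N => n Nn.
rewrite -lee_fin -ipE//; last exact: L2B.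
exact: HN.
Qed.

Lemma H1valB u v : H1val (u - v) = H1val u - H1val v. Proof. exact: (raddfB val). Qed.

Lemma H1funB u v : H1fun (u - v) = fun x => H1fun u x - H1fun v x.
Proof. by rewrite /H1fun H1valB. Qed.

Lemma H1grad1B u v : (H1grad (u - v)).1 = fun x => (H1grad u).1 x - (H1grad v).1 x.
Proof. by rewrite /H1grad H1valB. Qed.

Lemma H1grad2B u v : (H1grad (u - v)).2 = fun x => (H1grad u).2 x - (H1grad v).2 x.
Proof. by rewrite /H1grad H1valB. Qed.

(** The functions and both components of their gradients converge in the mean,
    and weak derivatives pass to the limit. *)
Lemma energy_graph_complete : graph_complete energy mass.
Proof.
move=> v cv.
have [||w0 [L0 C0]] := @limit_L2 (fun n => H1fun (v n)) => //.
  move=> e /cv[N HN]; exists N => m n Nm Nn; apply: le_trans (HN m n Nm Nn).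
  by rewrite -H1funB lerDr form_ge0//; exact: energy_semi_inner.
have [||w1 [L1 C1]] := @limit_L2 (fun n => (H1grad (v n)).1) => //.
  move=> e /cv[N HN]; exists N => m n Nm Nn; apply: le_trans (HN m n Nm Nn).
  by rewrite -H1grad1B /energy -addrA lerDl addr_ge0 ?ip_ge0.
have [||w2 [L2' C2]] := @limit_L2 (fun n => (H1grad (v n)).2) => //.
  move=> e /cv[N HN]; exists N => m n Nm Nn; apply: le_trans (HN m n Nm Nn).
  by rewrite -H1grad2B /energy addrAC -[leLHS]add0r lerD// addr_ge0 ?ip_ge0.
have H1w : H1 Omega w0 (w1, w2).
  split => //.
    apply: (@weak_derivative_lim R Omega aO true (fun n => H1fun (v n)) (fun n => (H1grad (v n)).1)) => //.
      by move=> n; case: (H1P (v n)).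
    move=> e e0; have [N HN] := C0 e e0; have [N' HN'] := C1 e e0.
    by exists (maxn N N'); rewrite HN ?HN' ?leq_maxl ?leq_maxr.
  apply: (@weak_derivative_lim R Omega aO false (fun n => H1fun (v n)) (fun n => (H1grad (v n)).2)) => //.
    by move=> n; case: (H1P (v n)).
  move=> e e0; have [N HN] := C0 e e0; have [N' HN'] := C2 e e0.
  by exists (maxn N N'); rewrite HN ?HN' ?leq_maxl ?leq_maxr.
have [w Ew] := H1_mk H1w; exists w => e e0.
have e3 : 0 < e / 3 by rewrite divr_gt0.
have [N0 H0] := C0 _ e3; have [N1 H1'] := C1 _ e3; have [N2 H2] := C2 _ e3.
exists (maxn N0 (maxn N1 N2)) => n; rewrite !geq_max => /and3P[n0 n1 n2].
rewrite /energy /mass H1funB H1grad1B H1grad2B /H1fun /H1grad Ew /=.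
by have := H0 n n0; have := H1' n n1; have := H2 n n2; rewrite /H1fun /H1grad; lra.
Qed.

End NeumannForms.

(** * Compactness of the embedding *)

Section Dissection.
Context {R : realType}.
Implicit Types (Omega c : set (R * R)) (f : R * R -> R).

(** Bounded open convex sets, the empty set included, so that a cut of such a
    set by a line has two parts of the same kind. *)
Definition convex_cell Omega := [/\ bounded_set Omega, open Omega & convex_set Omega].

Definition coordinate (b : bool) (x : R * R) : R := if b then x.1 else x.2.

Lemma coordinate_continuous b : continuous (coordinate b).
Proof. by case: b => x; [exact: cvg_fst|exact: cvg_snd]. Qed.

Lemma cell_measurable Omega : convex_cell Omega -> @measurable _ (mplane R) Omega.
Proof. by case=> _ oO _; exact: open_measurable2. Qed.

Lemma cell_lty Omega : convex_cell Omega -> (leb2 (Omega : set (mplane R)) < +oo)%E.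
Proof. by move=> cO; apply: bounded_leb2_lty; [case: cO|exact: cell_measurable]. Qed.

Lemma lt_convex_combination (t p q a : R) : 0 <= t <= 1 -> p < a -> q < a ->
  t * p + (1 - t) * q < a.
Proof. by move=> /andP[t0 t1] pa qa; have [h|h] := leP t 2^-1; nra. Qed.

Lemma cell_cut b (s : bool) (a : R) Omega : convex_cell Omega ->
  convex_cell (Omega `&` [set x | if s then coordinate b x < a else a < coordinate b x]).
Proof.
move=> [bO oO /convex_setE cO]; split.
- by case: bO => M [Mr HM]; exists M; split => // r /HM H x [] /H.
- apply: openI => //; case: s.
    rewrite (_ : [set x | _] = coordinate b @^-1` [set y | y < a]) //.
    by apply: open_comp; [move=> x _; exact: coordinate_continuous|exact: open_lt].
  rewrite (_ : [set x | _] = coordinate b @^-1` [set y | a < y]) //.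
  by apply: open_comp; [move=> x _; exact: coordinate_continuous|exact: open_gt].
- apply/convex_setE => x y t [Ox hx] [Oy hy] t01; split; first exact: cO.
  have hc := @lt_convex_combination t _ _ _ t01.
  have /= E : coordinate b (t * x.1 + (1 - t) * y.1, t * x.2 + (1 - t) * y.2) =
    t * coordinate b x + (1 - t) * coordinate b y by case: (b).
  case: s hx hy => /= hx hy; rewrite E; first exact: hc.
  by rewrite -ltrN2 opprD -!mulrN; apply: hc; rewrite ltrN2.
Qed.

Lemma line_null b (a : R) : leb2 ([set x | coordinate b x = a] : set (mplane R)) = 0%E.
Proof.
have ma : @measurable _ (mline R) [set a] by exact: measurable_set1.
have l0 : leb ([set a] : set (mline R)) = 0%E by exact: lebesgue_measure_set1.
case: b => /=.
  rewrite (_ : [set x | _] = ([set a] : set (mline R)) `*` setT); last first.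
    by apply/seteqP; split => x //= [].
  transitivity (0%E * leb [set: mline R])%E; last by rewrite mul0e.
  by rewrite -l0; exact: product_measure1E.
rewrite (_ : [set x | _] = setT `*` ([set a] : set (mline R))); last first.
  by apply/seteqP; split => x //= [].
transitivity (leb [set: mline R] * 0%E)%E; last by rewrite mule0.
by rewrite -l0; exact: product_measure1E.
Qed.

Lemma line_measurable b (a : R) : @measurable _ (mplane R) [set x | coordinate b x = a].
Proof.
have ma : @measurable _ (mline R) [set a] by exact: measurable_set1.
case: b => /=.
  rewrite (_ : [set x | _] = ([set a] : set (mline R)) `*` setT); first exact: measurableX.
  by apply/seteqP; split => x //= [].
rewrite (_ : [set x | _] = setT `*` ([set a] : set (mline R))); first exact: measurableX.
by apply/seteqP; split => x //= [].
Qed.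

Lemma integral_cut b (a : R) Omega f : convex_cell Omega -> leb2.-integrable Omega (EFin \o f) ->
  \int[leb2]_(x in Omega) f x =
  \int[leb2]_(x in Omega `&` [set x | coordinate b x < a]) f x +
  \int[leb2]_(x in Omega `&` [set x | a < coordinate b x]) f x.
Proof.
move=> cO fi; have mO := cell_measurable cO.
have m1 := cell_measurable (cell_cut b true a cO).
have m2 := cell_measurable (cell_cut b false a cO).
have E : Omega `\` [set x | coordinate b x = a] =
   (Omega `&` [set x | coordinate b x < a]) `|` (Omega `&` [set x | a < coordinate b x]).
  apply/seteqP; split => [x [Ox /= /eqP]|x [[Ox /= h]|[Ox /= h]]].
  - by rewrite neq_lt => /orP[]; [left|right].
  - by split => //= ha; move: h; rewrite ha ltxx.
  - by split => //= ha; move: h; rewrite ha ltxx.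
rewrite -Rintegral_setU//.
- rewrite /Rintegral (negligible_integral (line_measurable b a) mO fi (line_null b a)).
  by rewrite E.
- by apply: (integrableS mO _ _ fi); [exact: measurableU|move=> x [[]|[]]].
- apply/disj_setPS => x [[_ /= h1] [_ /= h2]].
  by have := lt_trans h1 h2; rewrite ltxx.
Qed.

Record dissection Omega (cells : seq (set (R * R))) : Prop := Dissection {
  dissection_cell : forall c, List.In c cells -> convex_cell c /\ c `<=` Omega ;
  dissection_integral : forall f, leb2.-integrable Omega (EFin \o f) ->
    \int[leb2]_(x in Omega) f x = \sum_(c <- cells) \int[leb2]_(x in c) f x }.

Lemma dissection_flatten Omega cells (P : set (R * R) -> Prop) : convex_cell Omega ->
  dissection Omega cells ->
  (forall c, List.In c cells -> exists2 cs, dissection c cs & forall c', List.In c' cs -> P c') ->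
  exists2 cs, dissection Omega cs & forall c, List.In c cs -> P c.
Proof.
move=> cO [Hc Hi] Hs.
have [cs Hcs HP] : exists2 cs, (forall c, List.In c cs -> convex_cell c /\ c `<=` Omega) /\
    (forall f, leb2.-integrable Omega (EFin \o f) ->
      \sum_(c <- cells) \int[leb2]_(x in c) f x = \sum_(c <- cs) \int[leb2]_(x in c) f x) &
    forall c, List.In c cs -> P c.
  move: Hc Hs {Hi}; elim: cells => [|c cells IH] Hc Hs.
    by exists [::] => //; split => // f _; rewrite !big_nil.
  have [cs [cs1 cs2] csP] := IH (fun c' h => Hc c' (or_intror h)) (fun c' h => Hs c' (or_intror h)).
  have [ds [ds1 ds2] dsP] := Hs c (or_introl erefl).
  have [cc cO'] := Hc c (or_introl erefl).
  exists (ds ++ cs).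
    split=> [c' /(@List.in_app_or _ _ _ _)[/ds1[h1 h2]|/cs1//]|f fi].
      by split => //; exact: subset_trans cO'.
    rewrite big_cons big_cat /= cs2// ds2//.
    exact: (integrableS (cell_measurable cO) (cell_measurable cc) cO' fi).
  by move=> c' /(@List.in_app_or _ _ _ _)[/dsP|/csP].
exists cs => //; split; first by case: Hcs.
by move=> f fi; rewrite Hi//; case: Hcs => _ ->.
Qed.

(** Lines at distance [h] cut a bounded set into finitely many slabs. *)
Lemma slab_dissection b (p h : R) n Omega : 0 < h -> convex_cell Omega ->
  (forall x, Omega x -> p < coordinate b x < p + n.+1%:R * h) ->
  exists2 cs, dissection Omega cs & forall c, List.In c cs -> c `<=` Omega /\
    forall x y, c x -> c y -> `|coordinate b x - coordinate b y| <= h.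
Proof.
move=> h0; elim: n Omega => [|n IH] Omega cO Hp.
  exists [:: Omega]; first split.
  - by move=> c [<-|[]]; split.
  - by move=> f _; rewrite big_seq1.
  - move=> c [<-|[]]; split => // x y /Hp hx /Hp hy.
    by rewrite ler_norml; move: hx hy; rewrite mul1r; lra.
set a := p + n.+1%:R * h.
have [cs [cs1 cs2] csP] := IH _ (cell_cut b true a cO) (fun x '(conj Ox hx) =>
   introT andP (conj (proj1 (andP (Hp x Ox))) hx)).
exists ((Omega `&` [set x | a < coordinate b x]) :: cs).
  split=> [c [<-|/cs1[h1 h2]]|f fi].
  - by split; [exact: (cell_cut b false a cO)|move=> x []].
  - by split => // x /h2[].
  - rewrite (integral_cut b a cO fi) big_cons addrC cs2//.
    by apply: (integrableS (cell_measurable cO) _ _ fi); [exact: cell_measurable (cell_cut b true a cO)|move=> x []].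
move=> c [<-|/csP[h1 h2]]; last by split => // x /h1[].
split=> [x []//|x y [/Hp hx /= ax] [/Hp hy /= ay]].
have e : p + n.+2%:R * h = a + h by rewrite /a -[n.+2]addn1 natrD; ring.
by rewrite ler_norml; move: hx hy; rewrite e; lra.
Qed.

Lemma cell_coordinate_bounded b Omega (h : R) : 0 < h -> convex_cell Omega ->
  exists p n, forall x, Omega x -> p < coordinate b x < p + n.+1%:R * h.
Proof.
move=> h0 [[M [Mr bM]] _ _].
pose N := Num.max 0 M + 1.
exists (- (N + 1)), (Num.truncn ((N + 1 + (N + 1)) / h)) => x Ox.
have : `|x| <= N.
  by apply: (bM N) => //; rewrite /N ltr_pwDr// le_max lexx orbT.
rewrite {1}/Num.norm /= /mx_norm ge_max => /andP[h1 h2].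
have : `|coordinate b x| <= N by case: b.
rewrite ler_norml => /andP[h3 h4].
have := truncnS_gt ((N + 1 + (N + 1)) / h); rewrite ltr_pdivrMr// => h5.
by apply/andP; split; lra.
Qed.

(** Cutting into slabs in one direction and each slab in the other one. *)
Lemma small_dissection Omega (h : R) : 0 < h -> convex_cell Omega ->
  exists2 cs, dissection Omega cs & forall c, List.In c cs ->
    forall x y, c x -> c y -> (x.1 - y.1) ^+ 2 + (x.2 - y.2) ^+ 2 <= 2 * h ^+ 2.
Proof.
move=> h0 cO; have [p [n Hp]] := cell_coordinate_bounded true h0 cO.
have [cs dcs csP] := slab_dissection h0 cO Hp.
apply: (dissection_flatten cO dcs) => c cin.
have [cc _] := dissection_cell dcs cin.
have [q [m Hq]] := cell_coordinate_bounded false h0 cc.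
have [ds dds dsP] := slab_dissection h0 cc Hq; exists ds => // c' /dsP[c'c Hc'] x y cx cy.
have sq (t : R) : `|t| <= h -> t ^+ 2 <= h ^+ 2.
  by move=> th; rewrite -[leLHS]real_normK ?num_real// ler_pXn2r ?nnegrE// ltW.
have [_ H1] := csP c cin; have := sq _ (H1 x y (c'c x cx) (c'c y cy)).
by have := sq _ (Hc' x y cx cy); rewrite /=; lra.
Qed.

End Dissection.

Section Compactness.
Context {R : realType}.
Variable Omega : set (R * R).
Hypothesis aO : admissible Omega.

Let mO : @measurable _ (mplane R) Omega := admissible_measurable aO.
Let cO : convex_cell Omega. Proof. by case: aO. Qed.

Lemma energyE (u : H1space Omega) : energy u u = \int[leb2]_(x in Omega) gradsq (H1grad u) x.
Proof.
transitivity (\int[leb2]_(x in Omega)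
  ((H1grad u).1 x * (H1grad u).1 x + (H1grad u).2 x * (H1grad u).2 x)); last first.
  by apply: eq_Rintegral => x _; rewrite /gradsq !expr2.
have L1 := H1grad1_L2 aO u; have L2' := H1grad2_L2 aO u.
by rewrite RintegralD//; [exact: L2_integrableM|exact: L2_integrableM].
Qed.

Lemma H1fun_integrable (c : set (R * R)) (u : H1space Omega) : @measurable _ (mplane R) c -> c `<=` Omega ->
  leb2.-integrable c (EFin \o H1fun u).
Proof.
move=> mc cO'; apply: (integrableS mO mc cO'); apply: L2_integrable => //; first exact: admissible_lty.
exact: H1fun_L2.
Qed.

Lemma cell_mean_bounded (c : set (R * R)) (k : R) : convex_cell c -> c `<=` Omega ->
  bounded_functional (@mass R Omega) (fun u : H1space Omega => k * \int[leb2]_(x in c) H1fun u x).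
Proof.
move=> cc cO'; have mc := cell_measurable cc; split.
  move=> u v; rewrite -mulrBr -RintegralB//; [exact: H1fun_integrable|exact: H1fun_integrable].
have L1 := L2_cst 1 mc (cell_lty cc).
exists (k ^+ 2 * ip c (fun=> 1) (fun=> 1)) => u.
have Lu : L2 c (H1fun u) by exact: L2_sub (H1fun_L2 aO u).
have E : \int[leb2]_(x in c) H1fun u x = ip c (fun=> 1) (H1fun u).
  by apply: eq_Rintegral => x _; rewrite mul1r.
rewrite exprMn -mulrA ler_wpM2l ?sqr_ge0// E (le_trans (ip_CS mc L1 Lu))//.
rewrite ler_wpM2l ?ip_ge0// -lee_fin -(ipE mc Lu) -(ipE mO (H1fun_L2 aO u)).
apply: ge0_subset_integral => //.
- by apply/measurable_EFinP; apply: measurable_funX; exact: L2_measurable (H1fun_L2 aO u).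
- by move=> x _; rewrite lee_fin sqr_ge0.
Qed.

(** The normalisation of the mean makes its square the term [(int u)^2 / |c|] of
    the Poincaré inequality. For a cell without area both sides are trivial. *)
Lemma cell_poincare (c : set (R * R)) (K : R) (u : H1space Omega) : convex_cell c -> c `<=` Omega ->
  (forall x y, c x -> c y -> (x.1 - y.1) ^+ 2 + (x.2 - y.2) ^+ 2 <= K) ->
  \int[leb2]_(x in c) (H1fun u x ^+ 2) <=
    4 * K * (\int[leb2]_(x in c) gradsq (H1grad u) x) +
    ((Num.sqrt (fine (leb2 (c : set (mplane R)))))^-1 * \int[leb2]_(x in c) H1fun u x) ^+ 2.
Proof.
move=> cc cO' cK; have mc := cell_measurable cc.
have [c0|/set0P/negP/negPn/eqP ->] := pselect (c !=set0); last first.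
  by rewrite !Rintegral_set0 !mulr0 add0r expr0n.
have ac : admissible c by case: cc.
have H1c : H1 c (H1fun u) (H1grad u) by apply: H1_sub (H1P aO u).
set m := fine _.
have m0 : 0 <= m by rewrite fine_ge0.
have g0 : 0 <= \int[leb2]_(x in c) gradsq (H1grad u) x.
  by apply: Rintegral_ge0 => x _; rewrite addr_ge0// sqr_ge0.
have [x0 cx0] := c0.
have K0 : 0 <= K by have := cK _ _ cx0 cx0; rewrite !subrr expr0n addr0.
move: m0; rewrite le_eqVlt => /orP[/eqP m0|m0].
  have -> : \int[leb2]_(x in c) H1fun u x ^+ 2 = 0.
    rewrite /Rintegral null_set_integral//.
      by apply/measurable_EFinP; apply: measurable_funX; case: H1c => -[].
    have /fineK E : leb2 (c : set (mplane R)) \is a fin_num.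
      by rewrite ge0_fin_numE ?measure_ge0//; exact: cell_lty.
    by transitivity (m%:E); [exact: esym E|rewrite -m0].
  by rewrite addr_ge0// ?sqr_ge0// !mulr_ge0.
have := poincare ac H1c cK; rewrite -/m => H.
rewrite -(ler_pM2l m0); apply: (le_trans H).
rewrite exprMn exprVn (sqr_sqrtr (ltW m0)).
set I := \int[_]_(_ in _) _; set G := \int[_]_(_ in _) _.
rewrite (_ : m * _ = I ^+ 2 + 4 * K * m * G); first exact: lexx.
by field; rewrite gt_eqF.
Qed.

(** On small cells the Poincaré inequality has a small constant, so that the mass
    is controlled by the energy up to the means over finitely many cells. *)
Lemma energy_compact : form_compact (@energy R Omega) (@mass R Omega).
Proof.
move=> eta eta0; pose h := Num.min 1 (eta / 8).
have h0 : 0 < h by rewrite lt_min ltr01 divr_gt0.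
have [cs dcs csK] := small_dissection h0 cO.
exists [seq (fun u : H1space Omega => (Num.sqrt (fine (leb2 (c : set (mplane R)))))^-1 * \int[leb2]_(x in c) H1fun u x) | c <- cs].
split.
  move=> l /List.in_map_iff[c [<- cin]]; have [cc ccO] := dissection_cell dcs cin.
  exact: cell_mean_bounded.
move=> u; rewrite big_map /= energyE.
have Emass : mass u u = \int[leb2]_(x in Omega) (H1fun u x ^+ 2) by [].
have h8 : 4 * (2 * h ^+ 2) <= eta.
  have h1 : h <= 1 by rewrite ge_min lexx.
  have h2 : h <= eta / 8 by rewrite ge_min lexx orbT.
  nra.
have i1 := L2_integrable_sqr (H1fun_L2 aO u).
have i2 : leb2.-integrable Omega (EFin \o gradsq (H1grad u)).
  exact: (integrableD mO (L2_integrable_sqr (H1grad1_L2 aO u)) (L2_integrable_sqr (H1grad2_L2 aO u))).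
rewrite Emass (dissection_integral dcs i1) (dissection_integral dcs i2) mulr_sumr -big_split /=.
have [Hc _] := dcs; elim: cs Hc csK {dcs} => [|c cs IH] Hc csK; first by rewrite !big_nil.
rewrite !big_cons; apply: lerD; last first.
  by apply: IH; [move=> c' ?; apply: Hc; right|move=> c' ?; apply: csK; right].
have [cc ccO] := Hc c (or_introl erefl).
apply: (le_trans (cell_poincare u cc ccO (csK c (or_introl erefl)))).
by rewrite lerD2r ler_wpM2r//; apply: Rintegral_ge0 => x _; rewrite addr_ge0// sqr_ge0.
Qed.

End Compactness.

(** * The min-max principle *)

Section MinMax.
Context {R : realType}.
Variable Omega : set (R * R).
Hypothesis aO : admissible Omega.
Implicit Types (u v w : H1space Omega).

Let mO : @measurable _ (mplane R) Omega := admissible_measurable aO.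
Local Notation mass := (@mass R Omega).
Local Notation energy := (@energy R Omega).
Let hb : semi_inner mass := mass_semi_inner aO.
Let ha : semi_inner energy := energy_semi_inner aO.

Lemma mass0_ae u : mass u u = 0 <-> \forall x \ae leb2, Omega x -> H1fun u x = 0.
Proof.
have Lu := H1fun_L2 aO u.
have mf2 : @measurable_fun _ _ (mplane R) _ Omega (fun x => (H1fun u x ^+ 2)%:E).
  by apply/measurable_EFinP; apply: measurable_funX; exact: L2_measurable.
have E : (\int[leb2]_(x in Omega) `|(H1fun u x ^+ 2)%:E| = (mass u u)%:E)%E.
  rewrite -(ipE mO Lu); apply: eq_integral => x _.
  by rewrite /= ger0_norm ?sqr_ge0.
split => H.
  rewrite H in E; have [N [mN N0 sub]] := (ae_eq_integral_abs leb2 mO mf2).1 E.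
  exists N; split => // x /= nx; apply: sub => /= H'; apply: nx => Ox.
  by have /eqP := H' Ox; rewrite eqe sqrf_eq0 => /eqP.
apply: EFin_inj; rewrite -E; apply/(ae_eq_integral_abs leb2 mO mf2).
have [N [mN N0 sub]] := H; exists N; split => // x /= nx; apply: sub => /= H'; apply: nx => Ox.
by rewrite H'// expr0n.
Qed.

Lemma H1fun_sum n (c : 'I_n -> R) (W : 'I_n -> H1space Omega) x :
  H1fun (\sum_i c i *: W i) x = \sum_i c i * H1fun (W i) x.
Proof.
elim/big_rec2 : _ => [|i y1 y2 _ IH].
  by rewrite /H1fun (_ : H1val 0 = 0)//; exact: (raddf0 val).
by rewrite -IH /H1fun H1valD H1valZ.
Qed.

Lemma independentE n (W : 'I_n -> H1space Omega) :
  independent Omega (fun i => H1fun (W i)) <-> form_free mass W.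
Proof.
have Hc (c : 'I_n -> R) : (\forall x \ae leb2, Omega x -> \sum_(i < n) c i * H1fun (W i) x = 0) <->
    mass (\sum_i c i *: W i) (\sum_i c i *: W i) = 0.
  rewrite mass0_ae; split => -[N [mN N0 sub]]; exists N; split => // x /= nx; apply: sub => /= H;
    by apply: nx => /H; rewrite H1fun_sum.
by split => H c /Hc; exact: H.
Qed.

Lemma eigenvectorE l u : eigenvector energy mass l u -> neumann_eigenspace Omega l (H1fun u).
Proof.
move=> eu; exists (H1grad u); first exact: H1P.
move=> phi h H1phi; have [v Ev] := H1_mk aO H1phi.
have := eu v; rewrite /energy /mass /H1grad /H1fun Ev /= => <-.
rewrite /ip -RintegralD//; [apply: L2_integrableM|apply: L2_integrableM] => //.
- exact: H1grad1_L2.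
- by case: H1phi.
- exact: H1grad2_L2.
- by case: H1phi.
Qed.

Lemma eigenspace_eigenvector l f : neumann_eigenspace Omega l f ->
  exists2 u, H1fun u = f & eigenvector energy mass l u.
Proof.
move=> [g H1f ef]; have [u Eu] := H1_mk aO H1f; exists u; first by rewrite /H1fun Eu.
move=> v; have := ef _ _ (H1P aO v); rewrite /mass /H1fun Eu /= => <-.
rewrite /energy /ip /H1grad Eu /=; case: H1f => _ L1 L2' _ _.
rewrite -RintegralD//; [apply: L2_integrableM|apply: L2_integrableM] => //.
- exact: H1grad1_L2.
- exact: H1grad2_L2.
Qed.

(** The eigenvectors of one value [l] are indexed by the positions of [l] in the
    list. *)
Lemma eigensystem_eigenvalue_list n lam (u : nat -> H1space Omega) :
  eigensystem energy mass n lam u -> eigenvalue_list Omega [seq lam i | i <- iota 0 n].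
Proof.
move=> [uo ue _] l.
pose I := [seq i <- iota 0 n | lam i == l].
have sI : count_mem l [seq lam i | i <- iota 0 n] = size I.
  by rewrite count_map size_filter.
have In i : (i < size I)%N -> (nth 0 I i < n)%N /\ lam (nth 0 I i) = l.
  move=> /(mem_nth 0); rewrite mem_filter mem_iota /= add0n => /andP[/eqP h1 h2].
  by split.
rewrite sI; exists (fun i : 'I_(size I) => H1fun (u (nth 0%N I i))).
  move=> i; have [h1 h2] := In i (ltn_ord i).
  by rewrite -[X in neumann_eigenspace _ X]h2; apply: eigenvectorE; exact: ue.
apply/independentE => c; set v := \sum_i _ => v0 i.
have -> : c i = mass (u (nth 0%N I i)) v.
  rewrite (form_sumZr hb) (bigD1 i)//= uo ?(In _ (ltn_ord _)).1// eqxx mulr1 big1 ?addr0// => j ji.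
  rewrite uo ?(In _ (ltn_ord _)).1// nth_uniq ?filter_uniq ?iota_uniq//.
  by rewrite eq_sym [_ == _](_ : _ = false) ?mulr0//; exact/negbTE.
have := form_CS hb (u (nth 0%N I i)) v; rewrite v0 mulr0 => h.
by apply/eqP; rewrite -sqrf_eq0 eq_le h sqr_ge0.
Qed.

(** The element of the list at position [i] is given an eigenfunction, the one
    whose rank is the number of earlier occurrences of the same value. Functions
    of different eigenvalues are orthogonal for both forms, so that linear
    independence can be checked within one eigenspace, and on the span
    [t * mass - energy] is the mass of the combination whose coefficients are
    multiplied by [sqrt (t - s_i)]. *)
Lemma eigenvalue_list_test k (s : seq R) (t : R) : size s = k -> eigenvalue_list Omega s ->
  all (fun l => l <= t) s -> exists W : 'I_k -> H1space Omega, form_free mass W /\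
  forall c : 'I_k -> R, energy (\sum_j c j *: W j) (\sum_j c j *: W j) <=
     t * mass (\sum_j c j *: W j) (\sum_j c j *: W j).
Proof.
move=> sk es /allP st.
have /choice[U HU] : forall l, exists U : nat -> H1space Omega,
    (forall j, (j < count_mem l s)%N -> eigenvector energy mass l (U j)) /\
    form_free mass (fun j : 'I_(count_mem l s) => U j).
  move=> l; have [f fe fi] := es l.
  have /choice[W HW] : forall i, exists u, H1fun u = f i /\ eigenvector energy mass l u.
    by move=> i; have [u] := eigenspace_eigenvector (fe i); exists u.
  exists (fun j => if insub j is Some i then W i else 0); split.
    by move=> j jl; rewrite insubT; exact: (HW _).2.
  rewrite (_ : (fun _ => _) = W); last by apply/funext => j; rewrite valK.
  apply/independentE; rewrite (_ : (fun _ => _) = f)//.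
  by apply/funext => j; exact: (HW _).1.
pose rank i := count_mem s`_i (take i s).
have rank_lt i : (i < k)%N -> (rank i < count_mem (nth 0%R s i) s)%N.
  move=> ik; rewrite -[X in count_mem _ X](cat_take_drop i) count_cat (drop_nth 0) ?sk//=.
  by rewrite eqxx addnS ltnS leq_addr.
have rank_mono i j : (i < j)%N -> (j < k)%N -> s`_i = s`_j -> (rank i < rank j)%N.
  move=> ij jk sij; rewrite /rank -sij.
  have ik : (i < size (take j s))%N by rewrite size_takel// sk ltnW.
  rewrite -[X in (_ < count_mem _ X)%N](cat_take_drop i) count_cat take_takel ?(ltnW ij)//.
  by rewrite (drop_nth 0)//= nth_take// eqxx addnS ltnS leq_addr.
pose W (i : 'I_k) := U s`_i (rank i).
have We (i : 'I_k) : eigenvector energy mass s`_i (W i) by exact: (HU _).1 _ (rank_lt _ (ltn_ord i)).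
have Wo (i j : 'I_k) : s`_i <> s`_j -> mass (W i) (W j) = 0.
  move=> nij; have := We i (W j); rewrite (formC ha) We (formC hb) => E.
  have /eqP : (s`_j - s`_i) * mass (W i) (W j) = 0 by rewrite mulrBl E subrr.
  by rewrite mulf_eq0 subr_eq0 => /orP[/eqP h|/eqP//]; case: nij.
have sum2 (q : H1space Omega -> H1space Omega -> R) (hq : semi_inner q) (c d : 'I_k -> R) :
    q (\sum_i c i *: W i) (\sum_i d i *: W i) = \sum_i \sum_j c i * (d j * q (W i) (W j)).
  rewrite (form_suml hq); apply: eq_bigr => i _.
  by rewrite (formZl hq) (form_sumZr hq) mulr_sumr.
exists W; split.
  move=> c v0 i0; set l := s`_i0.
  pose d (j : 'I_(count_mem l s)) := \sum_(i < k | (s`_i == l) && (rank i == j)) c i.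
  have dE : \sum_j d j *: U l j = \sum_(i < k | s`_i == l) c i *: W i.
    under eq_bigr do rewrite scaler_suml.
    rewrite (exchange_big_dep (fun i : 'I_k => s`_i == l))/=; last by move=> ? ? _ /andP[].
    apply: eq_bigr => i /eqP si.
    have ri : (rank i < count_mem l s)%N by rewrite -si rank_lt.
    rewrite (big_pred1 (Ordinal ri)); first by rewrite /W si.
    by move=> j; rewrite /= si eqxx /= eq_sym.
  have vl0 : mass (\sum_j d j *: U l j) (\sum_j d j *: U l j) = 0.
    pose e (i : 'I_k) := if s`_i == l then c i else 0.
    have eE : \sum_j d j *: U l j = \sum_i e i *: W i.
      rewrite dE big_mkcond; apply: eq_bigr => i _; rewrite /e.
      by case: ifP => // _; rewrite scale0r.
    have E2 : mass (\sum_i e i *: W i) (\sum_i e i *: W i) =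
              mass (\sum_i e i *: W i) (\sum_i c i *: W i).
      rewrite !sum2//; apply: eq_bigr => i _; apply: eq_bigr => j _; rewrite /e.
      have [si|_] := eqVneq s`_i l; last by rewrite !mul0r.
      have [//|/eqP sj] := eqVneq s`_j l.
      by rewrite Wo ?mulr0// si => /esym.
    rewrite eE E2; have := form_CS hb (\sum_i e i *: W i) (\sum_i c i *: W i).
    rewrite v0 mulr0 => h; apply/eqP.
    by rewrite -sqrf_eq0 eq_le h sqr_ge0.
  have r0 : (rank i0 < count_mem l s)%N by exact: rank_lt.
  have := (HU l).2 d vl0 (Ordinal r0); rewrite /d (big_pred1 i0)//= => i.
  apply/andP/eqP => [[/eqP si /eqP ri]|->]; last by [].
  apply/val_inj/eqP => /=; have [ii|ii|//] := ltngtP i i0.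
    by have := rank_mono _ _ ii (ltn_ord i0) si; rewrite ri ltnn.
  by have := rank_mono _ _ ii (ltn_ord i) (esym si); rewrite ri ltnn.
move=> c; rewrite -subr_ge0.
pose r (i : 'I_k) : R := Num.sqrt (t - s`_i).
have sr (i : 'I_k) : r i ^+ 2 = t - s`_i by rewrite sqr_sqrtr// subr_ge0 st// mem_nth// sk.
have -> : t * mass (\sum_j c j *: W j) (\sum_j c j *: W j) -
    energy (\sum_j c j *: W j) (\sum_j c j *: W j) =
    mass (\sum_j (r j * c j) *: W j) (\sum_j (r j * c j) *: W j).
  rewrite !sum2// mulr_sumr -sumrB; apply: eq_bigr => i _.
  rewrite mulr_sumr -sumrB; apply: eq_bigr => j _; rewrite We.
  have [sij|/eqP sij] := eqVneq s`_i s`_j.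
    transitivity (c i * (c j * mass (W i) (W j)) * (t - s`_i)); first by ring.
    by rewrite -sr /r -sij; ring.
  by rewrite Wo// !mulr0 subrr.
exact: form_ge0.
Qed.

Lemma eigensystem_le_mu k lam (u : nat -> H1space Omega) : eigensystem energy mass k.+1 lam u ->
  ((lam k)%:E <= neumann_mu Omega k)%E.
Proof.
move=> es; apply: le_ereal_inf_tmp => _ [t [s [sk el st]] <-]; rewrite lee_fin.
have [W [fW Wt]] := eigenvalue_list_test sk el st.
exact: (eigensystem_le_test hb es fW Wt).
Qed.

End MinMax.

(** * Polynomials in the Sobolev space *)

Section VanishingIntegral.
Context {R : realType}.

Lemma supp_FTC (F F' : R -> R) (N : R) : 0 < N ->
  (forall t, is_derive t (1 : R) F (F' t)) -> continuous F' ->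
  (forall t, N <= `|t| -> F t = 0) -> (forall t, N <= `|t| -> F' t = 0) ->
  (\int[leb]_t (F' t)%:E = 0)%E.
Proof.
move=> N0 dF cF' F0 F'0.
have cF : continuous F.
  by move=> t; apply: differentiable_continuous; apply/derivable1_diffP; case: (dF t).
transitivity (\int[leb]_(t in `[(- N)%R, N]) (F' t)%:E)%E.
  rewrite [RHS]integral_mkcond; apply: eq_integral => t _.
  rewrite patchE; case: ifPn => // tN; rewrite F'0//.
  rewrite leNgt; apply/negP; rewrite ltr_norml => /andP[h1 h2].
  by case/negP: tN; apply/mem_set; rewrite /= in_itv/= !ltW.
rewrite (@continuous_FTC2 _ _ F).
- by rewrite !F0 ?subee// ?normrN ler_norm.
- by lra.
- exact: continuous_subspaceT.
- split; first by move=> t _; case: (dF t).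
    by apply: cvg_at_right_filter; exact: cF.
  by apply: cvg_at_left_filter; exact: cF.
- by move=> t _; rewrite derive1E; case: (dF t).
Qed.

Lemma compact_support_integrable (d : R * R -> R) (K : set (R * R)) : continuous d ->
  compact K -> (forall x, ~ K x -> d x = 0) -> leb2.-integrable setT (EFin \o d).
Proof.
move=> cd cK d0.
have [M HM] := continuous_compact_bounded cd cK d0.
have mK : @measurable _ (mplane R) K.
  have := open_measurable2 (closed_openC (plane_compact_closed cK)).
  by move=> /measurableC; rewrite setCK.
have fK : (leb2 (K : set (mplane R)) < +oo)%E.
  by apply: bounded_leb2_lty => //; exact: compact_bounded.
have LK : L2 K d.
  by apply: (L2_bounded (M := M)) => //; apply: (@measurable_funS _ _ (mplane R) _ setT) => //;
    exact: continuous_measurable2.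
have := L2_integrableT mK fK LK; rewrite (_ : d \_ K = d)//.
apply/funext => x; rewrite patchE; case: ifPn => // xK.
by rewrite d0// -notin_setE.
Qed.

Definition line_through (b : bool) (s t : R) : R * R := if b then (t, s) else (s, t).

Lemma line_through_continuous b (s : R) : continuous (line_through b s).
Proof.
by case: b => t; [exact: (cvg_pair cvg_id (cvg_cst s))|exact: (cvg_pair (cvg_cst s) cvg_id)].
Qed.

Lemma smooth_derivable b (phi : R * R -> R) x : smooth phi ->
  derivable phi x (if b then @e1 R else @e2 R).
Proof. by move=> /(_ [::])[_ /(_ x)[d1 d2]]; case: b; [exact: d1|exact: d2]. Qed.

Lemma fubini_vanishing b (d : R * R -> R) : leb2.-integrable setT (EFin \o d) ->
  (forall s, \int[leb]_t (d (line_through b s t))%:E = 0)%E ->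
  \int[leb2]_x d x = 0.
Proof.
move=> di d0; rewrite /Rintegral.
suff -> : (\int[leb2]_x (d x)%:E = 0)%E by [].
case: b d0 => d0.
  rewrite -[LHS](integral21_prod_meas1 di).
  by apply: integral0_eq => s _; exact: d0.
rewrite -[LHS](integral12_prod_meas1 di).
by apply: integral0_eq => s _; exact: d0.
Qed.

Lemma line_derive b (phi : R * R -> R) (s t : R) :
  derivable phi (line_through b s t) (if b then @e1 R else @e2 R) ->
  is_derive t (1 : R) (fun t => phi (line_through b s t))
    ('D_(if b then @e1 R else @e2 R) phi (line_through b s t)).
Proof.
move=> dphi.
have E : (fun h : R => h^-1 *: (((fun t => phi (line_through b s t)) \o shift t) (h *: (1 : R)) - phi (line_through b s t))) =
  (fun h : R => h^-1 *: ((phi \o shift (line_through b s t)) (h *: (if b then @e1 R else @e2 R)) - phi (line_through b s t))).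
  have A (x y : R * R) : x + y = (x.1 + y.1, x.2 + y.2) by [].
  have Z (h : R) (x : R * R) : h *: x = (h * x.1, h * x.2) by [].
  apply/funext => h; case: b {dphi}; rewrite /line_through /= A Z /= /GRing.scale /=.
    by rewrite mulr0 add0r.
  by rewrite mulr0 add0r.
by split; rewrite /derivable /derive E.
Qed.

End VanishingIntegral.

Section FirstCoordinate.
Context {R : realType}.
Variable Omega : set (R * R).
Hypothesis aO : admissible Omega.

Let mO : @measurable _ (mplane R) Omega := admissible_measurable aO.
Let fO : (leb2 (Omega : set (mplane R)) < +oo)%E := admissible_lty aO.

Lemma compact_coordinate_bound (K : set (R * R)) : compact K ->
  exists2 N : R, 0 < N & forall b x, K x -> `|coordinate b x| < N.
Proof.
move=> /compact_bounded[M [Mr HM]]; exists (`|M| + 2); first by rewrite ltr_wpDl.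
move=> b x Kx; have : `|x| <= `|M| + 1.
  by apply: (HM (`|M| + 1)) => //; rewrite (le_lt_trans (ler_norm _))// ltrDl.
rewrite {1}/Num.norm /= /mx_norm ge_max => /andP[h1 h2].
by case: b; rewrite /=; [apply: le_lt_trans h1 _|apply: le_lt_trans h2 _]; lra.
Qed.

Lemma L2_first_coordinate (q : R -> R) : continuous q -> L2 Omega (fun x => q x.1).
Proof.
move=> cq; have [bO oO cO] := (let: And4 _ h1 h2 h3 := aO in And3 h1 h2 h3).
have [p [n Hp]] := cell_coordinate_bounded true ltr01 (And3 bO oO cO).
have : compact (q @` `[p, p + n.+1%:R * 1]%classic).
  apply: continuous_compact; last exact: segment_compact.
  exact: continuous_subspaceT.
move=> /compact_bounded[M [Mr HM]].
have c1 : continuous (fun x : R * R => q x.1).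
  by move=> x; apply: (@cvg_comp _ _ _ fst q _ (nbhs x.1)); [exact: cvg_fst|exact: cq].
apply: (L2_bounded (M := `|M| + 1)) => //.
  by apply: (@measurable_funS _ _ (mplane R) _ setT) => //; exact: continuous_measurable2.
move=> x /Hp /= /andP[h1 h2]; apply: (HM (`|M| + 1)).
  by rewrite (le_lt_trans (ler_norm _))// ltrDl.
by exists x.1 => //=; rewrite in_itv/= !ltW.
Qed.

(** The product of the polynomial and a test function has compact support, so
    that its partial derivatives integrate to zero on every line. *)
Lemma H1_polynomial (p : {poly R}) :
  H1 Omega (fun x => p.[x.1]) ((fun x => p^`().[x.1]), (fun=> 0)).
Proof.
have c1 (q : {poly R}) : continuous (fun x : R * R => q.[x.1]).
  move=> x; apply: (@cvg_comp _ _ _ fst (horner q) _ (nbhs x.1)); first exact: cvg_fst.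
  exact: continuous_horner.
have Lp (q : {poly R}) : L2 Omega (fun x => q.[x.1]).
  by apply: L2_first_coordinate; exact: continuous_horner.
have L0 := L2_cst 0 mO fO.
have W (b : bool) (g : R * R -> R) : continuous g -> L2 Omega g ->
    (forall (phi : R * R -> R) s t, derivable phi (line_through b s t) (if b then @e1 R else @e2 R) ->
      is_derive t (1 : R) (fun t => p.[(line_through b s t).1] * phi (line_through b s t))
        (p.[(line_through b s t).1] * 'D_(if b then @e1 R else @e2 R) phi (line_through b s t) +
         g (line_through b s t) * phi (line_through b s t))) ->
    weak_derivative Omega (if b then @e1 R else @e2 R) (fun x => p.[x.1]) g.
  move=> cg Lg Hd; apply/weak_derivativeE => phi tphi.
  have Lphi := test_function_L2 [::] mO fO tphi; have LD := test_function_L2 [:: b] mO fO tphi.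
  have [sphi [K [cK KO phi0]]] := tphi.
  have [N N0 HN] := compact_coordinate_bound cK.
  set D := iter_deriv [:: b] phi in LD *.
  have D0 : forall x, ~ K x -> D x = 0 := iter_deriv_out [:: b] (plane_compact_closed cK) phi0.
  pose d x := p.[x.1] * D x + g x * phi x.
  have cd : continuous d.
    move=> x; apply: cvgD; apply: cvgM; [exact: c1|exact: (sphi [:: b]).1|exact: cg|exact: (sphi [::]).1].
  have d0 x : ~ K x -> d x = 0 by move=> nK; rewrite /d phi0// D0// !mulr0 addr0.
  have lK s t : N <= `|t| -> ~ K (line_through b s t).
    by move=> tN /(HN b); case: (b) => /=; rewrite ltNge tN.
  have : \int[leb2]_x d x = 0.
    apply: (fubini_vanishing (b := b)); first exact: compact_support_integrable cK d0.
    move=> s; apply: (supp_FTC (F := fun t => p.[(line_through b s t).1] * phi (line_through b s t)) N0).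
    - by move=> t; apply: Hd; exact: smooth_derivable.
    - have cl := @line_through_continuous R b s.
      by move=> t; apply: (@continuous_comp _ _ _ (line_through b s) d); [exact: cl|exact: cd].
    - by move=> t tN; rewrite phi0 ?mulr0//; exact: lK.
    - by move=> t tN; rewrite d0//; exact: lK.
  rewrite (@restrict_supp _ Omega) //; last by move=> x nO; apply: d0 => /KO.
  have Lq := Lp p.
  rewrite RintegralD//; [|exact: L2_integrableM|exact: L2_integrableM].
  by move=> /eqP; rewrite addr_eq0 => /eqP.
split => //=.
  apply: (W true); [exact: c1|exact: Lp|move=> phi s t /line_derive dphi /=].
  have D := is_deriveM (is_derive_poly p t) dphi.
  by apply: (is_derive_eq D); rewrite /GRing.scale /= mulrC [_.[t] * _]mulrC addrC; ring.
apply: (W false); [by move=> x; exact: cvg_cst|exact: L0|].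
move=> phi s t /line_derive dphi /=.
have D := is_deriveM (is_derive_cst p.[s] t 1) dphi.
by apply: (is_derive_eq D); rewrite /GRing.scale /=; ring.
Qed.

Lemma open_null_empty (A : set (R * R)) : open A -> leb2 (A : set (mplane R)) = 0%E -> A = set0.
Proof.
move=> oA A0; apply/seteqP; split => // x Ax.
have [q [q0 qx qA]] := open_ratbox oA Ax.
have sA : cratbox q `<=` A := qA.
have mI (a b : R) : @measurable _ (mline R) `[a, b]%classic by exact: measurable_itv.
have mC : @measurable _ (mplane R) (cratbox q) by apply: measurableX; exact: mI.
have : (leb2 (cratbox q : set (mplane R)) <= leb2 (A : set (mplane R)))%E.
  by apply: le_measure; rewrite ?inE//; exact: open_measurable2.
rewrite A0 leNgt => /negP; apply.
have lI (a : R) : @lebesgue_measure R `[a - ratr q.2, a + ratr q.2]%classic = (2 * ratr q.2)%:E.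
  by rewrite lebesgue_measure_itv/= lte_fin ltrD2l gtrN// -EFinD; congr EFin; ring.
apply: (@lt_le_trans _ _ ((2 * ratr q.2)%:E * (2 * ratr q.2)%:E)%E).
  by rewrite -EFinM lte_fin mulr_gt0// mulr_gt0.
rewrite -[X in (X * _ <= _)%E](lI (ratr q.1.1)) -(lI (ratr q.1.2)).
by rewrite /cratbox product_measure1E//; exact: mI.
Qed.

(** A polynomial that vanishes almost everywhere on an open set vanishes on it by
    continuity, hence has infinitely many roots. *)
Lemma test_family k : exists W : 'I_k -> H1space Omega, form_free (@mass R Omega) W.
Proof.
have /choice[W HW] (i : 'I_k) : exists w : H1space Omega,
    H1val w = ((fun x => ('X^i : {poly R}).[x.1]), ((fun x => ('X^i : {poly R})^`().[x.1]), (fun=> 0))).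
  by apply: (H1_mk aO); exact: H1_polynomial.
exists W; apply/(independentE aO) => c [N [mN N0 sub]].
pose P : {poly R} := \poly_(i < k) (if insub i is Some j then c j else 0).
have PE t : \sum_(i < k) c i * ('X^i : {poly R}).[t] = P.[t].
  by rewrite horner_poly; apply: eq_bigr => i _; rewrite valK hornerXn.
suff P0 : P = 0.
  by move=> i; have := congr1 (fun q : {poly R} => q`_i) P0; rewrite coef_poly ltn_ord valK coef0.
have c1 : continuous (fun x : R * R => P.[x.1]).
  move=> x; apply: (@cvg_comp _ _ _ fst (horner P) _ (nbhs x.1)); first exact: cvg_fst.
  exact: continuous_horner.
have [[x0 Ox0] _ oO _] := aO.
pose A := Omega `&` ((fun x : R * R => P.[x.1]) @^-1` [set t | t != 0]).
have oA : open A.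
  by apply: openI => //; apply: open_comp; [move=> x _; exact: c1|exact: open_neq].
have A0 : A = set0.
  apply: (open_null_empty oA); apply/eqP; rewrite eq_le measure_ge0 andbT -N0.
  apply: le_measure; rewrite ?inE//; first exact: open_measurable2.
  move=> x [Ox Px]; apply: sub => /= /(_ Ox) H.
  move: Px; rewrite /= -PE; apply/negP/negPn/eqP; rewrite -[RHS]H.
  by apply: eq_bigr => i _; rewrite /H1fun HW.
apply/eqP; rewrite -[_ == _]negbK; apply/negP => Pn0.
have /nbhs_ballP[e /= e0 eO] : nbhs x0 Omega by exact: open_nbhs_nbhs.
pose n := size P.
pose pt (i : nat) : R := x0.1 + e * i%:R / n.+1%:R.
have pt_root i : (i < n.+1)%N -> root P (pt i).
  move=> ik; apply/eqP/eqP; rewrite -[_ == _]negbK; apply/negP => h.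
  have : A (pt i, x0.2).
    split => //; apply: eO; split => /=; last exact: ballxx.
    rewrite /ball/= /pt opprD addrA subrr sub0r normrN ger0_norm ?divr_ge0 ?mulr_ge0 ?(ltW e0)//.
    by rewrite -mulrA gtr_pMr// ltr_pdivrMr// mul1r ltr_nat.
  by rewrite A0.
have pt_inj : injective pt.
  have n0 : (n.+1%:R : R)^-1 != 0 by rewrite invr_eq0 pnatr_eq0.
  move=> i j /addrI /(mulIf n0) h; apply/eqP; rewrite -(eqr_nat R); apply/eqP.
  by apply: mulfI h; rewrite gt_eqF.
have := max_poly_roots Pn0 (rs := [seq pt i | i <- iota 0 n.+1]).
rewrite size_map size_iota /n => H; suff : (n.+1 < n)%N by rewrite ltnNge leqnSn.
apply: H; first by apply/allP => y /mapP[i]; rewrite mem_iota /= add0n => ik ->; exact: pt_root.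
by rewrite map_inj_uniq ?iota_uniq.
Qed.

End FirstCoordinate.

(** * Eigenvalues after cutting off a piece *)

Section Comparison.
Context {R : realType}.

Lemma sum_CS (I : finType) (x y : I -> R) :
  (\sum_i x i * y i) ^+ 2 <= (\sum_i x i ^+ 2) * (\sum_i y i ^+ 2).
Proof.
apply: discriminant => [|t]; first by apply: sumr_ge0 => i _; exact: sqr_ge0.
rewrite !mulr_sumr -!big_split /=; apply: sumr_ge0 => i _.
by rewrite (_ : _ + _ = (x i + t * y i) ^+ 2) ?sqr_ge0//; ring.
Qed.

Lemma H1val0 (Omega : set (R * R)) : H1val (0 : H1space Omega) = 0.
Proof. exact: (raddf0 val). Qed.

Lemma Rintegral_sum (C : set (R * R)) n (f : 'I_n -> R * R -> R) : @measurable _ (mplane R) C ->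
  (forall i, leb2.-integrable C (EFin \o f i)) ->
  leb2.-integrable C (EFin \o (fun x => \sum_i f i x)) /\
  \int[leb2]_(x in C) (\sum_i f i x) = \sum_i \int[leb2]_(x in C) f i x.
Proof.
move=> mC fi; elim: (index_enum _) => [|i s [IH1 IH2]].
  under eq_Rintegral do rewrite big_nil; rewrite big_nil; split.
    by apply: eq_integrable (integrable0 _ _) => // x _ /=; rewrite big_nil.
  by rewrite /Rintegral integral0.
under eq_Rintegral do rewrite big_cons; rewrite big_cons -IH2 -RintegralD//; split => //.
by apply: eq_integrable (integrableD mC (fi i) IH1) => // x _ /=; rewrite big_cons.
Qed.

(** Cauchy-Schwarz at each point. *)
Lemma gradsq_sum (Omega : set (R * R)) n (c : 'I_n -> R) (W : 'I_n -> H1space Omega) x :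
  gradsq (H1grad (\sum_i c i *: W i)) x <= (\sum_i c i ^+ 2) * \sum_i gradsq (H1grad (W i)) x.
Proof.
have [E1 E2] : (H1grad (\sum_i c i *: W i)).1 x = \sum_i c i * (H1grad (W i)).1 x /\
  (H1grad (\sum_i c i *: W i)).2 x = \sum_i c i * (H1grad (W i)).2 x.
  elim/big_rec3 : _ => [|i y1 y2 y3 _ [<- <-]].
    by rewrite /H1grad H1val0.
  by rewrite /H1grad H1valD H1valZ.
rewrite /gradsq E1 E2 big_split /= mulrDr; apply: lerD; exact: sum_CS.
Qed.

Section Gap.
Variables (Omega : set (R * R)) (K : R).
Hypothesis aO : admissible Omega.
Hypothesis diamK : forall x y, Omega x -> Omega y -> (x.1 - y.1) ^+ 2 + (x.2 - y.2) ^+ 2 <= K.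

Let mO : @measurable _ (mplane R) Omega := admissible_measurable aO.
Let hb := mass_semi_inner aO.
Let ha := energy_semi_inner aO.

Lemma energy_of_mean0 (v : H1space Omega) : \int[leb2]_(x in Omega) H1fun v x = 0 ->
  mass v v <= 4 * K * energy v v.
Proof.
move=> v0; have cO : convex_cell Omega by case: aO.
have := cell_poincare aO v cO (@subset_refl _ _) diamK.
by rewrite v0 mulr0 expr0n addr0 -(energyE aO).
Qed.

Lemma integral_H1fun_sum (C : set (R * R)) n (c : 'I_n -> R) (W : 'I_n -> H1space Omega) :
  @measurable _ (mplane R) C -> C `<=` Omega ->
  \int[leb2]_(x in C) H1fun (\sum_i c i *: W i) x = \sum_i c i * \int[leb2]_(x in C) H1fun (W i) x.
Proof.
move=> mC CO; elim/big_rec2 : _ => [|i y1 y2 _ <-].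
  by rewrite /H1fun H1val0 /Rintegral integral0.
have iC (v : H1space Omega) : leb2.-integrable C (EFin \o H1fun v) by exact: H1fun_integrable.
rewrite -RintegralZl// -RintegralD//.
exact: (integrableZl mC (c i) (iC (W i))).
Qed.

(** A nonzero combination of the first two eigenfunctions has mean zero, hence
    positive energy by the Poincaré inequality. *)
Lemma second_eigenvalue_gt0 n lam (u : nat -> H1space Omega) :
  eigensystem (@energy R Omega) (@mass R Omega) n lam u -> (1 < n)%N -> 0 < lam 1%N.
Proof.
move=> [uo ue um] n1.
have es : eigensystem (@energy R Omega) (@mass R Omega) 2 lam u.
  by split=> [i j i2 j2|i i2|i v i2]; [apply: uo|apply: ue|apply: um]; exact: leq_trans n1.
have [c [v0 vi]] := @free_orthogonal _ _ _ hb 2 (fun i : 'I_2 => u i) 1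
  (fun _ v => \int[leb2]_(x in Omega) H1fun v x) (eigensystem_free hb es)
  (fun _ c => integral_H1fun_sum c _ mO (@subset_refl _ _)) (ltnSn 1).
have l1 i : (i < 2)%N -> lam i <= lam 1%N.
  by move=> i2; apply: (eigensystem_monotone es); rewrite -ltnS.
have [_ Hv] := eigensystem_span ha hb c es l1.
have := energy_of_mean0 (vi ord0); move: v0 Hv; set v := \sum_i _ => v0 Hv Hp.
have [x Ox] : Omega !=set0 by case: aO.
have K0 : 0 <= K by have := diamK Ox Ox; rewrite !subrr expr0n addr0.
have e0 : 0 < energy v v.
  rewrite lt_def (form_ge0 ha) andbT; apply/eqP => E; rewrite E mulr0 in Hp.
  by have := lt_le_trans v0 Hp; rewrite ltxx.
have := lt_le_trans e0 Hv; by rewrite pmulr_lgt0.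
Qed.

End Gap.

Section Cut.
Variables (B Omega C : set (R * R)) (K eps : R).
Hypotheses (aB : admissible B) (aO : admissible Omega) (aC : admissible C).
Hypotheses (OB : Omega `<=` B) (CB : C `<=` B) (BOC : B `<=` Omega `|` C).
Hypothesis diamK : forall x y, C x -> C y -> (x.1 - y.1) ^+ 2 + (x.2 - y.2) ^+ 2 <= K.
Variables (k : nat) (lam : nat -> R) (u : nat -> H1space B).
Hypothesis es : eigensystem (@energy R B) (@mass R B) k.+2 lam u.
Hypothesis smallC : \sum_(i < k.+2) \int[leb2]_(x in C) gradsq (H1grad (u i)) x <= eps.

Let mB : @measurable _ (mplane R) B := admissible_measurable aB.
Let mO : @measurable _ (mplane R) Omega := admissible_measurable aO.
Let mC : @measurable _ (mplane R) C := admissible_measurable aC.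
Let hb := mass_semi_inner aB.
Let ha := energy_semi_inner aB.

Lemma integral_cover (f : R * R -> R) : leb2.-integrable B (EFin \o f) -> (forall x, 0 <= f x) ->
  \int[leb2]_(x in B) f x <= \int[leb2]_(x in Omega) f x + \int[leb2]_(x in C) f x.
Proof.
move=> fi f0.
have mCO : @measurable _ (mplane R) (C `\` Omega) by exact: measurableD.
have -> : B = Omega `|` (C `\` Omega).
  apply/seteqP; split => [x Bx|x [/OB//|[/CB]//]].
  have [Ox|nO] := pselect (Omega x); first by left.
  by right; split => //; case: (BOC Bx).
have CO : C `\` Omega `<=` B by move=> x [/CB].
rewrite Rintegral_setU//.
- rewrite lerD2l /Rintegral fine_le//.
  + exact: (integrable_fin_num mCO (integrableS mB mCO CO fi)).
  + exact: (integrable_fin_num mC (integrableS mB mC CB fi)).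
  + apply: ge0_subset_integral => //.
      exact: measurable_int (integrableS mB mC CB fi).
    by move=> x _; rewrite lee_fin.
- by apply: (integrableS mB _ _ fi); [exact: measurableU|move=> x [/OB|/CO]].
- by apply/disj_setPS => x [h1 [_ h2]].
Qed.

Lemma gradsq_integrable (A : set (R * R)) (v : H1space B) : @measurable _ (mplane R) A -> A `<=` B ->
  leb2.-integrable A (EFin \o gradsq (H1grad v)).
Proof.
move=> mA AB; apply: (integrableS mB mA AB).
exact: (integrableD mB (L2_integrable_sqr (H1grad1_L2 aB v)) (L2_integrable_sqr (H1grad2_L2 aB v))).
Qed.

(** Among the combinations of the first [k + 2] eigenfunctions of [B], one that is
    not zero has mean zero on [C] and is orthogonal on [Omega] to the first [k]
    eigenfunctions of [Omega]. By the Poincaré inequality on [C] it loses only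
    the fraction [4 * K * eps] of its mass when it is restricted to [Omega]. *)
Lemma neumann_mu_cut : 4 * K * eps < 1 ->
  (neumann_mu Omega k <= (lam k.+1 / (1 - 4 * K * eps))%:E)%E.
Proof.
move=> small; have d0 : 0 < 1 - 4 * K * eps by lra.
have hbO := mass_semi_inner aO; have haO := energy_semi_inner aO.
have [W fW] := test_family aO k.+1.
have [lam' [u' es']] := spectral haO hbO (energy_graph_complete aO) (energy_compact aO) fW.
have [uo' ue' um'] := es'.
have mule : (neumann_mu Omega k <= (lam' k)%:E)%E.
  apply: ereal_inf_lbound; exists (lam' k) => //=.
  exists [seq lam' i | i <- iota 0 k.+1]; split.
  - by rewrite size_map size_iota.
  - exact: eigensystem_eigenvalue_list es'.
  - apply/allP => y /mapP[i]; rewrite mem_iota add0n /= => ik ->.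
    exact: eigensystem_monotone es' _ _.
apply: (le_trans mule); rewrite lee_fin ler_pdivlMr//.
have /choice[r Hr] (v : H1space B) : exists w : H1space Omega, H1val w = H1val v.
  have [w Ew] := H1_mk aO (H1_sub mB mO OB (H1P aB v)); exists w.
  by rewrite Ew /H1fun /H1grad; case: (H1val v).
have rE c : r (\sum_(i < k.+2) c i *: u i) = \sum_i c i *: r (u i).
  apply: val_inj; rewrite /= Hr.
  elim/big_rec2 : _ => [|i y1 y2 _ IH].
    by rewrite !H1val0.
  by rewrite !H1valD !H1valZ IH Hr.
pose l (i : 'I_k.+1) (v : H1space B) : R :=
  if (i : nat) == k then \int[leb2]_(x in C) H1fun v x else mass (u' i) (r v).
have ll (i : 'I_k.+1) (c : 'I_k.+2 -> R) : l i (\sum_j c j *: u j) = \sum_j c j * l i (u j).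
  rewrite /l; case: ifP => _; first exact: (integral_H1fun_sum aB c _ mC CB).
  by rewrite rE (form_sumZr hbO).
have [c [v0 Hv]] := free_orthogonal hb (eigensystem_free hb es) ll (ltnSn _).
have lk i : (i < k.+2)%N -> lam i <= lam k.+1.
  by move=> ik; apply: (eigensystem_monotone es); rewrite -ltnS.
have [bv av] := eigensystem_span ha hb c es lk.
move: v0 Hv bv av; set v := \sum_i _ => v0 Hv bv av.
have C0 : \int[leb2]_(x in C) H1fun v x = 0 by have := Hv ord_max; rewrite /l eqxx.
have PO : lam' k * mass (r v) (r v) <= energy (r v) (r v).
  apply: um' => // j jk; have := Hv (widen_ord (leqnSn k) (Ordinal jk)).
  by rewrite /l /= ltn_eqF.
have cC : convex_cell C by case: aC.
have PC := cell_poincare aB v cC CB diamK.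
rewrite C0 mulr0 expr0n addr0 in PC.
have GC : \int[leb2]_(x in C) gradsq (H1grad v) x <= mass v v * eps.
  apply: (@le_trans _ _ (mass v v * \sum_(i < k.+2) \int[leb2]_(x in C) gradsq (H1grad (u i)) x)); last first.
    by rewrite ler_wpM2l// form_ge0.
  have iu (i : 'I_k.+2) : leb2.-integrable C (EFin \o gradsq (H1grad (u i))).
    exact: gradsq_integrable.
  have [i1 i2] := Rintegral_sum mC iu.
  rewrite -i2 -RintegralZl//.
  apply: le_Rintegral => //; [exact: gradsq_integrable|exact: (integrableZl mC (mass v v) i1)|].
  by move=> x _; rewrite bv; exact: gradsq_sum.
have [x Cx] : C !=set0 by case: aC.
have K0 : 0 <= K by have := diamK Cx Cx; rewrite !subrr expr0n addr0.
have MB : mass v v <= mass (r v) (r v) + \int[leb2]_(x in C) (H1fun v x ^+ 2).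
  have := integral_cover (L2_integrable_sqr (H1fun_L2 aB v)) (fun x => sqr_ge0 _).
  by rewrite /mass /ip /H1fun Hr.
have EB : energy (r v) (r v) <= energy v v.
  rewrite (energyE aO) (energyE aB) /H1grad Hr -/(H1grad v).
  rewrite /Rintegral fine_le//.
  + exact: (integrable_fin_num mO (gradsq_integrable v mO OB)).
  + exact: (integrable_fin_num mB (gradsq_integrable v mB (@subset_refl _ _))).
  + apply: ge0_subset_integral => //.
      exact: measurable_int (gradsq_integrable v mB (@subset_refl _ _)).
    by move=> y _; rewrite lee_fin addr_ge0// sqr_ge0.
have l0 : 0 <= lam' k.
  have := form_ge0 haO (u' k); rewrite ue' // uo'// eqxx mulr1; exact.
have MC : \int[leb2]_(x in C) (H1fun v x ^+ 2) <= 4 * K * eps * mass v v.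
  apply: (le_trans PC); rewrite -[leRHS]mulrA [eps * _]mulrC; apply: ler_wpM2l => //.
  by rewrite mulr_ge0.
rewrite -(ler_pM2r v0); apply: le_trans av; apply: le_trans EB; apply: le_trans PO.
by rewrite -[leLHS]mulrA; apply: ler_wpM2l => //; lra.
Qed.

End Cut.
End Comparison.

(** * One-dimensional Hausdorff measure *)

Section HausdorffMeasure.
Context {R : realType}.
Local Notation plane := (R * R)%type.
Implicit Types (A S T : set plane) (U : (set plane)^nat) (r : R).

Lemma edistance_le (x y : plane) (d : R) : 0 <= d ->
  (edistance x y <= d) = ((x.1 - y.1) ^+ 2 + (x.2 - y.2) ^+ 2 <= d ^+ 2).
Proof.
move=> d0; rewrite -[RHS](@ler_sqrt _ _ (d ^+ 2)) ?sqr_ge0//.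
by rewrite sqrtr_sqr ger0_norm.
Qed.

Lemma diameter_ge0 A : (0 <= diameter A)%E.
Proof. by apply: ereal_sup_ubound; left. Qed.

Lemma diameter_ub A (x y : plane) : A x -> A y -> ((edistance x y)%:E <= diameter A)%E.
Proof. by move=> Ax Ay; apply: ereal_sup_ubound; right; exists (x, y). Qed.

Lemma diameter_le A (d : R) : 0 <= d -> (forall x y, A x -> A y -> edistance x y <= d) ->
  (diameter A <= d%:E)%E.
Proof.
move=> d0 Ad; apply: ge_ereal_sup => _ [->|[[x y] [/= Ax Ay] <-]]; rewrite lee_fin//.
exact: Ad.
Qed.

Lemma diameter0 : diameter (set0 : set plane) = 0%E.
Proof. by apply/eqP; rewrite eq_le diameter_ge0 andbT diameter_le. Qed.

Definition fine_cover r A U := A `<=` \bigcup_i U i /\ forall i, (diameter (U i) <= r%:E)%E.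

(** The infimum over covers at scale [r], of which [hausdorff1] is the supremum. *)
Definition premeasure r A : \bar R :=
  ereal_inf [set (\sum_(0 <= i <oo) diameter (U i))%E | U in fine_cover r A].

Lemma premeasure_le_hausdorff1 r A : 0 < r -> (premeasure r A <= hausdorff1 A)%E.
Proof. by move=> r0; apply: ereal_sup_ubound; exists r. Qed.

Lemma hausdorff1_le A (m : \bar R) : (forall r, 0 < r -> (premeasure r A <= m)%E) -> (hausdorff1 A <= m)%E.
Proof. by move=> H; apply: ge_ereal_sup => _ [r r0 <-]; exact: H. Qed.

Lemma premeasure_ge0 r A : (0 <= premeasure r A)%E.
Proof.
by apply: le_ereal_inf_tmp => _ [U _ <-]; apply: nneseries_ge0 => i _ _; exact: diameter_ge0.
Qed.

Lemma hausdorff1_ge0 A : (0 <= hausdorff1 A)%E.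
Proof. exact: le_trans (premeasure_ge0 1 A) (premeasure_le_hausdorff1 _ ltr01). Qed.

Lemma premeasure_subset r A S : A `<=` S -> (premeasure r A <= premeasure r S)%E.
Proof.
move=> AS; apply: ereal_inf_le_tmp => _ [U [cU dU] <-]; exists U => //; split => //.
exact: subset_trans cU.
Qed.

Lemma premeasure_scale r r' A : r <= r' -> (premeasure r' A <= premeasure r A)%E.
Proof.
move=> rr; apply: ereal_inf_le_tmp => _ [U [cU dU] <-]; exists U => //; split => // i.
by apply: (le_trans (dU i)); rewrite lee_fin.
Qed.

Lemma premeasure0 r : 0 < r -> premeasure r set0 = 0%E.
Proof.
move=> r0; apply/eqP; rewrite eq_le premeasure_ge0 andbT.
apply: ge_ereal_inf; exists 0%E => //; exists (fun=> set0).
  by split => // i; rewrite diameter0 lee_fin ltW.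
by apply: eseries0 => i _ _; exact: diameter0.
Qed.

(** Adding finitely many small sets to a cover. *)
Lemma premeasure_append r S T M (V : 'I_M -> set plane) (d : R) : 0 <= d <= r ->
  T `<=` \bigcup_j V j -> (forall j, (diameter (V j) <= d%:E)%E) ->
  (premeasure r (S `|` T) <= premeasure r S + (M%:R * d)%:E)%E.
Proof.
move=> /andP[d0 dr] TV dV; rewrite -leeBlDr//; apply: le_ereal_inf_tmp => _ [U [cU dU] <-].
rewrite leeBlDr//; apply: ge_ereal_inf.
pose W i := if insub i is Some j then V j else U (i - M)%N.
have WM i : W (i + M)%N = U i.
  by rewrite /W insubF ?addnK//; apply/negbTE; rewrite -leqNgt leq_addl.
exists (\sum_(0 <= i <oo) diameter (W i))%E.
  exists W => //; split.
    move=> x [/cU[i _ Ux]|/TV[j _ Vx]]; first by exists (i + M)%N => //; rewrite WM.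
    by exists j => //; rewrite /W valK.
  move=> i; rewrite /W; case: insub => [j|//].
  by apply: (le_trans (dV j)); rewrite lee_fin.
rewrite (nneseries_split 0 M); last by move=> i _; exact: diameter_ge0.
rewrite add0n addeC; apply: leeD.
  rewrite -(nneseries_addn M); last by move=> i; exact: diameter_ge0.
  by rewrite le_eqVlt; apply/orP; left; apply/eqP; apply: eq_eseriesr => i _; rewrite WM.
rewrite big_mkord; apply: (@le_trans _ _ (\sum_(i < M) d%:E)%E).
  by apply: lee_sum => i _; rewrite /W valK.
by rewrite sumEFin lee_fin sumr_const card_ord mulr_natl.
Qed.

(** At scales below their distance, separated sets do not share the members of
    a cover. *)
Lemma premeasure_separated r S T : (forall x y, S x -> T y -> r < edistance x y) ->
  (premeasure r S + premeasure r T <= premeasure r (S `|` T))%E.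
Proof.
move=> ST; apply: le_ereal_inf_tmp => _ [U [cU dU] <-].
pose part A i := if pselect (U i `&` A !=set0) then U i else set0.
have partd A i : (diameter (part A i) <= r%:E)%E.
  rewrite /part; case: pselect => h; first exact: dU.
  by rewrite diameter0; apply: le_trans (dU i); exact: diameter_ge0.
have cover A : A `<=` S `|` T -> (premeasure r A <= \sum_(0 <= i <oo) diameter (part A i))%E.
  move=> AST; apply: ereal_inf_lbound; exists (part A) => //; split => // x Ax.
  have [i _ Ux] := cU _ (AST _ Ax); exists i => //; rewrite /part; case: pselect => // -[].
  by exists x.
apply: (le_trans (leeD (cover S (@subsetUl _ _ _)) (cover T (@subsetUr _ _ _)))).
rewrite -nneseriesD; last 2 first.
- by move=> i _ _; exact: diameter_ge0.
- by move=> i _ _; exact: diameter_ge0.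
apply: lee_nneseries => [i _ _|i _].
  by rewrite adde_ge0 ?diameter_ge0.
rewrite /part; case: pselect => [[x [Ux Sx]]|nS]; last first.
  by rewrite diameter0 add0e; case: pselect => h //; rewrite ?diameter0 diameter_ge0.
case: pselect => [[y [Uy Ty]]|nT]; last by rewrite diameter0 adde0.
have := le_trans (diameter_ub Ux Uy) (dU i); rewrite lee_fin leNgt.
by rewrite ST.
Qed.

(** The image of a contraction reaches down from its supremum by at most [d]. *)
Lemma projection_interval (f : plane -> R) A (d : \bar R) :
  (forall x y, `|f x - f y| <= edistance x y) -> diameter A = d ->
  exists I : set (mline R), [/\ measurable I, forall x, A x -> I (f x) & (leb I <= d)%E].
Proof.
move=> f1 <-; have [[x0 Ax0]|/set0P/negP/negPn/eqP ->] := pselect (A !=set0); last first.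
  by exists set0; split => //; rewrite measure0 diameter_ge0.
have [|Ad] := leP +oo%E (diameter A).
  rewrite leye_eq => /eqP ->.
  by exists setT; split => //; exact: leey.
have /fineK Ed : diameter A \is a fin_num by rewrite ge0_fin_numE// diameter_ge0.
set D := fine _ in Ed.
have fD x y : A x -> A y -> f x <= f y + D.
  move=> Ax Ay; have := diameter_ub Ax Ay; rewrite -Ed lee_fin => h.
  by have := f1 x y; rewrite ler_norml => /andP[_]; lra.
have fs : has_sup (f @` A).
  split; first by exists (f x0), x0.
  by exists (f x0 + D) => _ [x Ax <-]; exact: fD.
exists (`[sup (f @` A) - D, sup (f @` A)]%classic); split.
- exact: measurable_itv.
- move=> x Ax; rewrite /= in_itv/=; apply/andP; split; last by apply: ub_le_sup; [case: fs|exists x].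
  rewrite lerBlDr; apply: ge_sup; first by case: fs.
  by move=> _ [y Ay <-]; exact: fD.
rewrite -Ed; have D0 : 0 <= D by rewrite -lee_fin Ed diameter_ge0.
have lI (p q : R) : p <= q -> leb (`[p, q]%classic : set (mline R)) = (q - p)%:E.
  move=> pq; transitivity (lebesgue_measure `[p, q]%classic : \bar R); first by [].
  rewrite lebesgue_measure_itv/= lte_fin; case: ltP => [_|qp]; first by rewrite -EFinD.
  by rewrite (_ : q - p = 0)//; lra.
by rewrite lI ?lee_fin; lra.
Qed.

(** A contraction maps a cover to a cover by intervals of no larger total length. *)
Lemma premeasure_ge_projection r (f : plane -> R) T (a b : R) :
  (forall x y, `|f x - f y| <= edistance x y) -> `[a, b]%classic `<=` f @` T ->
  ((b - a)%:E <= premeasure r T)%E.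
Proof.
move=> f1 abT; apply: le_ereal_inf_tmp => _ [U [cU dU] <-].
have /choice[I HI] i : exists I : set (mline R),
    [/\ measurable I, forall x, U i x -> I (f x) & (leb I <= diameter (U i))%E].
  exact: projection_interval.
apply: (@le_trans _ _ (\sum_(0 <= i <oo) leb (I i))%E); last first.
  by apply: lee_nneseries => [i _ _|i _]; [exact: measure_ge0|case: (HI i)].
have [ab|ba] := ltP a b; last first.
  by apply: (@le_trans _ _ 0%E); [rewrite lee_fin subr_le0|apply: nneseries_ge0].
have mab : @measurable _ (mline R) `[a, b]%classic by exact: measurable_itv.
have -> : (b - a)%:E = leb (`[a, b]%classic : set (mline R)).
  transitivity (lebesgue_measure `[a, b]%classic : \bar R); last by [].
  by rewrite lebesgue_measure_itv/= lte_fin ab -EFinD.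
apply: measure_sigma_subadditive => //; first by move=> i; case: (HI i).
move=> t /abT[x Tx <-]; have [i _ Ux] := cU _ Tx; exists i => //.
by case: (HI i) => _ h _; exact: h.
Qed.

End HausdorffMeasure.

(** * The boundary of the disk *)

Section LipschitzCurves.
Context {R : realType}.
Local Notation plane := (R * R)%type.

Lemma subdivision_index (a h t : R) M : a <= t -> t <= a + M.+1%:R * h ->
  exists j : 'I_M.+1, a + j%:R * h <= t /\ t <= a + j.+1%:R * h.
Proof.
elim: M => [|M IH] at_ tM; first by exists ord0; rewrite /= mul0r addr0.
have [tm|tm] := leP t (a + M.+1%:R * h); last by exists ord_max; split => //=; exact: ltW.
by have [j hj] := IH at_ tm; exists (widen_ord (leqnSn _) j).
Qed.

(** The curve is cut into arcs of equal parameter length, shorter than [r]. *)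
Lemma premeasure_lipschitz_curve r (S : set plane) (gam : R -> plane) (a b L : R) :
  0 < r -> 0 <= L -> a <= b ->
  (forall t t', `[a, b]%classic t -> `[a, b]%classic t' -> edistance (gam t) (gam t') <= L * `|t - t'|) ->
  (premeasure r (S `|` gam @` `[a, b]) <= premeasure r S + (L * (b - a))%:E)%E.
Proof.
move=> r0 L0 ab gL; pose M := Num.truncn (L * (b - a) / r).
pose h := (b - a) / M.+1%:R.
have M0 : 0 < (M.+1%:R : R) by rewrite ltr0n.
have h0 : 0 <= h by rewrite divr_ge0 ?subr_ge0// ltW.
have hM : M.+1%:R * h = b - a by rewrite /h mulrC divfK// gt_eqF.
have -> : L * (b - a) = M.+1%:R * (L * h) by rewrite -hM mulrCA.
have hr : L * h <= r.
  by rewrite /h mulrA ler_pdivrMr// [leRHS]mulrC -ler_pdivrMr// ltW// truncnS_gt.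
pose V (j : 'I_M.+1) := gam @` (`[a, b] `&` `[a + j%:R * h, a + j.+1%:R * h])%classic.
apply: (@premeasure_append _ r S _ M.+1 V (L * h)); first by rewrite mulr_ge0.
  move=> _ [t tab <-]; have := tab; rewrite /= in_itv/= => /andP[h1 h2].
  have tM : t <= a + M.+1%:R * h by rewrite hM; lra.
  have [j [h3 h4]] := subdivision_index h1 tM.
  by exists j => //; exists t => //; split => //; rewrite /= in_itv/= h3.
move=> j; apply: diameter_le; first exact: mulr_ge0.
move=> _ _ [t [tab /= tj] <-] [t' [t'ab /= t'j] <-]; apply: (le_trans (gL _ _ tab t'ab)).
rewrite ler_wpM2l//; move: tj t'j; rewrite !in_itv/= ler_norml -natr1 mulrDl mul1r => /andP[? ?] /andP[? ?].
by apply/andP; split; lra.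
Qed.

End LipschitzCurves.

Section Disk.
Context {R : realType}.
Local Notation plane := (R * R)%type.
Local Notation B := (@unit_disk R).

Definition normsq (x : plane) : R := x.1 ^+ 2 + x.2 ^+ 2.
Definition circle : set plane := [set x | normsq x = 1].

Lemma continuous_affine_form (a b : R) : continuous (fun x : plane => a * x.1 + b * x.2).
Proof.
move=> x; apply: cvgD; apply: cvgM; do ?[exact: cvg_cst].
  exact: cvg_fst.
exact: cvg_snd.
Qed.

Lemma normsq_continuous : continuous normsq.
Proof.
move=> x; apply: cvgD.
  by apply: (cvgM (f := fst) (g := fst)); exact: cvg_fst.
by apply: (cvgM (f := snd) (g := snd)); exact: cvg_snd.
Qed.

Lemma normsq_convex (x y : plane) (t : R) : 0 <= t <= 1 ->
  normsq (t * x.1 + (1 - t) * y.1, t * x.2 + (1 - t) * y.2) <= t * normsq x + (1 - t) * normsq y.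
Proof.
move=> /andP[t0 t1]; rewrite /normsq /= -subr_ge0.
rewrite (_ : _ - _ = t * (1 - t) * ((x.1 - y.1) ^+ 2 + (x.2 - y.2) ^+ 2)); last by ring.
by apply: mulr_ge0; [apply: mulr_ge0; lra|rewrite addr_ge0 ?sqr_ge0].
Qed.

Lemma disk_bounded (A : set plane) : A `<=` B -> bounded_set A.
Proof.
move=> AB; exists 1; split => // M M1 x /AB; rewrite /unit_disk /= => h.
rewrite /Num.norm /= /mx_norm ge_max.
have sq (t : R) : t ^+ 2 < 1 -> `|t| <= M.
  by move=> t1; apply: ltW; apply: lt_trans M1; rewrite -(@ltr_pXn2r _ 2) ?nnegrE// expr1n real_normK ?num_real.
have := sqr_ge0 x.1; have := sqr_ge0 x.2 => h1 h2.
by apply/andP; split; apply: sq; lra.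
Qed.

Lemma disk_open : open B.
Proof.
rewrite (_ : B = normsq @^-1` [set t | t < 1])//.
by apply: open_comp; [move=> x _; exact: normsq_continuous|exact: open_lt].
Qed.

Lemma disk_convex (x y : plane) (t : R) : B x -> B y -> 0 <= t <= 1 ->
  B (t * x.1 + (1 - t) * y.1, t * x.2 + (1 - t) * y.2).
Proof.
move=> Bx By t01; rewrite /unit_disk /=; apply: le_lt_trans (normsq_convex x y t01) _.
exact: lt_convex_combination.
Qed.

Lemma disk_admissible : admissible B.
Proof.
split; [|exact: disk_bounded|exact: disk_open|].
  by exists (0, 0); rewrite /unit_disk /= expr0n addr0.
by apply/convex_setE => x y t; exact: disk_convex.
Qed.

Lemma closure_disk (x : plane) : closure B x -> normsq x <= 1.
Proof.
have cl : closed [set x : plane | normsq x <= 1].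
  rewrite (_ : mkset _ = normsq @^-1` [set t | t <= 1])//.
  by apply: closed_comp; [move=> y _; exact: normsq_continuous|exact: closed_le].
move=> Bx; have := closure_subset (_ : B `<=` [set x : plane | normsq x <= 1]).
move=> /(_ _ x Bx); rewrite -(closure_id _).1//; apply.
by move=> y; exact: ltW.
Qed.

(** Shrinking towards the origin approximates a point from inside. *)
Lemma in_closure (A : set plane) (x : plane) :
  (forall t : R, 0 <= t < 1 -> A (t * x.1, t * x.2)) -> closure A x.
Proof.
move=> H U /nbhs_ballP[e /= e0 eU].
pose N := Num.max `|x.1| `|x.2| + 1.
have N1 : 1 <= N by rewrite /N lerDr le_max normr_ge0.
have N0 : 0 < N by exact: lt_le_trans N1.
pose d := Num.min 1 (e / N).
have d0 : 0 < d by rewrite lt_min ltr01 divr_gt0.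
have d1 : d <= 1 by rewrite ge_min lexx.
exists ((1 - d) * x.1, (1 - d) * x.2); split; first by apply: H; apply/andP; split; lra.
have small (z : R) : `|z| < N -> `|z - (1 - d) * z| < e.
  move=> zN; rewrite (_ : z - _ = d * z); last by ring.
  rewrite normrM (ger0_norm (ltW d0)).
  have dN : d * N <= e by rewrite -ler_pdivlMr// ge_min lexx orbT.
  by apply: lt_le_trans dN; rewrite ltr_pM2l.
apply: eU; split; apply: small; rewrite /N ltr_pwDr// le_max lexx//.
by rewrite orbT.
Qed.

Lemma circle_boundary : circle `<=` closure B `\` interior B.
Proof.
move=> x cx; split.
  apply: in_closure => t /andP[t0 t1]; rewrite /unit_disk /= !exprMn -mulrDr -/(normsq x) cx mulr1.
  by rewrite expr_lt1.
have -> : interior B = B by apply/interior_id; exact: disk_open.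
by rewrite /unit_disk /= -/(normsq x) cx ltxx.
Qed.

Lemma disk_boundary : closure B `\` interior B `<=` circle.
Proof.
move=> x [/closure_disk h1]; have -> : interior B = B by apply/interior_id; exact: disk_open.
by move=> /negP; rewrite /unit_disk /= -leNgt => h2; apply/eqP; rewrite eq_le h1.
Qed.

(** Away from the ends of its diameter the half-circle has bounded slope. *)
Lemma sqrt_lipschitz (t t' : R) : `|t| <= 4 / 5 -> `|t'| <= 4 / 5 ->
  `|Num.sqrt (1 - t ^+ 2) - Num.sqrt (1 - t' ^+ 2)| <= 2 * `|t - t'|.
Proof.
have sq (z : R) : `|z| <= 4 / 5 -> 0 <= 1 - z ^+ 2 /\ 3 / 5 <= Num.sqrt (1 - z ^+ 2).
  rewrite ler_norml => /andP[h1 h2]; have h : z ^+ 2 <= (4 / 5) ^+ 2 by nra.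
  split; first by lra.
  rewrite -[leLHS]ger0_norm ?divr_ge0// -sqrtr_sqr; apply: ler_wsqrtr; lra.
move=> h h'; have [z0 s0] := sq t h; have [z0' s0'] := sq t' h'.
set u := Num.sqrt _ in s0 *; set v := Num.sqrt _ in s0' *.
have hu : u ^+ 2 = 1 - t ^+ 2 by rewrite sqr_sqrtr.
have hv : v ^+ 2 = 1 - t' ^+ 2 by rewrite sqr_sqrtr.
have uv : 0 < u + v by lra.
rewrite -(ler_pM2r uv) -{1}(gtr0_norm uv) -normrM (_ : (u - v) * (u + v) = (t' - t) * (t' + t)); last by nra.
rewrite normrM distrC mulrAC [leRHS]mulrC; apply: ler_pM => //.
by apply: (le_trans (ler_normD _ _)); lra.
Qed.

Lemma graph_edistance (p q : R -> R) (t t' L : R) : 0 <= L ->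
  `|p t - p t'| <= L * `|t - t'| -> `|q t - q t'| <= L * `|t - t'| ->
  edistance (p t, q t) (p t', q t') <= (2 * L) * `|t - t'|.
Proof.
move=> L0 hp hq; rewrite edistance_le /=; last by rewrite !mulr_ge0.
have n0 := normr_ge0 (t - t').
have h1 : (p t - p t') ^+ 2 <= (L * `|t - t'|) ^+ 2.
  by rewrite -[leLHS]real_normK ?num_real// ler_pXn2r ?nnegrE// mulr_ge0.
have h2 : (q t - q t') ^+ 2 <= (L * `|t - t'|) ^+ 2.
  by rewrite -[leLHS]real_normK ?num_real// ler_pXn2r ?nnegrE// mulr_ge0.
have := sqr_ge0 (L * `|t - t'|); rewrite -mulrA exprMn; lra.
Qed.

(** The circle is covered by four Lipschitz graphs. *)
Lemma perimeter_disk_lty : (perimeter B < +oo)%E.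
Proof.
pose I := (`[- (4 / 5), 4 / 5]%classic : set R).
pose s (t : R) := Num.sqrt (1 - t ^+ 2).
pose A1 := (fun t : R => (t, s t)) @` I; pose A2 := (fun t : R => (t, - s t)) @` I.
pose A3 := (fun t : R => (s t, t)) @` I; pose A4 := (fun t : R => (- s t, t)) @` I.
have sub : closure B `\` interior B `<=` set0 `|` A1 `|` A2 `|` A3 `|` A4.
  move=> x /disk_boundary; rewrite /circle /normsq /= => x1.
  have sE (z w : R) : z ^+ 2 + w ^+ 2 = 1 -> s z = `|w|.
    by move=> zw; rewrite /s (_ : 1 - _ = w ^+ 2) ?sqrtr_sqr//; lra.
  have pm (z w : R) : s z = `|w| -> w = s z \/ w = - s z.
    by move=> ->; have [h|h] := leP 0 w; [left; rewrite ger0_norm|right; rewrite ltr0_norm ?opprK].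
  have [h|h] := leP `|x.1| (4 / 5).
    have xI : I x.1 by rewrite /I /= in_itv/= -ler_norml.
    have [E|E] := pm _ _ (sE x.1 x.2 x1).
      by do 3 left; right; exists x.1 => //; rewrite -E -surjective_pairing.
    by do 2 left; right; exists x.1 => //; rewrite -E -surjective_pairing.
  have xI : I x.2.
    rewrite /I /= in_itv/= -ler_norml -(@ler_pXn2r _ 2) ?nnegrE ?divr_ge0// real_normK ?num_real//.
    have : (4 / 5) ^+ 2 < `|x.1| ^+ 2 by rewrite ltr_pXn2r ?nnegrE ?divr_ge0.
    by rewrite real_normK ?num_real//; lra.
  have x1' : x.2 ^+ 2 + x.1 ^+ 2 = 1 by rewrite addrC.
  have [E|E] := pm _ _ (sE x.2 x.1 x1').
    by left; right; exists x.2 => //; rewrite -E -surjective_pairing.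
  by right; exists x.2 => //; rewrite -E -surjective_pairing.
apply: (@le_lt_trans _ _ ((\sum_(i < 4) (2 * 2 * (4 / 5 - - (4 / 5))))%:E)%E); last exact: ltry.
apply: hausdorff1_le => r r0; apply: (le_trans (premeasure_subset r sub)).
have ab : - (4 / 5) <= 4 / 5 :> R by lra.
have sl t t' : I t -> I t' -> `|s t - s t'| <= 2 * `|t - t'|.
  by rewrite /I /= !in_itv/= -!ler_norml; exact: sqrt_lipschitz.
have sn t t' : I t -> I t' -> `|- s t - - s t'| <= 2 * `|t - t'|.
  by move=> It It'; rewrite -opprD normrN; exact: sl.
have il (t t' : R) : `|t - t'| <= 2 * `|t - t'| by rewrite ler_peMl// ler1n.
have L4 : 0 <= 2 * 2 :> R by [].
rewrite !big_ord_recl big_ord0 addr0 !EFinD.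
apply: (le_trans (premeasure_lipschitz_curve _ r0 L4 ab _)).
  by move=> t t' It It'; apply: (graph_edistance (p := fun t => - s t) (q := id)) => //; exact: sn.
rewrite [leRHS]addeC; apply: leeD2r.
apply: (le_trans (premeasure_lipschitz_curve _ r0 L4 ab _)).
  by move=> t t' It It'; apply: (graph_edistance (p := s) (q := id)) => //; exact: sl.
rewrite [leRHS]addeC; apply: leeD2r.
apply: (le_trans (premeasure_lipschitz_curve _ r0 L4 ab _)).
  by move=> t t' It It'; apply: (graph_edistance (p := id) (q := fun t => - s t)) => //; exact: sn.
rewrite [leRHS]addeC; apply: leeD2r.
apply: (le_trans (premeasure_lipschitz_curve _ r0 L4 ab _)).
  by move=> t t' It It'; apply: (graph_edistance (p := id) (q := s)) => //; exact: sl.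
by rewrite premeasure0// add0e.
Qed.

End Disk.

(** * The disk without a cap *)

Section CutDisk.
Context {R : realType}.
Local Notation plane := (R * R)%type.
Local Notation B := (@unit_disk R).
Variable e : plane.
Hypothesis e1 : normsq e = 1.

Definition along (x : plane) : R := e.1 * x.1 + e.2 * x.2.
Definition across (x : plane) : R := - e.2 * x.1 + e.1 * x.2.
Definition frame (a b : R) : plane := (e.1 * a - e.2 * b, e.2 * a + e.1 * b).

Lemma along_frame a b : along (frame a b) = a.
Proof.
transitivity (a * normsq e); last by rewrite e1 mulr1.
by rewrite /along /frame /normsq /=; ring.
Qed.

Lemma across_frame a b : across (frame a b) = b.
Proof.
transitivity (b * normsq e); last by rewrite e1 mulr1.
by rewrite /across /frame /normsq /=; ring.
Qed.

Lemma frameK x : frame (along x) (across x) = x.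
Proof.
rewrite [RHS]surjective_pairing /frame /along /across; congr pair.
  by transitivity (x.1 * normsq e); [rewrite /normsq; ring|rewrite e1 mulr1].
by transitivity (x.2 * normsq e); [rewrite /normsq; ring|rewrite e1 mulr1].
Qed.

Lemma normsq_coordinates x : normsq x = along x ^+ 2 + across x ^+ 2.
Proof.
transitivity (normsq e * normsq x); first by rewrite e1 mul1r.
by rewrite /along /across /normsq; ring.
Qed.

Lemma normsq_frame a b : normsq (frame a b) = a ^+ 2 + b ^+ 2.
Proof. by rewrite normsq_coordinates along_frame across_frame. Qed.

Lemma edistance_frame a b a' b' :
  edistance (frame a b) (frame a' b') = Num.sqrt ((a - a') ^+ 2 + (b - b') ^+ 2).
Proof.
rewrite -normsq_frame /edistance; apply: congr1.
by rewrite /frame /normsq /=; ring.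
Qed.

(** The linear form is the scalar product with a unit vector. *)
Lemma projection_contraction (al be : R) x y : al ^+ 2 + be ^+ 2 = 1 ->
  `|(al * along x + be * across x) - (al * along y + be * across y)| <= edistance x y.
Proof.
move=> ab; rewrite -(@ler_pXn2r _ 2) ?nnegrE ?sqrtr_ge0// real_normK ?num_real//.
rewrite /edistance sqr_sqrtr ?addr_ge0 ?sqr_ge0//.
rewrite -[X in _ <= X]mul1r -{1}ab -[X in _ <= X]mul1r -{1}e1 /normsq /along /across -subr_ge0.
set X := x.1 - y.1; set Y := x.2 - y.2.
rewrite (_ : _ - _ = (al * (- e.2 * X + e.1 * Y) - be * (e.1 * X + e.2 * Y)) ^+ 2) ?sqr_ge0//.
by rewrite /X /Y; ring.
Qed.

Definition cut_disk (c : R) : set plane := B `&` [set x | along x < c].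
Definition cap (c : R) : set plane := B `&` [set x | c < along x].

Lemma along_convex x y (t : R) :
  along (t * x.1 + (1 - t) * y.1, t * x.2 + (1 - t) * y.2) = t * along x + (1 - t) * along y.
Proof. by rewrite /along /=; ring. Qed.

Lemma along_continuous : continuous along.
Proof. exact: continuous_affine_form. Qed.

Lemma cut_disk_admissible c : 0 < c -> admissible (cut_disk c).
Proof.
move=> c0; split.
- by exists (0, 0); split; rewrite /unit_disk /along /= ?expr0n ?mulr0 addr0.
- by apply: disk_bounded => x [].
- apply: openI; first exact: disk_open.
  rewrite (_ : [set x | _] = along @^-1` [set t | t < c])//.
  by apply: open_comp; [move=> x _; exact: along_continuous|exact: open_lt].
- apply/convex_setE => x y t [Bx hx] [By hy] t01; split; first exact: disk_convex.
  by rewrite /= along_convex; exact: lt_convex_combination.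
Qed.

Lemma cap_admissible c : 0 < c < 1 -> admissible (cap c).
Proof.
move=> /andP[c0 c1]; split.
- exists (frame ((1 + c) / 2) 0); split => /=; last by rewrite along_frame; lra.
  change (normsq (frame ((1 + c) / 2) 0) < 1).
  by rewrite normsq_frame expr0n addr0 expr_lt1//; lra.
- by apply: disk_bounded => x [].
- apply: openI; first exact: disk_open.
  rewrite (_ : [set x | _] = along @^-1` [set t | c < t])//.
  by apply: open_comp; [move=> x _; exact: along_continuous|exact: open_gt].
- apply/convex_setE => x y t [Bx hx] [By hy] t01; split; first exact: disk_convex.
  rewrite /= along_convex -ltrN2 opprD -!mulrN.
  by apply: lt_convex_combination => //; rewrite ltrN2.
Qed.

(** The squared distance of a point of the disk to the apex [e] is at most
    [2 - 2 * along x]. *)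
Lemma cap_apex h x : cap (1 - h) x -> (x.1 - e.1) ^+ 2 + (x.2 - e.2) ^+ 2 < 2 * h.
Proof.
move=> [Bx /= hx]; have : normsq x < 1 by [].
have : (x.1 - e.1) ^+ 2 + (x.2 - e.2) ^+ 2 = normsq x + normsq e - 2 * along x.
  by rewrite /normsq /along; ring.
move=> ->; rewrite e1; lra.
Qed.

Lemma cap_diam h x y : cap (1 - h) x -> cap (1 - h) y ->
  (x.1 - y.1) ^+ 2 + (x.2 - y.2) ^+ 2 <= 8 * h.
Proof.
move=> /cap_apex hx /cap_apex hy.
have sq (p q r : R) : (p - q) ^+ 2 <= 2 * (p - r) ^+ 2 + 2 * (q - r) ^+ 2.
  by rewrite -subr_ge0 (_ : _ - _ = (p + q - 2 * r) ^+ 2) ?sqr_ge0//; ring.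
have := sq x.1 y.1 e.1; have := sq x.2 y.2 e.2; lra.
Qed.

(** Contracting by the factor [c] maps the closed disk into the closure of the cut
    disk. *)
Lemma hausdorff_distance_cut c : 0 < c < 1 ->
  (hausdorff_distance (closure (cut_disk c)) (closure B) <= (1 - c)%:E)%E.
Proof.
move=> /andP[c0 c1]; have d0 : 0 <= 1 - c by lra.
rewrite /hausdorff_distance ge_max; apply/andP; split; apply: ge_ereal_sup => _ [x cx <-].
  apply: ge_ereal_inf; exists 0%E; last by rewrite lee_fin.
  exists x; first by apply: closure_subset cx => y [].
  by rewrite /edistance !subrr expr0n addr0 sqrtr0.
have n1 := closure_disk cx.
apply: ge_ereal_inf; exists (edistance x (c * x.1, c * x.2))%:E.
  exists (c * x.1, c * x.2) => //; apply: in_closure => t /andP[t0 t1] /=.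
  have ax : along x <= 1.
    have := normsq_coordinates x; have := sqr_ge0 (across x) => h1 h2.
    have : `|along x| ^+ 2 <= 1 by rewrite real_normK ?num_real//; lra.
    by rewrite expr_le1// ler_norml => /andP[].
  have tc : t * c < c by rewrite gtr_pMl.
  have tc0 : 0 <= t * c by rewrite mulr_ge0// ltW.
  split.
    have E : normsq (t * (c * x.1), t * (c * x.2)) = (t * c) ^+ 2 * normsq x.
      by rewrite /normsq /=; ring.
    change (normsq (t * (c * x.1), t * (c * x.2)) < 1); rewrite E.
    have : (t * c) ^+ 2 < 1 by rewrite expr_lt1//; lra.
    have n0 : 0 <= normsq x by rewrite addr_ge0 ?sqr_ge0.
    have := ler_piMr (sqr_ge0 (t * c)) n1; lra.
  rewrite /= (_ : along _ = t * c * along x); last by rewrite /along /=; ring.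
  have := ler_wpM2l tc0 ax; lra.
rewrite lee_fin edistance_le//=.
have -> : (x.1 - c * x.1) ^+ 2 + (x.2 - c * x.2) ^+ 2 = (1 - c) ^+ 2 * normsq x.
  by rewrite /normsq; ring.
by rewrite ler_piMr// sqr_ge0.
Qed.

Section PerimeterDrop.
Variable eta : R.
Hypothesis eta0 : 0 < eta.
Hypothesis eta1 : eta <= 1 / 2.

(** [c] is the position of the chord when each half of the arc that is cut off has
    a chord of length exactly [eta]: its end points are [(1, 0)] and [(c, y1)] in
    the frame. The loss [tau] makes room between the arcs, and [eta ^+ 3 / 64] is
    small compared with the gain [2 * eta - 2 * y1 >= eta ^+ 3 / 4]. *)
Let c : R := 1 - eta ^+ 2 / 2.
Let s : R := Num.sqrt (1 - eta ^+ 2 / 4).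
Let y1 : R := eta * s.
Let tau : R := eta ^+ 3 / 64.
Let y2 : R := y1 - tau.
Let c2 : R := Num.sqrt (1 - y2 ^+ 2).

Let eta2 : eta ^+ 2 <= 1 / 4.
Proof. have := ler_pM (ltW eta0) (ltW eta0) eta1 eta1; rewrite -expr2; lra. Qed.
Let eta20 : 0 < eta ^+ 2.
Proof. by rewrite exprn_gt0. Qed.
Let eta30 : 0 < eta ^+ 3.
Proof. by rewrite exprn_gt0. Qed.
Let c_ge : 3 / 4 <= c.
Proof. have := eta2; rewrite /c; lra. Qed.
Let sE : s ^+ 2 = 1 - eta ^+ 2 / 4.
Proof. by rewrite sqr_sqrtr//; have := eta2; lra. Qed.
Let s0 : 0 <= s.
Proof. exact: sqrtr_ge0. Qed.
Let s_ge : 3 / 4 <= s.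
Proof. by rewrite -(@ler_pXn2r _ 2) ?nnegrE// sE; have := eta2; lra. Qed.
Let s_le : s <= 1 - eta ^+ 2 / 8.
Proof.
have h2 := eta2; rewrite -(@ler_pXn2r _ 2) ?nnegrE//; last by lra.
by rewrite sE -subr_ge0 (_ : _ - _ = (eta ^+ 2 / 8) ^+ 2) ?sqr_ge0//; field.
Qed.
Let s1 : s <= 1.
Proof. by have := s_le; have := eta20; lra. Qed.
Let y1E : y1 ^+ 2 = 1 - c ^+ 2.
Proof. by rewrite /y1 exprMn sE /c; field. Qed.
Let tau0 : 0 < tau.
Proof. by rewrite divr_gt0. Qed.
Let eta3 : eta ^+ 3 <= eta / 4.
Proof. by rewrite exprS; have := ler_wpM2l (ltW eta0) eta2; lra. Qed.
Let tau_lt : tau < y2.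
Proof.
have : eta * (3 / 4) <= y1 by rewrite /y1 ler_pM2l.
by have := eta3; have := eta0; rewrite /y2 /tau; lra.
Qed.
Let y2_lt : y2 < y1.
Proof. have := tau0; rewrite /y2; lra. Qed.
Let y1_le : y1 <= 1 / 2.
Proof. by have := ler_wpM2l (ltW eta0) s1; have := eta1; rewrite /y1; lra. Qed.
Let y2_sq : y2 ^+ 2 <= 1 / 4.
Proof.
have h0 : 0 <= y2 by have := tau0; have := tau_lt; lra.
have h1 : y2 <= 1 / 2 by have := y2_lt; have := y1_le; lra.
by have := ler_pM h0 h0 h1 h1; rewrite -expr2; lra.
Qed.
Let c2E : c2 ^+ 2 = 1 - y2 ^+ 2.
Proof. by rewrite sqr_sqrtr//; have := y2_sq; lra. Qed.
Let c2_gt : c < c2.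
Proof.
rewrite -(@ltr_pXn2r _ 2) ?nnegrE ?sqrtr_ge0//; last by have := c_ge; lra.
have : y2 ^+ 2 < y1 ^+ 2.
  by rewrite ltr_pXn2r ?nnegrE//; have := tau0; have := tau_lt; have := y2_lt; lra.
by rewrite c2E y1E; lra.
Qed.
Let c2_le : c2 <= c + 2 * tau.
Proof.
have h1 := c_ge; have h2 := y1_le; have h0 := tau0.
rewrite -(@ler_pXn2r _ 2) ?nnegrE ?sqrtr_ge0//; last by lra.
have E : y2 ^+ 2 = 1 - c ^+ 2 - 2 * (y1 * tau) + tau ^+ 2 by rewrite -y1E /y2; ring.
have E2 : (c + 2 * tau) ^+ 2 = c ^+ 2 + 4 * (c * tau) + 4 * tau ^+ 2 by ring.
have h3 := ler_wpM2r (ltW h0) h1; have h4 := ler_wpM2r (ltW h0) h2.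
by rewrite c2E E E2; have := sqr_ge0 tau; lra.
Qed.

Definition long_arc : set plane := [set x | normsq x = 1 /\ along x <= c].
Definition chord : set plane := [set frame c t | t in `[- y1, y1]].
Definition short_arc (sg : R) : set plane :=
  [set x | [/\ normsq x = 1, c2 <= along x & tau <= sg * across x]].

Lemma cut_boundary :
  closure (cut_disk c) `\` interior (cut_disk c) `<=` long_arc `|` chord.
Proof.
move=> x [clx]; have -> : interior (cut_disk c) = cut_disk c.
  by apply/interior_id; case: (@cut_disk_admissible c) => //; have := c_ge; lra.
move=> nx.
have n1 : normsq x <= 1 by apply: closure_disk; apply: closure_subset clx => y [].
have ac : along x <= c.
  have cl : closed [set x : plane | along x <= c].
    rewrite (_ : mkset _ = along @^-1` [set t | t <= c])//.
    by apply: closed_comp; [move=> y _; exact: along_continuous|exact: closed_le].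
  have := closure_subset (_ : cut_disk c `<=` [set x : plane | along x <= c]).
  by move=> /(_ _ x clx); rewrite -(closure_id _).1//; apply=> y [_ /= /ltW].
have [E|ne] := eqVneq (normsq x) 1; first by left.
right; have lt1 : normsq x < 1 by rewrite lt_neqAle ne.
have Ec : along x = c.
  apply/eqP; rewrite eq_le ac /= leNgt; apply/negP => h; apply: nx; split => //.
exists (across x); last by rewrite -Ec frameK.
rewrite /= in_itv/= -ler_norml -(@ler_pXn2r _ 2) ?nnegrE ?mulr_ge0 ?(ltW eta0)// real_normK ?num_real//.
by rewrite y1E; have := normsq_coordinates x; rewrite Ec; lra.
Qed.

(** The projection onto the direction of the chord from [(1, 0)] to [(c, y1)] maps
    the half-arc continuously, hence onto an interval. *)
Lemma short_arc_ge (sg : R) r : sg ^+ 2 = 1 -> ((eta - 4 * tau)%:E <= premeasure r (short_arc sg))%E.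
Proof.
move=> sg1.
have ab : (- (eta / 2)) ^+ 2 + (s * sg) ^+ 2 = 1 by rewrite exprMn sg1 sE; field.
pose phi x := - (eta / 2) * along x + s * sg * across x.
pose f (y : R) := - (eta / 2) * Num.sqrt (1 - y ^+ 2) + s * y.
have cf : continuous f.
  move=> y; apply: cvgD; apply: cvgM; do ?[exact: cvg_cst|exact: cvg_id].
  apply: (@continuous_comp _ _ _ (fun y : R => 1 - y ^+ 2) Num.sqrt); last exact: sqrt_continuous.
  by apply: cvgB; [exact: cvg_cst|exact: exprn_continuous].
have sqs (y : R) : tau <= y <= y2 -> c2 <= Num.sqrt (1 - y ^+ 2) /\ Num.sqrt (1 - y ^+ 2) ^+ 2 = 1 - y ^+ 2.
  move=> /andP[h1 h2]; have h3 : y ^+ 2 <= y2 ^+ 2 by have := tau0; nra.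
  have h4 := y1_le; have h5 := y2_lt; have h6 := tau_lt; have h7 := tau0.
  by split; [apply: ler_wsqrtr; lra|rewrite sqr_sqrtr//; nra].
pose a := - (eta / 2) + 2 * tau; pose b := eta / 2 - 2 * tau.
have fa : f tau <= a.
  rewrite /f /a; have tt : tau <= tau <= y2 by rewrite lexx ltW.
  have [_ h] := sqs _ tt; have h0 := sqrtr_ge0 (1 - tau ^+ 2).
  have h1 : 1 - tau <= Num.sqrt (1 - tau ^+ 2).
    rewrite -(@ler_pXn2r _ 2) ?nnegrE//; last by have := y1_le; have := y2_lt; have := tau_lt; lra.
    by rewrite h; have := tau0; have := y1_le; have := y2_lt; have := tau_lt; nra.
  have h2 : eta / 2 * (1 - tau) <= eta / 2 * Num.sqrt (1 - tau ^+ 2).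
    by rewrite ler_wpM2l// divr_ge0// ltW.
  have h3 : s * tau <= tau by rewrite ler_piMl ?s1// ltW.
  have h4 : eta * tau <= tau by rewrite ler_piMl ?(ltW tau0)//; have := eta1; lra.
  by move: h2; rewrite mulrBr mulr1 mulNr; have := tau0; lra.
have fb : b <= f y2.
  rewrite /f /b -/c2.
  have : s * y1 = eta * s ^+ 2 by rewrite /y1; ring.
  rewrite sE => h1; have h2 := c2_le.
  have h3 : eta / 2 * c2 <= eta / 2 * (c + 2 * tau) by rewrite ler_wpM2l// divr_ge0// ltW.
  have h4 : s * tau <= tau by rewrite ler_piMl ?s1// ltW.
  have h5 : eta * tau <= tau by rewrite ler_piMl ?(ltW tau0)//; have := eta1; lra.
  rewrite /y2 mulrBr h1; move: h3; rewrite /c; lra.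
rewrite (_ : eta - 4 * tau = b - a); last by rewrite /a /b; field.
apply: (@premeasure_ge_projection _ r phi); first by move=> x y; exact: projection_contraction.
move=> v; rewrite /= in_itv/= => /andP[av vb].
have [y yI fy] : exists2 y, y \in `[tau, y2] & f y = v.
  apply: IVT; first exact: ltW.
    exact: continuous_subspaceT.
  have h1 := le_trans fa av; have h2 := le_trans vb fb.
  by rewrite ge_min h1 /= le_max h2 orbT.
move: yI; rewrite in_itv/= => yI; have [h1 h2] := sqs _ yI.
have sgsg : sg * sg = 1 by rewrite -expr2.
exists (frame (Num.sqrt (1 - y ^+ 2)) (sg * y)).
  split; rewrite ?along_frame ?across_frame//.
    by rewrite normsq_frame h2 exprMn sg1 mul1r subrK.
  by rewrite mulrA sgsg mul1r; case/andP: yI.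
rewrite /phi along_frame across_frame -fy /f -[s * sg * _]mulrA (mulrA sg) sgsg mul1r//.
Qed.

Lemma short_arcs_separated x y : short_arc 1 x -> short_arc (-1) y -> 2 * tau <= edistance x y.
Proof.
move=> [_ _ hx] [_ _ hy].
have := @projection_contraction 0 1 x y; rewrite expr0n add0r expr1n => /(_ erefl).
rewrite !mul0r !add0r !mul1r ler_norml => /andP[_]; lra.
Qed.

Lemma long_short_separated sg x y : long_arc x -> short_arc sg y -> c2 - c <= edistance x y.
Proof.
move=> [_ hx] [_ hy _].
have := @projection_contraction 1 0 x y; rewrite expr0n addr0 expr1n => /(_ erefl).
rewrite !mul0r !addr0 !mul1r ler_norml => /andP[+ _]; lra.
Qed.

(** The disk loses both half-arcs, of length at least [eta] each, and gains their
    common chord, of length [2 * eta * sqrt (1 - eta ^+ 2 / 4)]. *)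
Lemma perimeter_cut : (perimeter (cut_disk c) + (eta ^+ 3 / 8)%:E <= perimeter B)%E.
Proof.
rewrite -leeBrDr//; apply: hausdorff1_le => r0 r00; rewrite leeBrDr//.
apply: (@le_trans _ _ (premeasure r0 (long_arc `|` chord) + (eta ^+ 3 / 8)%:E)%E).
  by rewrite leeD2r// premeasure_subset//; exact: cut_boundary.
pose r := Num.min r0 (Num.min tau ((c2 - c) / 2)).
have cc : 0 < c2 - c by rewrite subr_gt0.
have r_gt0 : 0 < r by rewrite !lt_min r00 tau0 divr_gt0.
have [rr0 rt rc] : [/\ r <= r0, r <= tau & r <= (c2 - c) / 2].
  by rewrite /r; split; rewrite !ge_min lexx ?orbT.
apply: (@le_trans _ _ (premeasure r (long_arc `|` chord) + (eta ^+ 3 / 8)%:E)%E).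
  by rewrite leeD2r// premeasure_scale.
have chord_le : (premeasure r (long_arc `|` chord) <= premeasure r long_arc + (2 * y1)%:E)%E.
  have -> : 2 * y1 = 1 * (y1 - - y1) by ring.
  have yy : - y1 <= y1 by have := tau_lt; have := y2_lt; have := tau0; lra.
  apply: (premeasure_lipschitz_curve _ r_gt0 ler01 yy) => t t' _ _.
  by rewrite edistance_frame subrr expr0n add0r sqrtr_sqr mul1r.
apply: (le_trans (leeD2r _ chord_le)); rewrite -addeA -EFinD.
pose b := eta - 4 * tau.
apply: (@le_trans _ _ (premeasure r long_arc + (b%:E + b%:E))%E).
  rewrite leeD2l// -EFinD lee_fin /b /tau /y1.
  have : eta * s <= eta * (1 - eta ^+ 2 / 8) by rewrite ler_pM2l.
  rewrite (_ : eta * (1 - _) = eta - eta ^+ 3 / 8); last by ring.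
  lra.
have one : (1 : R) ^+ 2 = 1 by rewrite expr1n.
have mone : (-1 : R) ^+ 2 = 1 by rewrite sqrrN expr1n.
apply: (@le_trans _ _ (premeasure r (long_arc `|` (short_arc 1 `|` short_arc (-1))))).
  apply: le_trans (premeasure_separated (r := r) _); last first.
    by move=> x y Lx [/(long_short_separated Lx)|/(long_short_separated Lx)]; lra.
  rewrite leeD2l//; apply: le_trans (premeasure_separated (r := r) _); last first.
    by move=> x y /short_arcs_separated /[apply]; have := tau0; lra.
  by apply: leeD; exact: short_arc_ge.
apply: (@le_trans _ _ (premeasure r (closure B `\` interior B))); last first.
  exact: premeasure_le_hausdorff1.
apply: premeasure_subset => x Hx; apply: circle_boundary.
by case: Hx => [[]|[[]|[]]].
Qed.

End PerimeterDrop.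

End CutDisk.

(** * A cap carrying little of an integral *)

Section GoodCap.
Context {R : realType}.
Local Notation plane := (R * R)%type.
Local Notation B := (@unit_disk R).
Variable G : plane -> R.
Hypothesis iG : leb2.-integrable B (EFin \o G).
Hypothesis G0 : forall x, 0 <= G x.

Let mB : @measurable _ (mplane R) B := admissible_measurable disk_admissible.

Definition shell (N : nat) : set plane := B `&` [set x | 1 - N.+1%:R^-1 < normsq x].

Lemma shell_measurable N : @measurable _ (mplane R) (shell N).
Proof.
apply: open_measurable2; apply: openI; first exact: disk_open.
rewrite (_ : [set x | _] = normsq @^-1` [set t | 1 - N.+1%:R^-1 < t])//.
by apply: open_comp; [move=> x _; exact: normsq_continuous|exact: open_gt].
Qed.

Lemma shell_integral_small (eps : R) : 0 < eps ->
  exists N0, forall N, (N0 <= N)%N -> \int[leb2]_(x in B) (G x * \1_(shell N) x) <= eps.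
Proof.
move=> eps0.
pose f N (x : mplane R) : \bar R := (G x * \1_(shell N) x)%:E.
have mG : @measurable_fun _ _ (mplane R) _ B G by exact/measurable_EFinP/measurable_int/iG.
have mf N : measurable_fun B (f N).
  apply/measurable_EFinP; apply: measurable_funM => //.
  by apply: (@measurable_funS _ _ (mplane R) _ setT) => //; apply: measurable_indic; exact: shell_measurable.
have f_cvg : (\int[leb2]_(x in B) f N x)%E @[N --> \oo] --> (\int[leb2]_(x in B) (cst 0%E) x)%E.
  apply: (@dominated_cvg _ (mplane R) R leb2 B mB f (cst 0%E) (EFin \o G)) => //.
    move=> x Bx; have n1 : normsq x < 1 by [].
    apply: cvg_near_cst; exists (Num.truncn (1 - normsq x)^-1) => // N /= hN.
    rewrite /f indicE memNset ?mulr0// => -[_ /=]; apply/negP; rewrite -leNgt.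
    have h0 : 0 < 1 - normsq x by lra.
    have : N.+1%:R^-1 <= 1 - normsq x; last by move: (N.+1%:R^-1) => a; lra.
    rewrite invf_ple ?posrE// ltW//; apply: lt_le_trans (truncnS_gt _) _.
    by rewrite ler_nat ltnS.
  move=> N x Bx; rewrite /f lee_fin normrM (ger0_norm (G0 x)) indicE.
  by case: (_ \in _); rewrite ?normr1 ?mulr1 ?normr0 ?mulr0.
rewrite integral0 in f_cvg.
have /cvgrPdist_le /(_ eps eps0)[N0 _ HN0] :
    (fine \o (fun N => \int[leb2]_(x in B) f N x)%E) @ \oo --> (0 : R) by exact: fine_cvg.
exists N0 => N N0N; have := HN0 N N0N; rewrite /= sub0r normrN; apply: le_trans.
exact: ler_norm.
Qed.

(** Unit vectors whose first coordinates are equally spaced. *)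
Definition direction (N j : nat) : plane := (j%:R / N%:R, Num.sqrt (1 - (j%:R / N%:R) ^+ 2)).

Lemma direction_unit N j : (j < N)%N -> normsq (direction N j) = 1.
Proof.
move=> jN; have N0 : 0 < (N%:R : R) by rewrite ltr0n (leq_trans _ jN).
have h : j%:R / N%:R <= 1 :> R by rewrite ler_pdivrMr// mul1r ler_nat ltnW.
rewrite /normsq /= sqr_sqrtr; first by rewrite addrC subrK.
by rewrite subr_ge0 expr_le1// divr_ge0.
Qed.

(** With [eta = 1 / (3 * N)] the first coordinates of the apexes are [3 * eta] apart,
    while both apexes are within [sqrt 2 * eta] of a common point. *)
Lemma caps_disjoint N i j x : (i < N)%N -> (j < N)%N ->
  cap (direction N i) (1 - (3 * N%:R)^-1 ^+ 2) x ->
  cap (direction N j) (1 - (3 * N%:R)^-1 ^+ 2) x -> i = j.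
Proof.
move=> iN jN /(cap_apex (direction_unit iN)) /= hi /(cap_apex (direction_unit jN)) /= hj.
have N0 : 0 < (N%:R : R) by rewrite ltr0n (leq_trans _ jN).
have h : (i%:R / N%:R - j%:R / N%:R) ^+ 2 < 8 * (3 * N%:R)^-1 ^+ 2 :> R.
  have : (i%:R / N%:R - j%:R / N%:R) ^+ 2 <= 2 * (x.1 - i%:R / N%:R) ^+ 2 + 2 * (x.1 - j%:R / N%:R) ^+ 2.
    set p := i%:R / _; set q := j%:R / _; rewrite -subr_ge0.
    by rewrite (_ : _ - _ = (2 * x.1 - p - q) ^+ 2) ?sqr_ge0//; ring.
  have := sqr_ge0 (x.2 - Num.sqrt (1 - (i%:R / N%:R) ^+ 2)).
  by have := sqr_ge0 (x.2 - Num.sqrt (1 - (j%:R / N%:R) ^+ 2)); lra.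
apply/eqP; rewrite -[_ == _]negbK; apply/negP => ij.
have : 1 <= (i%:R - j%:R : R) ^+ 2.
  wlog ltij : i j {iN jN hi hj h} ij / (i < j)%N => [H|].
    have [ltij|ltji|E] := ltngtP i j; first exact: H.
      by rewrite -sqrrN opprB; apply: H => //; rewrite eq_sym.
    by rewrite E eqxx in ij.
  have : 1 <= j%:R - i%:R :> R by rewrite -natrB ?(ltnW ltij)// ler1n subn_gt0.
  by nra.
have v0 : 0 < (N%:R^-1 : R) by rewrite invr_gt0.
have E : (3 * N%:R)^-1 = N%:R^-1 / 3 :> R by rewrite invfM mulrC.
move: h; rewrite -mulrBl E !exprMn => h hD.
have v2 : 0 < (N%:R^-1 : R) ^+ 2 by rewrite exprn_gt0.
have e9 : (3^-1 : R) ^+ 2 = 1 / 9 by field.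
have := ler_wpM2r (ltW v2) hD; rewrite mul1r; move: h v2; rewrite e9.
by set q := _^-1 ^+ 2; set p := _ * q; lra.
Qed.

(** About [1 / (3 * eta)] disjoint caps share the integral over a thin shell, which
    tends to zero with [eta], so that one of them carries at most [eps * eta]. *)
Lemma good_cap (eps delta : R) : 0 < eps -> 0 < delta -> exists eta (e : plane),
  [/\ 0 < eta, eta <= 1 / 2, eta <= delta, normsq e = 1 &
      \int[leb2]_(x in cap e (1 - eta ^+ 2)) G x <= eps * eta].
Proof.
move=> eps0 delta0; have eps3 : 0 < eps / 3 by rewrite divr_gt0.
have [N0 HN0] := shell_integral_small eps3.
(* [eta <= delta] needs [N >= 1 / delta]; the shell [N - 1] has thickness about [1 / N],
   more than the height [eta ^+ 2] of the caps *)
pose N := (maxn N0 (Num.truncn delta^-1)).+1.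
have NR : 0 < (N%:R : R) by rewrite ltr0n.
pose eta : R := (3 * N%:R)^-1.
have eta0 : 0 < eta by rewrite invr_gt0 mulr_gt0.
have N1 : 1 <= (N%:R : R) by rewrite ler1n.
have Nd : delta^-1 <= N%:R.
  apply: le_trans (ltW (truncnS_gt _)) _.
  by rewrite ler_nat ltnS leq_maxr.
have eN : N%:R * eta = 1 / 3 by rewrite /eta; field; rewrite gt_eqF.
have eta3 : eta <= 1 / 3 by rewrite -eN ler_peMl// ltW.
have eta2 : eta ^+ 2 <= 1 / 9 by rewrite expr2; have := ler_pM (ltW eta0) (ltW eta0) eta3 eta3; lra.
have eta20 : 0 < eta ^+ 2 by rewrite exprn_gt0.
have NV : N%:R^-1 = 3 * eta by rewrite /eta; field; rewrite gt_eqF.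
have [j Hj] : exists j : 'I_N, \int[leb2]_(x in cap (direction N j) (1 - eta ^+ 2)) G x <= eps * eta.
  apply/not_existsP => Hj.
  have cm (j : 'I_N) : @measurable _ (mplane R) (cap (direction N j) (1 - eta ^+ 2)).
    apply: admissible_measurable; apply: cap_admissible; first exact: direction_unit.
    by apply/andP; split; lra.
  have capB j : cap (direction N j) (1 - eta ^+ 2) `<=` B by move=> x [].
  pose g (j : 'I_N) x := G x * \1_(cap (direction N j) (1 - eta ^+ 2)) x.
  have gle (A : set plane) : @measurable _ (mplane R) A -> leb2.-integrable B (EFin \o (fun x => G x * \1_A x)).
    move=> mA; apply: le_integrable iG => //.
      apply/measurable_EFinP; apply: measurable_funM; first exact/measurable_EFinP/measurable_int/iG.
      by apply: (@measurable_funS _ _ (mplane R) _ setT) => //; exact/measurable_indic.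
    move=> x Bx /=; rewrite lee_fin normrM indicE.
    by case: (_ \in _); rewrite ?normr1 ?mulr1 ?normr0 ?mulr0.
  have [ig Eg] := Rintegral_sum mB (fun j : 'I_N => gle _ (cm j)).
  have gE (j : 'I_N) : \int[leb2]_(x in B) g j x = \int[leb2]_(x in cap (direction N j) (1 - eta ^+ 2)) G x.
    rewrite (restrict_supp (capB j)); last first.
      by move=> x nx; rewrite /g indicE memNset ?mulr0.
    by apply: eq_Rintegral => x xc; rewrite /g indicE xc mulr1.
  have : \int[leb2]_(x in B) (\sum_(j < N) g j x) <= eps / 3.
    apply: le_trans (HN0 N.-1 _); last by rewrite /N /= leq_maxl.
    apply: le_Rintegral => //; first by apply: gle; exact: shell_measurable.
    move=> x Bx; rewrite /g -mulr_sumr; apply: ler_wpM2l => //.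
    have [[j xj]|nx] := pselect (exists j : 'I_N, cap (direction N j) (1 - eta ^+ 2) x).
      rewrite (bigD1 j)//= big1 => [|i ij]; last first.
        rewrite indicE memNset// => xi; case/negP: ij; apply/eqP/val_inj.
        exact: (caps_disjoint (ltn_ord i) (ltn_ord j) xi xj).
      rewrite addr0 !indicE mem_set//= mem_set//; split => //=.
      have [_ /= hx] := xj; have dj := direction_unit (ltn_ord j).
      rewrite (normsq_coordinates dj); have := sqr_ge0 (across (direction N j) x).
      have h0 : 0 <= 1 - eta ^+ 2 by lra.
      have h1 : (1 - eta ^+ 2) * (1 - eta ^+ 2) < along (direction N j) x * along (direction N j) x.
        exact: ltr_pM.
      have h2 := ler_wpM2l (ltW eta0) eta3; rewrite -expr2 in h2.
      have -> : (N.-1.+1%:R : R) = N%:R by [].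
      rewrite NV [along _ _ ^+ 2]expr2; have := sqr_ge0 (eta ^+ 2); move: h1.
      by rewrite mulrBl mul1r mulrBr mulr1 -expr2; lra.
    rewrite big1 => [|i _]; first by rewrite indicE.
    by rewrite indicE memNset// => xi; apply: nx; exists i.
  rewrite Eg leNgt => /negP; apply.
  have -> : eps / 3 = \sum_(j < N) (eps * eta).
    by rewrite sumr_const card_ord -mulr_natl /eta; field; rewrite gt_eqF.
  apply: ltr_sum => [|j _]; first by apply/hasP; exists ord0; rewrite ?mem_index_enum.
  by rewrite gE ltNge; apply/negP; exact: Hj.
exists eta, (direction N j); split => //.
- rewrite /eta invf_ple ?posrE ?mulr_gt0//; lra.
- rewrite /eta invf_ple ?posrE ?mulr_gt0//; lra.
- exact: direction_unit.
Qed.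

End GoodCap.

(** A relative gain on the perimeter outweighs the same relative loss on the
    eigenvalue, because the perimeter is squared. *)
Lemma gain_beats_loss (R : realType) (p P x y l : R) : 0 <= p -> 0 < x -> p + x <= P ->
  P * y < x -> y < 1 -> 0 < l -> p ^+ 2 * (l / (1 - y)) < P ^+ 2 * l.
Proof.
move=> p0 x0 pP Py y1 l0; have y10 : 0 < 1 - y by lra.
rewrite mulrA ltr_pdivrMr// [ltRHS]mulrAC ltr_pM2r//.
have Pp : 0 < P by lra.
have h1 : p * p <= (P - x) * (P - x) by rewrite ler_pM//; lra.
have h2 : 0 <= x * (P - x) by rewrite mulr_ge0//; lra.
have h3 : P * (P * y) < P * x by rewrite ltr_pM2l.
by rewrite !expr2; lra.
Qed.

(** * The theorem *)

Theorem theorem3p3 (R : realType) (k : nat) (hk : (1 <= k)%N)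
  (hmu : neumann_mu (@unit_disk R) k.-1 = neumann_mu (@unit_disk R) k) :
  ~ local_minimizer
      (fun Omega : set (R * R) =>
         (perimeter Omega ^+ 2 * neumann_mu Omega k.-1)%E)
      (@unit_disk R).
Proof.
case: k hk hmu => // k _ /= hmu [delta delta0 minB].
have aB := @disk_admissible R.
have mB := admissible_measurable aB.
have [W fW] := test_family aB k.+2.
have [lam [u es]] := spectral (energy_semi_inner aB) (mass_semi_inner aB)
  (energy_graph_complete aB) (energy_compact aB) fW.
have lam0 : 0 < lam k.+1.
  have diamB x y : @unit_disk R x -> @unit_disk R y -> (x.1 - y.1) ^+ 2 + (x.2 - y.2) ^+ 2 <= 4.
    rewrite /unit_disk /= => hx hy.
    by have := sqr_ge0 (x.1 + y.1); have := sqr_ge0 (x.2 + y.2); lra.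
  apply: lt_le_trans (second_eigenvalue_gt0 aB diamB es isT) _.
  exact: (eigensystem_monotone es).
have mu_ge : ((lam k.+1)%:E <= neumann_mu (@unit_disk R) k)%E.
  by rewrite hmu; exact: eigensystem_le_mu es.
have Pfin : perimeter (@unit_disk R) \is a fin_num.
  by rewrite ge0_fin_numE ?perimeter_disk_lty// hausdorff1_ge0.
have [P EP] : exists P : R, perimeter (@unit_disk R) = P%:E.
  by exists (fine (perimeter (@unit_disk R))); rewrite fineK.
have P0 : 0 <= P by rewrite -lee_fin -EP hausdorff1_ge0.
pose G x := \sum_(i < k.+2) gradsq (H1grad (u i)) x.
have iu (i : 'I_k.+2) : leb2.-integrable (@unit_disk R) (EFin \o gradsq (H1grad (u i))).
  exact: (gradsq_integrable aB).
have [iG _] := Rintegral_sum mB iu.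
have G0 x : 0 <= G x by apply: sumr_ge0 => i _; rewrite addr_ge0 ?sqr_ge0.
(* the relative loss will be [y = 32 * eps * eta ^+ 3], against a gain of
   [x = eta ^+ 3 / 8] on the perimeter: [P * y < x] means [256 * eps * P < 1] *)
pose eps := (257 * (1 + P))^-1.
have P1 : 0 < 257 * (1 + P) by lra.
have eps0 : 0 < eps by rewrite invr_gt0.
have epsP : 257 * (eps * P) <= 1 - 257 * eps.
  have : eps * (257 * (1 + P)) = 1 by rewrite mulVf ?gt_eqF.
  lra.
have [eta [e [eta0 eta1 etad e1 small]]] := good_cap iG G0 eps0 delta0.
have eta2 : eta ^+ 2 <= eta / 2.
  by rewrite expr2; have := ler_wpM2l (ltW eta0) eta1; lra.
have eta20 : 0 < eta ^+ 2 by rewrite exprn_gt0.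
have eta30 : 0 < eta ^+ 3 by rewrite exprn_gt0.
have eta3 : eta ^+ 3 <= 1 / 8.
  rewrite exprS; have h : eta ^+ 2 <= 1 / 4 by lra.
  by have := ler_pM (ltW eta0) (ltW eta20) eta1 h; lra.
pose c := 1 - eta ^+ 2 / 2.
have c01 : 0 < c < 1 by apply/andP; rewrite /c; split; lra.
have aO : admissible (cut_disk e c) by apply: cut_disk_admissible => //; case/andP: c01.
have aC : admissible (cap e (1 - eta ^+ 2)).
  by apply: cap_admissible => //; apply/andP; split; lra.
(* [8 * eta ^+ 2] bounds the squared diameter of the cap of height [eta ^+ 2] *)
pose y := 4 * (8 * eta ^+ 2) * (eps * eta).
have yE : y = 32 * (eps * eta ^+ 3) by rewrite /y; ring.
have y1 : y < 1.
  have he : 257 * eps <= 1.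
    by have := mulr_ge0 (ltW eps0) P0; lra.
  have := ler_wpM2l (ltW eps0) eta3; rewrite yE; lra.
have muO : (neumann_mu (cut_disk e c) k <= (lam k.+1 / (1 - y))%:E)%E.
  apply: (neumann_mu_cut aB aO aC _ _ _ (@cap_diam _ _ e1 (eta ^+ 2)) es _ y1).
  - by move=> x [].
  - by move=> x [].
  - move=> x Bx; have [h|h] := ltP (along e x) c; [left|right]; split => //=.
    by apply: lt_le_trans h; rewrite /c; lra.
  - rewrite -(Rintegral_sum _ _).2//; first exact: admissible_measurable.
    by move=> i; apply: (gradsq_integrable aB); [exact: admissible_measurable|move=> x []].
have near : (hausdorff_distance (closure (cut_disk e c)) (closure (@unit_disk R)) < delta%:E)%E.
  apply: le_lt_trans (hausdorff_distance_cut e1 c01) _.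
  by rewrite lte_fin /c; lra.
have := minB _ aO near; rewrite leNgt => /negP; apply.
have drop := perimeter_cut e1 eta0 eta1; rewrite -/c EP in drop.
have [p Ep] : exists p : R, perimeter (cut_disk e c) = p%:E.
  exists (fine (perimeter (cut_disk e c))); rewrite fineK// ge0_fin_numE ?hausdorff1_ge0//.
  apply: (@le_lt_trans _ _ P%:E); last exact: ltry.
  by apply: le_trans drop; rewrite leeDl// lee_fin divr_ge0// ltW.
have p0 : 0 <= p by rewrite -lee_fin -Ep hausdorff1_ge0.
move: drop; rewrite Ep -EFinD lee_fin => pP.
rewrite EP -!EFinM -!expr2.
apply: (@le_lt_trans _ _ ((p ^+ 2)%:E * (lam k.+1 / (1 - y))%:E)%E).
  by rewrite lee_wpmul2l// lee_fin sqr_ge0.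
apply: (@lt_le_trans _ _ ((P ^+ 2)%:E * (lam k.+1)%:E)%E); last first.
  by rewrite lee_wpmul2l// lee_fin sqr_ge0.
rewrite -!EFinM lte_fin.
apply: (gain_beats_loss p0 _ pP _ y1 lam0); first by rewrite divr_gt0.
by rewrite yE; move: epsP eps0 eta30; set q := eta ^+ 3 => ? ? q0; nra.
Qed.
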